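(* Let $m$ and $n$ be natural numbers (positive integers), let $\mathbb{K}$ be a field, let $q\in\mathbb{K}^*$ be not a root of unity, and let $\mathcal{H}=(\mathbb{K}^* )^{m+n}$ act on the algebra $\mathcal{O}_q(M_{m,n})$ of $m\times n$ quantum matrices by $(a_1,\dots,a_m,b_1,\dots,b_n)\cdot Y_{i,\alpha}=a_ib_\alpha Y_{i,\alpha}$. Then the dimensions of the $\mathcal{H}$-strata in $\mathcal{O}_q(M_{m,n})$ are all at most $\min(m,n)$; moreover, for each $d\in\{0,1,\ldots,\min(m,n)\}$ there exists a $d$-dimensional $\mathcal{H}$-stratum.
   Context: $\mathbb{K}^*=\mathbb{K}\setminus\{0\}$. The algebra $\mathcal{O}_q(M_{m,n})$ is the $\mathbb{K}$-algebra generated by $Y_{i,\alpha}$, $1\le i\le m$, $1\le\alpha\le n$, subject to the relations - $Y_{i,\beta}Y_{i,\alpha}=q^{-1}Y_{i,\alpha}Y_{i,\beta}$ for $\alpha<\beta$; - $Y_{j,\alpha}Y_{i,\alpha}=q^{-1}Y_{i,\alpha}Y_{j,\alpha}$ for $i<j$; - $Y_{j,\beta}Y_{i,\alpha}=Y_{i,\alpha}Y_{j,\beta}$ for $i<j$, $\alpha>\beta$; - $Y_{j,\beta}Y_{i,\alpha}=Y_{i,\alpha}Y_{j,\beta}-(q-q^{-1})Y_{i,\beta}Y_{j,\alpha}$ for $i<j$, $\alpha<\beta$. The torus $\mathcal{H}$ acts by $\mathbb{K}$-algebra automorphisms. A two-sided ideal $I$ is $\mathcal{H}$-invariant if $h\cdot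 I=I$ for all $h\in\mathcal{H}$. An $\mathcal{H}$-prime ideal is a proper $\mathcal{H}$-invariant ideal $J$ such that whenever $J$ contains a product of two $\mathcal{H}$-invariant ideals, it contains at least one of them. For a prime ideal $P$ of $A=\mathcal{O}_q(M_{m,n})$, the ideal $(P:\mathcal{H}):=\bigcap_{h\in\mathcal{H}}h\cdot P$ is $\mathcal{H}$-prime. For an $\mathcal{H}$-prime $J$, the $\mathcal{H}$-stratum associated to $J$ is $\mathrm{Spec}_J(A)=\{P\in\mathrm{Spec}(A)\mid (P:\mathcal{H})=J\}$, with the topology induced by the Zariski topology of $\mathrm{Spec}(A)$. It is known that each $\mathcal{H}$-stratum is homeomorphic to $\mathrm{Spec}(\mathbb{K}[z_1^{\pm1},\dots,z_d^{\pm1}])$ for some $d$ depending on $J$; this $d$ is the (Krull) dimension of the $\mathcal{H}$-stratum. *)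

(* Defs.v *)
From HB Require Import structures.
From mathcomp Require Import all_boot all_algebra all_classical.
From mathcomp Require Import topology_structure subtype_topology.
From mathcomp Require Import finmap ring.
From mathcomp.multinomials Require Import monalg.

Set Implicit Arguments.
Unset Strict Implicit.
Unset Printing Implicit Defensive.

Import GRing.Theory.

Local Open Scope classical_set_scope.
Local Open Scope ring_scope.
Local Open Scope quotient_scope.

Section Ideals.
Variable R : nzRingType.
Implicit Types (I J P S : set R).

Definition ideal I : Prop :=
  [/\ I 0, forall x y, I x -> I y -> I (x + y),
      forall a x, I x -> I (a * x) & forall a x, I x -> I (x * a)].

Definition ideal_gen S : set R :=
  \bigcap_(I in [set I | ideal I /\ S `<=` I]) I.

Definition ideal_mul I J : set R :=
  ideal_gen [set z | exists x y, [/\ I x, J y & z = x * y]].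

Definition prime_ideal P : Prop :=
  [/\ ideal P, P != setT &
      forall I J, ideal I -> ideal J ->
        ideal_mul I J `<=` P -> I `<=` P \/ J `<=` P].

Lemma idealN I x : ideal I -> I x -> I (- x).
Proof. by case=> _ _ IMl _ Ix; rewrite -mulN1r; exact: IMl. Qed.

Lemma ideal_gen_ideal S : ideal (ideal_gen S).
Proof.
split.
- by move=> I [[]].
- by move=> x y Sx Sy I IS; case: (IS) => -[_ ID _ _] _; apply: ID; [exact: Sx|exact: Sy].
- by move=> a x Sx I IS; case: (IS) => -[_ _ IM _] _; apply: IM; exact: Sx.
- by move=> a x Sx I IS; case: (IS) => -[_ _ _ IM] _; apply: IM; exact: Sx.
Qed.

Lemma sub_ideal_gen S : S `<=` ideal_gen S.
Proof. by move=> x Sx I [_]; exact. Qed.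

End Ideals.

Lemma ideal_ker (R : nzRingType) (R' : nzRingType) (f : {rmorphism R -> R'}) :
  ideal [set x | f x = 0].
Proof.
split=> /=; first exact: rmorph0.
- by move=> x y fx fy; rewrite rmorphD fx fy addr0.
- by move=> a x fx; rewrite rmorphM fx mulr0.
- by move=> a x fx; rewrite rmorphM fx mul0r.
Qed.

Section Spectrum.
Variable R : nzRingType.

Record spec := Spec { spec_ideal :> set R ; spec_prime : prime_ideal spec_ideal }.

HB.instance Definition _ := gen_eqMixin spec.
HB.instance Definition _ := gen_choiceMixin spec.

Definition zariski_open : set_system spec :=
  [set U | exists2 I : set R, ideal I & U = [set P : spec | ~ (I `<=` P)]].

Let zariski_openT : zariski_open setT.
Proof.
exists setT; first by split.
apply/seteqP; split=> // -[P [? /eqP PT ?]] _ /= TP.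
by apply: PT; apply/seteqP.
Qed.

Let zariski_openI : setI_closed zariski_open.
Proof.
move=> _ _ [I idI ->] [J idJ ->].
exists (ideal_mul I J); first exact: ideal_gen_ideal.
apply/seteqP; split=> -[P primeP] /=; case: (primeP) => idP _ PP.
  by move=> [nIP nJP] /PP[].
case: idI idJ => I0 ID IMl IMr [J0 JD JMl JMr].
move=> nIJP; split=> sP; apply: nIJP => z; apply; split=> // _ [x [y [Ix Jy ->]]];
  apply: sP; [exact: IMr|exact: JMl].
Qed.

Let zariski_open_bigU (T : Type) (f : T -> set spec) :
  (forall i, zariski_open (f i)) -> zariski_open (\bigcup_i f i).
Proof.
move=> fo.
exists (ideal_gen [set x | exists i I,
  [/\ ideal I, f i = [set P : spec | ~ (I `<=` P)] & I x]]).
  exact: ideal_gen_ideal.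
apply/seteqP; split=> P /=.
  move=> [i _ fiP] sP; have [I idI fiE] := fo i.
  move: fiP; rewrite fiE; apply=> x Ix; apply: sP; apply: sub_ideal_gen.
  by exists i, I.
apply: contra_notP => nP x; apply; split; first by case: (spec_prime P).
move=> y [i [I [idI fiE]]]; apply: contraPP => nPy Iy; apply: nP.
by exists i => //; rewrite fiE => /(_ y Iy).
Qed.

HB.instance Definition _ :=
  isOpenTopological.Build spec zariski_openT zariski_openI zariski_open_bigU.

End Spectrum.

Definition homeomorphic (T U : topologicalType) : Prop :=
  exists (f : T -> U) (g : U -> T),
    [/\ continuous f, continuous g, cancel f g & cancel g f].

Section MalgComplements.
Variables (K : comNzRingType) (M : monomType).

Lemma malgUZ (c : K) (w : M) : << c *g w >> = c *: << w >> :> {malg K[M]}.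
Proof. by apply/malgP=> w'; rewrite mcoeffZ !mcoeffU mulr_natr. Qed.

Lemma malgUM (w1 w2 : M) :
  << w1 >> * << w2 >> = << mmul w1 w2 >> :> {malg K[M]}.
Proof. by rewrite malgM_def fgmulUU mulr1. Qed.

End MalgComplements.

(* The K-algebra freely generated by X: the algebra of the free monoid on X. *)
Section FreeAlgebra.
Variables (K : fieldType) (X : choiceType).

Definition freealg := {malg K[{fmonom X}]}.

HB.instance Definition _ := GRing.Lalgebra.on freealg.

Let freealg_scalerAr (k : K) (x y : freealg) : k *: (x * y) = x * (k *: y).
Proof.
rewrite (malgMEw (fsubset_refl _) (msuppZ_le k y)) malgME scaler_sumr.
apply: eq_bigr => i _; rewrite scaler_sumr; apply: eq_bigr => j _.
by rewrite mcoeffZ mulrCA malgUZ [in RHS]malgUZ scalerA.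
Qed.

HB.instance Definition _ :=
  GRing.Lalgebra_isAlgebra.Build K freealg freealg_scalerAr.

Definition gen (x : X) : freealg := << fmu x >>.

Variables (B : algType K) (v : X -> B).

Definition word_eval (w : {fmonom X}) : B := \prod_(x <- w) v x.

Let word_eval_morph : mmorphism word_eval.
Proof.
split=> [w1 w2|]; first by rewrite /word_eval fmM big_cat.
by rewrite /word_eval fm1 big_nil.
Qed.

HB.instance Definition _ :=
  isMultiplicative.Build {fmonom X} B word_eval word_eval_morph.

Definition free_eval : freealg -> B := mmap (in_alg B) word_eval.

Let free_eval_additive : additive free_eval.
Proof. by move=> x y; rewrite /free_eval raddfB. Qed.

HB.instance Definition _ :=
  GRing.isAdditive.Build freealg B free_eval free_eval_additive.

Let free_eval_multiplicative : multiplicative free_eval.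
Proof.
apply: commr_mmap_is_multiplicative => g m m'.
by rewrite /GRing.comm /= mulr_algl mulr_algr.
Qed.

HB.instance Definition _ :=
  GRing.isMultiplicative.Build freealg B free_eval free_eval_multiplicative.

Let free_eval_scalable : scalable free_eval.
Proof. by move=> a x; rewrite /free_eval mmapZ /= mulr_algl. Qed.

HB.instance Definition _ :=
  GRing.isScalable.Build K freealg B *:%R free_eval free_eval_scalable.

Lemma free_eval_gen x : free_eval (gen x) = v x.
Proof.
by rewrite /free_eval /gen mmapU /= scale1r mul1r /word_eval fmU big_seq1.
Qed.

Lemma free_evalZ k x : free_eval (k *: x) = k *: free_eval x.
Proof. exact: linearZ. Qed.

Lemma free_evalB x y : free_eval (x - y) = free_eval x - free_eval y.
Proof. exact: rmorphB. Qed.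

Lemma free_evalM x y : free_eval (x * y) = free_eval x * free_eval y.
Proof. exact: rmorphM. Qed.

Lemma free_eval1 : free_eval 1 = 1.
Proof. exact: rmorph1. Qed.

Lemma free_eval_uniq (f : {lrmorphism freealg -> B}) :
  (forall x, f (gen x) = v x) -> f =1 free_eval.
Proof.
move=> fv g; rewrite [g](@monalgE {fmonom X} K) /free_eval !raddf_sum /=.
apply: eq_bigr => w _; rewrite mmapU /= mulr_algl.
rewrite malgUZ [LHS]linearZ; congr (_ *: _); rewrite /word_eval; case: w => w /=.
elim: w => [|x w IH].
  by rewrite big_nil -(rmorph1 f); congr (f << _ >>); rewrite -fmoneE.
rewrite big_cons -IH -fv -rmorphM; congr (f _).
transitivity (<< fmmul (fmu x) (FMonom w) >> : freealg).
  by rewrite fmmulE fmuE.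
by symmetry; exact: malgUM.
Qed.

End FreeAlgebra.

(* The algebra A / (S), for S generating a proper two-sided ideal. *)
Section QuotientAlgebra.
Variables (K : fieldType) (A : algType K) (S : set A).
Hypothesis S_proper : ~ ideal_gen S 1.

Let I := ideal_gen S.
Let idI : ideal I := ideal_gen_ideal S.

Definition ideal_equiv (x y : A) : bool := `[< ideal_gen S (x - y) >].

Lemma ideal_equivP : equiv_class_of ideal_equiv.
Proof.
case: (idI) => I0 ID _ _; split.
- by move=> x; apply/asboolP; rewrite subrr.
- by move=> x y; apply/asboolP/asboolP=> /(idealN idI); rewrite opprB.
- move=> y x z /asboolP xy /asboolP yz; apply/asboolP.
  by rewrite -(subrKA y); exact: ID.
Qed.

Canonical ideal_equiv_rel := EquivRelPack ideal_equivP.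

Definition quotalg of ~ ideal_gen S 1 := {eq_quot ideal_equiv}.

Local Notation Q := (quotalg S_proper).

HB.instance Definition _ := Choice.on Q.
HB.instance Definition _ := EqQuotient.on Q.

Lemma quotalgP x y : reflect (ideal_gen S (x - y)) (x == y %[mod Q]).
Proof. by rewrite eqmodE; exact: asboolP. Qed.

Let piP x y : I (x - y) -> \pi_Q x = \pi_Q y.
Proof. by move=> xy; apply/eqP/quotalgP. Qed.

Let repr_pi x : I (repr (\pi_Q x) - x).
Proof. by apply/quotalgP; rewrite reprK. Qed.

(* The operations are locked so that unification never unfolds them. *)
Fact quotalg_key : unit. Proof. exact: tt. Qed.
Local Notation lock_op := (locked_with quotalg_key).

Definition qzero : Q := lock_op (\pi_Q 0).
Definition qone : Q := lock_op (\pi_Q 1).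
Definition qopp : Q -> Q := lock_op (fun x => \pi_Q (- repr x)).
Definition qadd : Q -> Q -> Q := lock_op (fun x y => \pi_Q (repr x + repr y)).
Definition qmul : Q -> Q -> Q := lock_op (fun x y => \pi_Q (repr x * repr y)).
Definition qscale : K -> Q -> Q := lock_op (fun k x => \pi_Q (k *: repr x)).
Definition quotalg_pi : A -> Q := lock_op (fun x => \pi_Q x).

Let pi_zero : qzero = \pi_Q 0. Proof. exact: unlock. Qed.

Let pi_one : qone = \pi_Q 1. Proof. exact: unlock. Qed.

Let quotalg_piE x : quotalg_pi x = \pi_Q x.
Proof. by rewrite /quotalg_pi unlock. Qed.

Let pi_opp x : qopp (\pi_Q x) = \pi_Q (- x).
Proof. by rewrite /qopp unlock; apply: piP; rewrite -opprD; exact: (idealN idI (repr_pi _)). Qed.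

Let pi_add x y : qadd (\pi_Q x) (\pi_Q y) = \pi_Q (x + y).
Proof.
by rewrite /qadd unlock; apply: piP; rewrite opprD addrACA; case: idI => _ ID _ _; apply: ID. Qed.

Let pi_mul x y : qmul (\pi_Q x) (\pi_Q y) = \pi_Q (x * y).
Proof.
rewrite /qmul unlock; apply: piP; case: idI => _ ID IMl IMr.
rewrite -(subrKA (repr (\pi_Q x) * y)) -mulrBr -mulrBl.
by apply: ID; [apply: IMl|apply: IMr].
Qed.

Let pi_scale k x : qscale k (\pi_Q x) = \pi_Q (k *: x).
Proof.
rewrite /qscale unlock; apply: piP; case: idI => _ _ IMl _.
by rewrite -scalerBr -mulr_algl; apply: IMl.
Qed.

Let Qind (P : Q -> Prop) : (forall x, P (\pi_Q x)) -> forall x, P x.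
Proof. by move=> Ppi x; rewrite -(reprK x). Qed.

Let qaddA : associative qadd.
Proof. by do 3![elim/Qind=> ?]; rewrite !pi_add addrA. Qed.
Let qaddC : commutative qadd.
Proof. by do 2![elim/Qind=> ?]; rewrite !pi_add addrC. Qed.
Let qadd0 : left_id qzero qadd.
Proof. by elim/Qind=> ?; rewrite pi_zero pi_add add0r. Qed.
Let qaddN : left_inverse qzero qopp qadd.
Proof. by elim/Qind=> ?; rewrite pi_opp pi_add addNr pi_zero. Qed.

HB.instance Definition _ := GRing.isZmodule.Build Q qaddA qaddC qadd0 qaddN.

Let qmulA : associative qmul.
Proof. by do 3![elim/Qind=> ?]; rewrite !pi_mul mulrA. Qed.
Let qmul1l : left_id qone qmul.
Proof. by elim/Qind=> ?; rewrite pi_one pi_mul mul1r. Qed.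
Let qmul1r : right_id qone qmul.
Proof. by elim/Qind=> ?; rewrite pi_one pi_mul mulr1. Qed.
Let qmulDl : left_distributive qmul qadd.
Proof. by do 3![elim/Qind=> ?]; rewrite pi_add !pi_mul pi_add mulrDl. Qed.
Let qmulDr : right_distributive qmul qadd.
Proof. by do 3![elim/Qind=> ?]; rewrite pi_add !pi_mul pi_add mulrDr. Qed.
Let qone_neq0 : qone != qzero.
Proof. by rewrite pi_one pi_zero; apply/quotalgP; rewrite subr0. Qed.

HB.instance Definition _ :=
  GRing.Zmodule_isNzRing.Build Q qmulA qmul1l qmul1r qmulDl qmulDr qone_neq0.

Let qscaleA a b x : qscale a (qscale b x) = qscale (a * b) x.
Proof. by elim/Qind: x => ?; rewrite !pi_scale scalerA. Qed.
Let qscale1 : left_id 1 qscale.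
Proof. by elim/Qind=> ?; rewrite pi_scale scale1r. Qed.
Let qscaleDr : right_distributive qscale +%R.
Proof.
move=> a x y; elim/Qind: x => x; elim/Qind: y => y.
rewrite -[LHS]/(qscale _ (qadd _ _)) -[RHS]/(qadd (qscale _ _) (qscale _ _)).
by rewrite pi_add !pi_scale pi_add scalerDr.
Qed.
Let qscaleDl x : {morph qscale^~ x : a b / a + b}.
Proof.
move=> a b; elim/Qind: x => ?.
by rewrite -[RHS]/(qadd (qscale _ _) (qscale _ _)) !pi_scale pi_add scalerDl.
Qed.

HB.instance Definition _ :=
  GRing.Zmodule_isLmodule.Build K Q qscaleA qscale1 qscaleDr qscaleDl.

Let qscaleAl (k : K) (x y : Q) : k *: (x * y) = (k *: x) * y.
Proof.
elim/Qind: x => x; elim/Qind: y => y.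
by rewrite -[LHS]/(qscale _ (qmul _ _)) -[RHS]/(qmul (qscale _ _) _)
  !(pi_scale, pi_mul) scalerAl.
Qed.

HB.instance Definition _ := GRing.Lmodule_isLalgebra.Build K Q qscaleAl.

Let qscaleAr (k : K) (x y : Q) : k *: (x * y) = x * (k *: y).
Proof.
elim/Qind: x => x; elim/Qind: y => y.
by rewrite -[LHS]/(qscale _ (qmul _ _)) -[RHS]/(qmul _ (qscale _ _))
  !(pi_scale, pi_mul) scalerAr.
Qed.

HB.instance Definition _ := GRing.Lalgebra_isAlgebra.Build K Q qscaleAr.

Let quotalg_pi_additive : additive quotalg_pi.
Proof.
by move=> x y; rewrite -[RHS]/(qadd _ (qopp _)) !quotalg_piE pi_opp pi_add.
Qed.
HB.instance Definition _ := GRing.isAdditive.Build A Q quotalg_pi quotalg_pi_additive.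

Let quotalg_pi_multiplicative : multiplicative quotalg_pi.
Proof.
split=> [x y|]; last by rewrite quotalg_piE -pi_one.
by rewrite -[RHS]/(qmul _ _) !quotalg_piE pi_mul.
Qed.
HB.instance Definition _ :=
  GRing.isMultiplicative.Build A Q quotalg_pi quotalg_pi_multiplicative.

Let quotalg_pi_scalable : scalable quotalg_pi.
Proof. by move=> k x; rewrite -[RHS]/(qscale _ _) !quotalg_piE pi_scale. Qed.
HB.instance Definition _ :=
  GRing.isScalable.Build K A Q *:%R quotalg_pi quotalg_pi_scalable.

Lemma quotalg_pi_eq0 x : quotalg_pi x = 0 <-> ideal_gen S x.
Proof.
rewrite -(rmorph0 quotalg_pi) /= !quotalg_piE -{2}(subr0 x); split=> [/eqP|xS].
  by move/quotalgP.
by apply/eqP/quotalgP.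
Qed.

Section Lift.
Variables (B : algType K) (f : {lrmorphism A -> B}).

Definition quotalg_lift (x : Q) : B := f (repr x).

Hypothesis fS : forall s, S s -> f s = 0.

Lemma quotalg_liftE x : quotalg_lift (quotalg_pi x) = f x.
Proof.
apply/eqP; rewrite quotalg_piE -subr_eq0 -rmorphB; apply/eqP.
have /(_ [set y | f y = 0]) := repr_pi x; apply.
by split; [exact: ideal_ker|exact: fS].
Qed.

Lemma quotalg_lift_lrmorphism :
  [/\ {morph quotalg_lift : x y / x + y}, {morph quotalg_lift : x y / x * y},
      quotalg_lift 1 = 1 & scalable quotalg_lift].
Proof.
have pi_repr x : x = quotalg_pi (repr x) by rewrite quotalg_piE reprK.
split.
- by move=> x y; rewrite (pi_repr x) (pi_repr y) -rmorphD !quotalg_liftE rmorphD.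
- by move=> x y; rewrite (pi_repr x) (pi_repr y) -rmorphM !quotalg_liftE rmorphM.
- by rewrite -(rmorph1 quotalg_pi) quotalg_liftE rmorph1.
- by move=> k x; rewrite (pi_repr x) -linearZ !quotalg_liftE linearZ.
Qed.

End Lift.

End QuotientAlgebra.

Lemma ideal_gen_proper (R R' : nzRingType) (S : set R) (f : {rmorphism R -> R'}) :
  (forall s, S s -> f s = 0) -> ~ ideal_gen S 1.
Proof.
move=> fS /(_ [set x | f x = 0]) S1.
have /eqP : f 1 = 0 by apply: S1; split; [exact: ideal_ker|exact: fS].
by rewrite rmorph1 oner_eq0.
Qed.

Section QuantumMatrices.
Variables (m n : nat) (K : fieldType) (q : K).

Local Notation Y i a := (gen K ((i, a) : 'I_m * 'I_n)).

Inductive qmat_relator : set (freealg K ('I_m * 'I_n)%type) :=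
| QmatRow (i : 'I_m) (a b : 'I_n) of (a < b)%N :
    qmat_relator (Y i b * Y i a - q^-1 *: (Y i a * Y i b))
| QmatCol (i j : 'I_m) (a : 'I_n) of (i < j)%N :
    qmat_relator (Y j a * Y i a - q^-1 *: (Y i a * Y j a))
| QmatAnti (i j : 'I_m) (a b : 'I_n) of (i < j)%N & (b < a)%N :
    qmat_relator (Y j b * Y i a - Y i a * Y j b)
| QmatDiag (i j : 'I_m) (a b : 'I_n) of (i < j)%N & (a < b)%N :
    qmat_relator (Y j b * Y i a
                  - (Y i a * Y j b - (q - q^-1) *: (Y i b * Y j a))).

Lemma qmat_relator0 (B : algType K) (v : 'I_m * 'I_n -> B) s :
  (forall x, v x = 0) -> qmat_relator s -> free_eval v s = 0.
Proof.
move=> v0; case=> *.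
- by rewrite free_evalB free_evalZ [X in X - _]free_evalM free_evalM 2!free_eval_gen
    !v0 mul0r scaler0 subrr.
- by rewrite free_evalB free_evalZ [X in X - _]free_evalM free_evalM 2!free_eval_gen
    !v0 mul0r scaler0 subrr.
- by rewrite free_evalB [X in X - _]free_evalM free_evalM 2!free_eval_gen
    !v0 mul0r subrr.
- rewrite 2!free_evalB free_evalZ [X in X - _]free_evalM
    [X in _ - (X - _)]free_evalM
    free_evalM 4!free_eval_gen !v0 mul0r.
  by rewrite scaler0 !subrr.
Qed.

Lemma qmat_proper : ~ ideal_gen qmat_relator 1.
Proof.
have v0 s := @qmat_relator0 K^o (fun=> 0) s (fun=> erefl).
exact: ideal_gen_proper v0.
Qed.

Definition qmat := quotalg qmat_proper.

HB.instance Definition _ := GRing.Algebra.on qmat.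

Definition qmat_gen (i : 'I_m) (a : 'I_n) : qmat := quotalg_pi qmat_proper (Y i a).

(* h = (a_1, .., a_m, b_1, .., b_n) *)
Definition torus : set ('I_(m + n) -> K) := [set h | forall k, h k != 0].

Definition torus_scale (h : 'I_(m + n) -> K) (x : 'I_m * 'I_n) : qmat :=
  (h (lshift n x.1) * h (rshift m x.2)) *: qmat_gen x.1 x.2.

Definition torus_act (h : 'I_(m + n) -> K) : qmat -> qmat :=
  quotalg_lift (free_eval (torus_scale h)).

Lemma qmat_relator_scale (B : algType K) (v : 'I_m * 'I_n -> B)
    (f : 'I_m -> K) (g : 'I_n -> K) :
  (forall s, qmat_relator s -> free_eval v s = 0) ->
  forall w, (forall i a, w (i, a) = (f i * g a) *: v (i, a)) ->
  forall s, qmat_relator s -> free_eval w s = 0.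
Proof.
move=> v0 w wE s; case=> [i a b ab|i j a ij|i j a b ij ba|i j a b ij ab].
- have := v0 _ (QmatRow i ab);
  rewrite free_evalB free_evalZ [X in X - _]free_evalM free_evalM 2!free_eval_gen => /subr0_eq E.
  rewrite free_evalB free_evalZ [X in X - _]free_evalM free_evalM 2!free_eval_gen; apply/eqP.
  rewrite subr_eq0 !wE -!(scalerAl, scalerAr) !scalerA E !scalerA; apply/eqP.
  by congr (_ *: _); ring.
- have := v0 _ (QmatCol a ij);
  rewrite free_evalB free_evalZ [X in X - _]free_evalM free_evalM 2!free_eval_gen => /subr0_eq E.
  rewrite free_evalB free_evalZ [X in X - _]free_evalM free_evalM 2!free_eval_gen; apply/eqP.
  rewrite subr_eq0 !wE -!(scalerAl, scalerAr) !scalerA E !scalerA; apply/eqP.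
  by congr (_ *: _); ring.
- have := v0 _ (QmatAnti ij ba);
  rewrite free_evalB [X in X - _]free_evalM free_evalM 2!free_eval_gen => /subr0_eq E.
  rewrite free_evalB [X in X - _]free_evalM free_evalM 2!free_eval_gen; apply/eqP.
  rewrite subr_eq0 !wE -!(scalerAl, scalerAr) !scalerA E; apply/eqP.
  by congr (_ *: _); ring.
- have := v0 _ (QmatDiag ij ab);
  rewrite 2!free_evalB free_evalZ [X in X - _]free_evalM
    [X in _ - (X - _)]free_evalM
    free_evalM 4!free_eval_gen => /subr0_eq E.
  rewrite 2!free_evalB free_evalZ [X in X - _]free_evalM
    [X in _ - (X - _)]free_evalM
    free_evalM 4!free_eval_gen; apply/eqP.
  rewrite subr_eq0 !wE -!(scalerAl, scalerAr) !scalerA E.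
  rewrite scalerBr !scalerA; apply/eqP.
  by congr (_ *: _ - _ *: _); ring.
Qed.

Let torus_scale_relator h s :
  qmat_relator s -> free_eval (torus_scale h) s = 0.
Proof.
move: s; apply: (@qmat_relator_scale qmat (fun x => qmat_gen x.1 x.2)
  (fun i => h (lshift n i)) (fun a => h (rshift m a)) _ (torus_scale h)) => // r rr.
rewrite -(@free_eval_uniq _ _ _ _ (quotalg_pi qmat_proper)); last by case.
by apply/quotalg_pi_eq0; exact: sub_ideal_gen.
Qed.

Lemma torus_act_gen h i a :
  torus_act h (qmat_gen i a) = (h (lshift n i) * h (rshift m a)) *: qmat_gen i a.
Proof.
rewrite /torus_act /qmat_gen (quotalg_liftE _ (torus_scale_relator h)).
exact: free_eval_gen.
Qed.

Lemma torus_act_lrmorphism h :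
  [/\ {morph torus_act h : x y / x + y}, {morph torus_act h : x y / x * y},
      torus_act h 1 = 1 & scalable (torus_act h)].
Proof. by apply: quotalg_lift_lrmorphism; exact: torus_scale_relator. Qed.

Definition torus_invariant (I : set qmat) : Prop :=
  forall h, torus h -> torus_act h @` I = I.

Definition torus_prime (J : set qmat) : Prop :=
  [/\ ideal J, J != setT, torus_invariant J &
      forall I1 I2, ideal I1 -> torus_invariant I1 ->
        ideal I2 -> torus_invariant I2 ->
        ideal_mul I1 I2 `<=` J -> I1 `<=` J \/ I2 `<=` J].

Definition torus_core (P : set qmat) : set qmat :=
  \bigcap_(h in torus) (torus_act h @` P).

Definition stratum (J : set qmat) : set (spec qmat) :=
  [set P : spec qmat | torus_core P = J].

End QuantumMatrices.

Section LaurentPolynomials.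
Variables (K : fieldType) (d : nat).

(* z_i is the generator (i, true), and its inverse is (i, false). *)
Local Notation Z x := (gen K (x : 'I_d * bool)).

Inductive laurent_relator : set (freealg K ('I_d * bool)%type) :=
| LaurentComm x y : laurent_relator (Z x * Z y - Z y * Z x)
| LaurentInv i : laurent_relator (Z (i, true) * Z (i, false) - 1).

Lemma laurent_relator1 (B : algType K) (v : 'I_d * bool -> B) s :
  (forall x, v x = 1) -> laurent_relator s -> free_eval v s = 0.
Proof.
move=> v1; case=> *.
  by rewrite free_evalB [X in X - _]free_evalM free_evalM 2!free_eval_gen !v1 mul1r subrr.
by rewrite free_evalB free_evalM 2!free_eval_gen free_eval1 !v1 mul1r subrr.
Qed.

Lemma laurent_proper : ~ ideal_gen laurent_relator 1.
Proof.
have v1 s := @laurent_relator1 K^o (fun=> 1) s (fun=> erefl).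
exact: ideal_gen_proper v1.
Qed.

Definition laurent := quotalg laurent_proper.

HB.instance Definition _ := GRing.Algebra.on laurent.

End LaurentPolynomials.

(* "The stratum of J has dimension d", as a relation in d; the topology on the
   stratum is the one induced from spec (subtype_topology). *)
Definition stratum_dim (m n : nat) (K : fieldType) (q : K)
    (J : set (qmat m n q)) (d : nat) : Prop :=
  homeomorphic (stratum J) (spec (laurent K d)).

(* Main.v *)
Require Import Defs.
From HB Require Import structures.
From mathcomp Require Import all_boot all_order all_algebra all_classical.
From mathcomp Require Import topology_structure subtype_topology.
From mathcomp Require Import zify ring.
From mathcomp.multinomials Require Import monalg.

Set Implicit Arguments.
Unset Strict Implicit.
Unset Printing Implicit Defensive.

Import Order.TTheory GRing.Theory Num.Theory.

Local Open Scope classical_set_scope.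
Local Open Scope ring_scope.

(* Let [J] be an H-prime ideal. Cauchon's deleting derivations, run on the quotient
   by [J] and removing one quadratic correction at a time from the last box to the
   first, turn it into an algebra whose generators quasi-commute and are zero or
   invertible, that is, into a quantum torus on a set [S] of boxes. A step does
   nothing if the pivot vanishes; otherwise it localizes at the powers of the pivot,
   which is a homogeneous element contained in no prime of the stratum, so that the
   primes with zero H-core, and their Zariski topology, are preserved.

   The torus separates the rows, and together with the conjugations by the
   generators it distinguishes all monomials: an H-invariant proper ideal of the
   quantum torus is zero, and every ideal is generated by its central part. The
   center is the Laurent polynomial algebra on the radical of the commutation form
   of [S], and all of its primes occur. For [e] in the radical, the sum of the
   squares of the partial row sums of [e] does not depend on the column, so [e] is
   determined by its row sums, or by its column sums; hence the rank [d] of the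
   radical is at most [m] and at most [n]. The number [d] is determined by the
   topology because chains of primes detect it (Coquand and Lombardi).

   Conversely the kernel of the map to a Laurent polynomial algebra that sends [d]
   diagonal generators to the variables, and the others to zero, is H-prime, and
   its stratum has dimension [d] because diagonal boxes commute. *)

(** * Ideals and spectra *)

(** It is not known in advance that the quotient by an H-prime ideal has no zero divisors, so a
    pivot could be nilpotent, and no basis of the algebra of quantum matrices is at hand. The
    argument draws on generators, relations and H-primeness, which excludes two nonzero stable
    ideals with zero product: a nonzero normal weight vector is regular, and noetherianity makes a
    non-nilpotent pivot regular. Nilpotency of a pivot [x] is refuted by factoring [x ^+ k * a ^+ k]
    and [a ^+ k * x ^+ k] through the quantum determinant of a two-by-two minor; the coefficients of
    the two factorizations differ because [q] is not a root of unity. The Ore condition holds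
    because conjugation by the pivot is locally finite with nonzero eigenvalues, and the relations
    after a deletion are eigencomponents of the earlier ones. Linear independence of monomials is
    likewise a consequence of separating eigenvectors, not an input. The vanishing of a radical
    vector with zero row sums is used twice: for the bound on the rank, and for telling monomials
    apart by torus elements that multiply one row by [q]. *)

Section IdealTheory.
Variable R : nzRingType.
Implicit Types I J P : set R.

Lemma ideal0 I : ideal I -> I 0. Proof. by case. Qed.
Lemma idealD I x y : ideal I -> I x -> I y -> I (x + y).
Proof. by case=> _ ID _ _; exact: ID. Qed.
Lemma idealMl I a x : ideal I -> I x -> I (a * x).
Proof. by case=> _ _ IM _; exact: IM. Qed.
Lemma idealMr I a x : ideal I -> I x -> I (x * a).
Proof. by case=> _ _ _ IM; exact: IM. Qed.
Lemma idealB I x y : ideal I -> I x -> I y -> I (x - y).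
Proof. by move=> idI Ix Iy; apply: idealD => //; exact: idealN. Qed.
Lemma ideal_sum I (T : Type) (r : seq T) (p : pred T) (F : T -> R) :
  ideal I -> (forall i, p i -> I (F i)) -> I (\sum_(i <- r | p i) F i).
Proof.
move=> idI IF; elim/big_ind: _ => //; first exact: ideal0.
by move=> x y; exact: idealD.
Qed.

Lemma prime_idealP P : prime_ideal P <->
  [/\ ideal P, ~ P 1 & forall I J, ideal I -> ideal J ->
     (forall x y, I x -> J y -> P (x * y)) -> I `<=` P \/ J `<=` P].
Proof.
have PT : ideal P -> (P != setT) <-> ~ P 1.
  move=> idP; split=> [/eqP nT P1|nP1]; last by apply/eqP => PT; apply: nP1; rewrite PT.
  by apply: nT; apply/seteqP; split=> // x _; rewrite -(mulr1 x); exact: idealMl.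
split=> -[idP /(PT idP) nT PP]; split=> // I J idI idJ IJ; apply: PP => //.
  by move=> z IJz; apply: (IJz P); split=> // _ [x [y [Ix Jy ->]]]; exact: IJ.
by move=> x y Ix Jy; apply: IJ; apply: sub_ideal_gen; exists x, y.
Qed.

Lemma ideal_genP (S : set R) x : ideal_gen S x <->
  exists l : seq (R * R * R), (forall t, t \in l -> S t.1.2) /\
    x = \sum_(t <- l) t.1.1 * t.1.2 * t.2.
Proof.
split; last first.
  move=> [l [lS ->]]; rewrite big_seq; apply: (ideal_sum _ (ideal_gen_ideal S)).
  move=> t /lS St; apply: (idealMr _ (ideal_gen_ideal S)).
  by apply: (idealMl _ (ideal_gen_ideal S)); exact: sub_ideal_gen.
set T := [set x | exists l : seq (R * R * R), (forall t, t \in l -> S t.1.2) /\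
    x = \sum_(t <- l) t.1.1 * t.1.2 * t.2] => Sx.
apply: (Sx T); split; last first.
  move=> s Ss; exists [:: (1, s, 1)]; split; first by move=> t; rewrite inE => /eqP->.
  by rewrite big_seq1 /= mul1r mulr1.
split=> /=.
- by exists [::]; rewrite big_nil.
- move=> _ _ [l [lS ->]] [l' [lS' ->]]; exists (l ++ l'); rewrite big_cat; split=> // t.
  by rewrite mem_cat => /orP[/lS|/lS'].
- move=> a _ [l [lS ->]]; exists [seq (a * t.1.1, t.1.2, t.2) | t <- l]; split.
    by move=> _ /mapP[t tl ->] /=; exact: lS.
  by rewrite big_map mulr_sumr; apply: eq_bigr => t _; rewrite !mulrA.
- move=> a _ [l [lS ->]]; exists [seq (t.1.1, t.1.2, t.2 * a) | t <- l]; split.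
    by move=> _ /mapP[t tl ->] /=; exact: lS.
  by rewrite big_map mulr_suml; apply: eq_bigr => t _; rewrite !mulrA.
Qed.

Lemma zero_ideal : ideal [set (0 : R)].
Proof.
split=> //=; first by move=> _ _ -> ->; rewrite addr0.
  by move=> ? _ ->; rewrite mulr0.
by move=> ? _ ->; rewrite mul0r.
Qed.

End IdealTheory.

Lemma ideal_preimage (R R' : nzRingType) (f : {rmorphism R -> R'}) (I : set R') :
  ideal I -> ideal [set a | I (f a)].
Proof.
move=> idI; split=> /=; first by rewrite rmorph0; exact: ideal0.
- by move=> a b Ia Ib; rewrite rmorphD; exact: idealD.
- by move=> a b Ib; rewrite rmorphM; exact: idealMl.
- by move=> a b Ib; rewrite rmorphM; exact: idealMr.
Qed.

Lemma lrmorphism_exists (K : fieldType) (A B : algType K) (f : A -> B) :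
  {morph f : x y / x + y} -> {morph f : x y / x * y} -> f 1 = 1 -> scalable f ->
  exists g : {lrmorphism A -> B}, g =1 f.
Proof.
move=> fD fM f1 fZ.
have fB : additive f by move=> x y; rewrite fD -scaleN1r fZ scaleN1r.
pose F1 := GRing.isAdditive.Build A B f fB.
pose F2 := GRing.isMultiplicative.Build A B f (conj fM f1).
pose F3 := GRing.isScalable.Build K A B *:%R f fZ.
by exists (HB.pack f F1 F2 F3 : {lrmorphism A -> B}).
Qed.

Lemma idealZ (K : fieldType) (A : algType K) (I : set A) k x :
  ideal I -> I x -> I (k *: x).
Proof. by move=> idI Ix; rewrite -mulr_algl; exact: idealMl. Qed.

Lemma idealZE (K : fieldType) (A : algType K) (I : set A) k x :
  ideal I -> k != 0 -> I (k *: x) -> I x.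
Proof.
by move=> idI k0 /(idealZ k^-1 idI); rewrite scalerA mulVf // scale1r.
Qed.

(** A homeomorphism for the induced Zariski topologies, expressed through the closed sets of all [P]
    containing a given ideal. It is stated for plain sets of ideals, so that equivalences compose
    without primality proofs or subtype topologies. *)
Definition spec_equiv (A B : nzRingType) (X : set (set A)) (Y : set (set B)) :=
  exists F G, [/\ forall P, X P -> Y (F P) /\ G (F P) = P,
    forall Q, Y Q -> X (G Q) /\ F (G Q) = Q,
    forall I, ideal I -> exists2 I', ideal I' &
      forall P, X P -> (I `<=` P <-> I' `<=` F P) &
    forall I', ideal I' -> exists2 I, ideal I &
      forall P, X P -> (I `<=` P <-> I' `<=` F P)].

Lemma spec_equiv_sym (A B : nzRingType) (X : set (set A)) (Y : set (set B)) :
  spec_equiv X Y -> spec_equiv Y X.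
Proof.
move=> [F [G [FX GY FI GI]]]; exists G, F; split=> //.
- move=> I /GI[I' idI' II']; exists I' => // Q YQ.
  by have [XG {1}<-] := GY _ YQ; split=> /(II' _ XG).
- move=> I /FI[I' idI' II']; exists I' => // Q YQ.
  by have [XG {1}<-] := GY _ YQ; split=> /(II' _ XG).
Qed.

Lemma spec_equiv_trans (A B C : nzRingType)
    (X : set (set A)) (Y : set (set B)) (Z : set (set C)) :
  spec_equiv X Y -> spec_equiv Y Z -> spec_equiv X Z.
Proof.
move=> [F [G [FX GY FI GI]]] [F' [G' [FX' GY' FI' GI']]].
exists (F' \o F), (G \o G'); split=> /=.
- by move=> P /FX[/FX'[? ->] ->].
- by move=> P /GY'[/GY[? ->] ->].
- move=> I /FI[I1 /FI'[I2 idI2 I12] I01]; exists I2 => // P XP.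
  by have [YF _] := FX _ XP; rewrite I01 // I12.
- move=> I /GI'[I1 /GI[I2 idI2 I12] I01]; exists I2 => // P XP.
  by have [YF _] := FX _ XP; rewrite I12 // I01.
Qed.

(* Extension [e] and contraction [c] form a Galois connection between ideals, so
   they match the closed sets of the two spectra as soon as they match points. *)
Lemma spec_equiv_galois (A B : nzRingType) (X : set (set A)) (Y : set (set B))
    (e : set A -> set B) (c : set B -> set A) :
  (forall I, ideal I -> ideal (e I)) -> (forall I, ideal I -> ideal (c I)) ->
  (forall I J, I `<=` J -> e I `<=` e J) -> (forall I J, I `<=` J -> c I `<=` c J) ->
  (forall I, ideal I -> I `<=` c (e I)) -> (forall I, ideal I -> I `<=` e (c I)) ->
  (forall P, X P -> [/\ ideal P, Y (e P) & c (e P) `<=` P]) ->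
  (forall Q, Y Q -> [/\ ideal Q, X (c Q) & e (c Q) `<=` Q]) ->
  spec_equiv X Y.
Proof.
move=> ei ci em cm ce ec eX cY; exists e, c; split.
- by move=> P /eX[idP YP cP]; split=> //; apply/seteqP; split=> //; exact: ce.
- by move=> P /cY[idP YP cP]; split=> //; apply/seteqP; split=> //; exact: ec.
- move=> I idI; exists (e I); first exact: ei.
  move=> P /eX[idP YP cP]; split; first exact: em.
  by move=> /cm s; apply: subset_trans (ce _ idI) _; exact: subset_trans s _.
- move=> I idI; exists (c I); first exact: ci.
  move=> P /eX[idP YP cP]; split; last by move=> /cm /subset_trans; apply.
  by move=> /em; apply: subset_trans; exact: ec.
Qed.

(** * Generation of algebras *)

Section Generation.
Variable K : fieldType.

Definition subalgebra (A : algType K) (S : set A) : Prop :=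
  [/\ S 1, forall x y, S x -> S y -> S (x + y),
      forall x y, S x -> S y -> S (x * y) & forall k x, S x -> S (k *: x)].

(** Formulated as an induction principle: a property closed under the algebra operations need only
    be checked on the [v t], and no normal form of elements is required. *)
Definition generated (A : algType K) (T : Type) (v : T -> A) : Prop :=
  forall S, subalgebra S -> (forall t, S (v t)) -> forall a, S a.

Lemma subalgebra0 (A : algType K) (S : set A) : subalgebra S -> S 0.
Proof. by case=> S1 _ _ SZ; rewrite -(scale0r 1); exact: SZ. Qed.

Lemma subalgebraN (A : algType K) (S : set A) x : subalgebra S -> S x -> S (- x).
Proof. by case=> S1 _ _ SZ Sx; rewrite -scaleN1r; exact: SZ. Qed.

Lemma subalgebraX (A : algType K) (S : set A) x k : subalgebra S -> S x -> S (x ^+ k).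
Proof.
by case=> S1 _ SM _ Sx; elim: k => // k IH; rewrite exprS; exact: SM.
Qed.

Lemma centralizer_subalgebra (A : algType K) (b : A) : subalgebra [set a | a * b = b * a].
Proof.
split=> /=; first by rewrite mulr1 mul1r.
- by move=> x y xb yb; rewrite mulrDl mulrDr xb yb.
- by move=> x y xb yb; rewrite -mulrA yb mulrA xb mulrA.
- by move=> k x xb; rewrite -scalerAl xb scalerAr.
Qed.

Lemma freealg_generated (X : choiceType) : generated (@gen K X).
Proof.
move=> S /[dup] SS [S1 SD SM SZ] Sv a.
rewrite [a](@monalgE {fmonom X} K).
apply: (big_ind S); [exact: (subalgebra0 SS)|exact: SD|].
move=> w _; rewrite malgUZ; apply: SZ; case: w => w /=.
elim: w => [|x w IH].
  have -> : FMonom [::] = mone :> {fmonom X} by rewrite -fmoneE.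
  exact: S1.
suff -> : (<< FMonom (x :: w) >> : freealg K X) = gen K x * << FMonom w >> by apply: SM.
transitivity (<< fmmul (fmu x) (FMonom w) >> : freealg K X).
  by rewrite fmmulE fmuE.
by symmetry; exact: malgUM.
Qed.

Lemma generated_image (A B : algType K) (f : {lrmorphism A -> B}) (T : Type)
    (v : T -> A) : generated v -> (forall b, exists a, f a = b) ->
  generated (f \o v).
Proof.
move=> gv fs S [S1 SD SM SZ] Sv b; have [a <-] := fs b.
apply: (gv [set a | S (f a)]) => //; split=> /=; first by rewrite rmorph1.
- by move=> x y Sx Sy; rewrite rmorphD; exact: SD.
- by move=> x y Sx Sy; rewrite rmorphM; exact: SM.
- by move=> k x Sx; rewrite linearZ; exact: SZ.
Qed.

Lemma generated_eq (A B : algType K) (f g : {lrmorphism A -> B}) (T : Type)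
    (v : T -> A) : generated v -> (forall t, f (v t) = g (v t)) -> f =1 g.
Proof.
move=> gv fg; apply: (gv [set a | f a = g a]) => //; split=> /=.
- by rewrite !rmorph1.
- by move=> x y fx fy; rewrite !rmorphD /= fx fy.
- by move=> x y fx fy; rewrite !rmorphM /= fx fy.
- by move=> k x fx; rewrite !linearZ /= fx.
Qed.

Lemma quotalg_surj (A : algType K) (S : set A) (h : ~ ideal_gen S 1) b :
  exists a, quotalg_pi h a = b.
Proof.
exists (repr b); rewrite /quotalg_pi locked_withE; exact: reprK.
Qed.

End Generation.

(** * Algebras with a group of automorphisms *)

Section Actions.
Variables (K : fieldType) (G : Type) (A : algType K) (act : G -> {lrmorphism A -> A}).

(** [G] is a bare index type with no group law, so one inclusion is asked for; for the torus,
    inverses turn it into an equality in [stable_invariant]. *)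
Definition stable (I : set A) : Prop := forall g x, I x -> I (act g x).

(** For the torus the set of these [x] is the intersection of all translates of [P], by
    [torus_coreE]; hence [str0] is the stratum of the zero ideal. *)
Definition core0 (P : set A) : Prop :=
  forall x, (forall g, P (act g x)) -> x = 0.

Definition hprime0 : Prop := forall I J, ideal I -> stable I -> ideal J -> stable J ->
  (forall x y, I x -> J y -> x * y = 0) -> I `<=` [set 0] \/ J `<=` [set 0].

Definition str0 : set (set A) := [set P | prime_ideal P /\ core0 P].

End Actions.

(** * Separation of simultaneous eigenvectors *)

Section Separation.
Variables (K : fieldType) (V : lmodType K) (W : set V).
Hypothesis (WD : forall u v, W u -> W v -> W (u + v)).
Hypothesis (WZ : forall k u, W u -> W (k *: u)).
Variables (J : Type) (T : J -> V -> V).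
Hypotheses (TL : forall j, linear (T j)) (WT : forall j u, W u -> W (T j u)).
Variables (I : eqType) (F : I -> V) (lam : J -> I -> K).
Hypothesis TF : forall j i, T j (F i) = lam j i *: F i.

(** Interpolation: for an index [b] whose eigenvalues differ from those of [i0] at some [j], the
    operator [T j] minus [lam j b], suitably normalized, kills [F b] and fixes every term with the
    eigenvalues of [i0]. Applying one such operator per unwanted index stays inside [W]. *)
Lemma eigen_separation (r : seq I) (i0 : I) : W (\sum_(i <- r) F i) ->
  W (\sum_(i <- r | `[< forall j, lam j i = lam j i0 >]) F i).
Proof.
set sim := fun i => `[< forall j, lam j i = lam j i0 >] => Wr.
suff /(_ r)[c [Wc c1 c0]] : forall bad : seq I, exists c : I -> K,
    [/\ W (\sum_(i <- r) c i *: F i), forall i, sim i -> c i = 1 &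
        forall i, i \in bad -> ~~ sim i -> c i = 0].
  rewrite (_ : \sum_(i <- r | sim i) F i = \sum_(i <- r) c i *: F i) //.
  rewrite [RHS](bigID sim) /= [X in _ = _ + X]big1_seq ?addr0; last first.
    by move=> i /andP[ns /c0 ->]; rewrite ?scale0r.
  by apply: eq_bigr => i /c1 ->; rewrite scale1r.
elim=> [|b bad [c [Wc c1 c0]]].
  by exists (fun=> 1); split=> //; under eq_bigr do rewrite scale1r.
have [sb|/asboolPn/existsNP[j /eqP nb]] := boolP (sim b).
  exists c; split=> // i; rewrite inE => /orP[/eqP->|/c0//].
  by rewrite sb.
have d0 : lam j i0 - lam j b != 0 by rewrite subr_eq0 eq_sym.
(* These are the coefficients after applying [T j] minus [lam j b] and dividing by its value at
   [i0]. *)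
exists (fun i => (lam j i0 - lam j b)^-1 * (lam j i - lam j b) * c i); split.
- have T0 : T j 0 = 0.
    by have := TL j (-1) 0 0; rewrite scaler0 add0r scaleN1r addNr.
  have Tr : T j (\sum_(i <- r) c i *: F i) = \sum_(i <- r) (lam j i * c i) *: F i.
    elim: r {Wr Wc} => [|i s IH]; first by rewrite !big_nil.
    by rewrite !big_cons TL IH TF scalerA [lam _ _ * _]mulrC.
  under eq_bigr do rewrite -mulrA -scalerA.
  rewrite -scaler_sumr; apply: WZ.
  under eq_bigr do rewrite mulrBl scalerBl -scalerA.
  rewrite big_split /=; apply: WD; first by
    under eq_bigr do rewrite scalerA; rewrite -Tr; exact: WT.
  rewrite (_ : \sum_(i <- r) _ = - (lam j b) *: \sum_(i <- r) c i *: F i); first exact: WZ.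
  by rewrite scaler_sumr; apply: eq_bigr => i _; rewrite scaleNr scalerA.
- by move=> i /[dup] si /asboolP/(_ j) ->; rewrite mulVf // c1 // mul1r.
- move=> i; rewrite inE => /orP[/eqP->|ib] si; first by rewrite subrr mulr0 mul0r.
  by rewrite c0 // mulr0.
Qed.

End Separation.

(** * Local finiteness of conjugation and the Ore condition *)

Section LocallyFinite.
Variables (K : fieldType) (A : algType K) (x : A).

Definition twist (c : K) (a : A) : A := x * a - c *: (a * x).

(* [a] is killed by a product of operators [twist c] with [c != 0]: once [x] is
   inverted, [a] lies in a finite sum of generalized eigenspaces of the
   conjugation by [x], all with nonzero eigenvalues. *)
Inductive locfin : A -> Prop :=
| Locfin0 : locfin 0
| LocfinS c a of c != 0 & locfin (twist c a) : locfin a.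

Lemma twistC c d a : twist c (twist d a) = twist d (twist c a).
Proof.
rewrite /twist !mulrBr !mulrBl -!scalerAr -!scalerAl !scalerBr !scalerA !mulrA.
by rewrite !opprB [d * c]mulrC addrACA [RHS]addrACA; congr (_ + _); exact: addrC.
Qed.

Lemma twistD c a b : twist c (a + b) = twist c a + twist c b.
Proof. by rewrite /twist mulrDr mulrDl scalerDr opprD addrACA. Qed.

Lemma twistZ c k a : twist c (k *: a) = k *: twist c a.
Proof. by rewrite /twist -scalerAr -scalerAl scalerBr !scalerA mulrC. Qed.

(** A twisted Leibniz rule in which the parameters multiply; since a product of nonzero parameters
    is nonzero, it makes locally finite elements closed under products. *)
Lemma twistM c d a b : twist (c * d) (a * b) = twist c a * b + c *: (a * twist d b).
Proof.
rewrite /twist mulrBl mulrBr scalerBr -!scalerAl -!scalerAr !scalerA !mulrA.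
by rewrite addrA subrK.
Qed.

Lemma locfin_twist c a : locfin a -> locfin (twist c a).
Proof.
elim=> [|d b d0 _ IH]; first by rewrite -(scale0r 0) twistZ scale0r; exact: Locfin0.
by apply: (LocfinS d0); rewrite twistC.
Qed.

Lemma locfinD a b : locfin a -> locfin b -> locfin (a + b).
Proof.
move=> la; elim: la b => [b|c {}a c0 _ IH b lb]; first by rewrite add0r.
by apply: (LocfinS c0); rewrite twistD; apply: IH; exact: locfin_twist.
Qed.

Lemma locfinZ k a : locfin a -> locfin (k *: a).
Proof.
elim=> [|c b c0 _ IH]; first by rewrite scaler0; exact: Locfin0.
by apply: (LocfinS c0); rewrite twistZ.
Qed.

Lemma locfinM a b : locfin a -> locfin b -> locfin (a * b).
Proof.
move=> la; elim: la b => [b _|c {}a c0 _ IHa b lb]; first by rewrite mul0r; exact: Locfin0.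
elim: lb => [|d {}b d0 lb IHb]; first by rewrite mulr0; exact: Locfin0.
apply: (LocfinS (mulf_neq0 c0 d0)); rewrite twistM.
apply: locfinD; last exact: locfinZ.
by apply: IHa; exact: LocfinS lb.
Qed.

Lemma locfin_eigen c a : c != 0 -> x * a = c *: (a * x) -> locfin a.
Proof. by move=> c0 E; apply: (LocfinS c0); rewrite /twist E subrr; exact: Locfin0. Qed.

Lemma locfin_subalgebra : subalgebra locfin.
Proof.
split; [|exact: locfinD|exact: locfinM|exact: locfinZ].
by apply: (locfin_eigen (oner_neq0 K)); rewrite mulr1 mul1r scale1r.
Qed.

(** If the twist [x a - c a x], multiplied by a power of [x], equals [x a'], then one more power
    lets [a] itself pass, because [c] is invertible. Keeping [a'] inside [I] makes the same
    statement serve for the Ore condition and for extending ideals to the localization. *)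
Lemma locfin_ore (I : set A) a : ideal I -> I a -> locfin a ->
  exists k a', I a' /\ a * x ^+ k = x * a'.
Proof.
move=> idI Ia la; elim: la Ia => [I0|c b c0 _ IH Ib].
  by exists 0%N, 0; rewrite mul0r mulr0.
have [|k [a' [Ia' E]]] := IH.
  exact: (idealB idI (idealMl _ idI Ib) (idealZ _ idI (idealMr _ idI Ib))).
exists k.+1, (c^-1 *: (b * x ^+ k - a')); split.
  exact: (idealZ _ idI (idealB idI (idealMr _ idI Ib) Ia')).
apply: (scalerI c0); rewrite -scalerAr scalerA mulfV // scale1r mulrBr -E.
by rewrite /twist mulrBl !mulrA opprB addrC subrK exprS mulrA -scalerAl.
Qed.

(** If [x * a = 0], then [x] also annihilates the twist of [a], which is then zero by induction;
    this leaves [a * x = 0]. So regularity on one side gives regularity on the other. *)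
Lemma locfin_regl a : (forall b, b * x = 0 -> b = 0) -> locfin a -> x * a = 0 -> a = 0.
Proof.
move=> xr; elim=> // c b c0 _ IH xb.
have : x * twist c b = 0 by rewrite /twist xb sub0r mulrN -scalerAr mulrA xb mul0r scaler0 oppr0.
move=> /IH; rewrite /twist xb sub0r => /eqP; rewrite oppr_eq0 scaler_eq0 (negPf c0) /=.
by move=> /eqP/xr.
Qed.

End LocallyFinite.

(** * Normal elements *)

Section NormalElements.
Variables (K : fieldType) (A : algType K) (T : Type) (v : T -> A).
Hypothesis gv : generated v.

Definition qcomm (u w : A) : Prop := exists2 c : K, c != 0 & u * w = c *: (w * u).

Lemma qcommC u w : qcomm u w -> qcomm w u.
Proof.
move=> [c c0 E]; exists c^-1; first by rewrite invr_eq0.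
by rewrite E scalerA mulVf // scale1r.
Qed.

Lemma qcommM u w w' : qcomm u w -> qcomm u w' -> qcomm u (w * w').
Proof.
move=> [c c0 E] [d d0 E']; exists (c * d); first exact: mulf_neq0.
by rewrite mulrA E -scalerAl -(mulrA w u w') E' -scalerAr scalerA mulrA.
Qed.

Lemma qcommX u w k : qcomm u w -> qcomm u (w ^+ k).
Proof.
move=> uw; elim: k => [|k IH]; last by rewrite exprS; exact: qcommM.
by exists 1; rewrite ?oner_neq0 // mulr1 mul1r scale1r.
Qed.

Lemma normal_right u : (forall t, qcomm u (v t)) -> forall a, exists b, u * a = b * u.
Proof.
move=> uv; apply: gv; last first.
  by move=> t; have [c _ E] := uv t; exists (c *: v t); rewrite E scalerAl.
split=> /=; first by exists 1; rewrite mulr1 mul1r.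
- by move=> a b [a' Ea] [b' Eb]; exists (a' + b'); rewrite mulrDr mulrDl Ea Eb.
- by move=> a b [a' Ea] [b' Eb]; exists (a' * b'); rewrite mulrA Ea -mulrA Eb mulrA.
- by move=> k a [a' Ea]; exists (k *: a'); rewrite -scalerAr Ea scalerAl.
Qed.

Lemma normal_left u : (forall t, qcomm u (v t)) -> forall a, exists b, a * u = u * b.
Proof.
move=> uv; apply: gv; last first.
  by move=> t; have [c _ E] := qcommC (uv t); exists (c *: v t); rewrite E scalerAr.
split=> /=; first by exists 1; rewrite mulr1 mul1r.
- by move=> a b [a' Ea] [b' Eb]; exists (a' + b'); rewrite mulrDr mulrDl Ea Eb.
- by move=> a b [a' Ea] [b' Eb]; exists (a' * b'); rewrite -mulrA Eb mulrA Ea mulrA.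
- by move=> k a [a' Ea]; exists (k *: a'); rewrite -scalerAl Ea scalerAr.
Qed.

Variables (G : Type) (act : G -> {lrmorphism A -> A}).
Hypothesis hp : hprime0 act.

Definition weight_vector (u : A) : Prop := forall g, exists2 c : K, c != 0 & act g u = c *: u.

Lemma weight_vectorM u w : weight_vector u -> weight_vector w -> weight_vector (u * w).
Proof.
move=> wu ww g; have [c c0 Ec] := wu g; have [d d0 Ed] := ww g.
exists (c * d); first exact: mulf_neq0.
by rewrite rmorphM /= Ec Ed -scalerAl -scalerAr scalerA.
Qed.

Lemma weight_vectorX u k : weight_vector u -> weight_vector (u ^+ k).
Proof.
move=> wu; elim: k => [g|k IH]; last by rewrite exprS; exact: weight_vectorM.
by exists 1; rewrite ?oner_neq0 // rmorph1 scale1r.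
Qed.

(** By normality both the annihilator of [u] and the multiples of [u] form stable two-sided ideals,
    and their product is zero. The second one contains [u], so H-primeness makes the annihilator
    vanish. *)
Lemma normal_regular u : (forall t, qcomm u (v t)) -> weight_vector u -> u != 0 ->
  (forall a, a * u = 0 -> a = 0) /\ (forall a, u * a = 0 -> a = 0).
Proof.
move=> uv wu u0; have ur := normal_right uv; have ul := normal_left uv.
have stu : forall g a, act g a = 0 -> act g (u * a) = 0.
  by move=> g a a0; rewrite rmorphM /= a0 mulr0.
have idl : ideal [set b | exists a, b = u * a].
  split=> /=; first by exists 0; rewrite mulr0.
  - by move=> _ _ [a ->] [b ->]; exists (a + b); rewrite mulrDr.
  - by move=> a _ [b ->]; have [a' E] := ul a; exists (a' * b); rewrite !mulrA E.
  - by move=> a _ [b ->]; exists (b * a); rewrite mulrA.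
have stl : stable act [set b | exists a, b = u * a].
  move=> g _ [a ->] /=; have [c c0 E] := wu g; exists (c *: act g a).
  by rewrite rmorphM /= E -scalerAl scalerAr.
have nl : ~ [set b | exists a, b = u * a] `<=` [set 0].
  by move=> /(_ u) /= ue; move/eqP: u0; apply; apply: ue; exists 1; rewrite mulr1.
split.
- have [] := hp (I := [set a | a * u = 0]) (J := [set b | exists a, b = u * a]) => //.
  + split=> /=; first by rewrite mul0r.
    * by move=> a b Ea Eb; rewrite mulrDl Ea Eb addr0.
    * by move=> a b E; rewrite -mulrA E mulr0.
    * by move=> a b E; have [a' Ea] := ul a; rewrite -mulrA Ea mulrA E mul0r.
  + move=> g a /= E; have [c c0 Ec] := wu g.
    have := congr1 (act g) E; rewrite rmorphM /= Ec rmorph0 -scalerAr => /eqP.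
    by rewrite scaler_eq0 (negPf c0) => /eqP.
  + by move=> a _ /= E [b ->]; rewrite mulrA E mul0r.
- have [] := hp (I := [set b | exists a, b = u * a]) (J := [set a | u * a = 0]) => //.
  + split=> /=; first by rewrite mulr0.
    * by move=> a b Ea Eb; rewrite mulrDr Ea Eb addr0.
    * by move=> a b E; have [a' Ea] := ur a; rewrite mulrA Ea -mulrA E mulr0.
    * by move=> a b E; rewrite mulrA E mul0r.
  + move=> g a /= E; have [c c0 Ec] := wu g.
    have := congr1 (act g) E; rewrite rmorphM /= Ec rmorph0 -scalerAl => /eqP.
    by rewrite scaler_eq0 (negPf c0) => /eqP.
  + by move=> _ b [a ->] /= E; have [a' Ea] := ur a; rewrite Ea -mulrA E mulr0.
Qed.

End NormalElements.

(** * Ore localization at the powers of one element *)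

Section Localization.
Local Open Scope quotient_scope.
Variables (K : fieldType) (A : algType K) (x : A).
Hypotheses (xr : forall a, a * x = 0 -> a = 0) (xl : forall a, x * a = 0 -> a = 0).
Hypothesis ore : forall a, exists k a', a * x ^+ k = x * a'.

Let mulxr n a b : a * x ^+ n = b * x ^+ n -> a = b.
Proof.
elim: n => [|n IH]; first by rewrite !mulr1.
rewrite !exprSr !mulrA => /eqP; rewrite -subr_eq0 -mulrBl => /eqP/xr/eqP.
by rewrite subr_eq0 => /eqP.
Qed.

Let mulxl n a b : x ^+ n * a = x ^+ n * b -> a = b.
Proof.
elim: n => [|n IH]; first by rewrite !mul1r.
rewrite !exprS -!mulrA => /eqP; rewrite -subr_eq0 -mulrBr => /eqP/xl/eqP.
by rewrite subr_eq0 => /eqP.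
Qed.

Let orex a n : exists p : nat * A, a * x ^+ p.1 = x ^+ n * p.2.
Proof.
elim: n => [|n [[k a'] /= IH]]; first by exists (0, a)%N; rewrite mulr1 mul1r.
have [l [a'' E]] := ore a'; exists (k + l, a'')%N => /=.
by rewrite exprD mulrA IH -mulrA E mulrA exprSr.
Qed.

(* [(a, n)] stands for the right fraction [a x^-n]. *)
Definition loc_equiv (p r : A * nat) : bool := p.1 * x ^+ r.2 == r.1 * x ^+ p.2.

Lemma loc_equivP : equiv_class_of loc_equiv.
Proof.
split=> [p|p r|r p s]; first exact: eqxx.
  exact: eq_sym.
move=> /eqP pr /eqP rs; apply/eqP; apply: (@mulxr r.2).
by rewrite -mulrA -exprD addnC exprD mulrA pr -mulrA -exprD addnC exprD mulrA rs
  -!mulrA -!exprD addnC.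
Qed.

Canonical loc_rel := EquivRelPack loc_equivP.
Definition loc := {eq_quot loc_rel}.
HB.instance Definition _ := Choice.on loc.
HB.instance Definition _ := EqQuotient.on loc.

Fact loc_key : unit. Proof. exact: tt. Qed.
Local Notation lock_op := (locked_with loc_key).

Definition frac : A -> nat -> loc := lock_op (fun a n => \pi_loc (a, n)).

Let fracE a n b k : frac a n = frac b k <-> a * x ^+ k = b * x ^+ n.
Proof.
by rewrite /frac unlock; split=> [/eqP|/eqP E]; [|apply/eqP]; rewrite eqmodE // => /eqP.
Qed.

Let frac_repr (r : loc) : r = frac (repr r).1 (repr r).2.
Proof. by rewrite /frac unlock -[LHS]reprK; case: (repr r). Qed.

Let fracX j a n : frac a n = frac (a * x ^+ j) (n + j).
Proof. by apply/fracE; rewrite -mulrA -exprD addnC. Qed.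

Let frac_com (r s : loc) : exists n a b, r = frac a n /\ s = frac b n.
Proof.
rewrite (frac_repr r) (frac_repr s); case: (repr r) (repr s) => a n [b k] /=.
exists (n + k)%N, (a * x ^+ k), (b * x ^+ n); split; first exact: fracX.
by rewrite addnC; exact: fracX.
Qed.

Let frac_com3 (r s t : loc) : exists n a b c, [/\ r = frac a n, s = frac b n & t = frac c n].
Proof.
have [n [a [b [-> ->]]]] := frac_com r s; rewrite (frac_repr t).
case: (repr t) => c k /=.
exists (n + k)%N, (a * x ^+ k), (b * x ^+ k), (c * x ^+ n); split; try exact: fracX.
by rewrite addnC; exact: fracX.
Qed.

Definition lzero : loc := frac 0 0.
Definition lone : loc := frac 1 0.
Definition lopp : loc -> loc := lock_op (fun r => frac (- (repr r).1) (repr r).2).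
Definition ladd : loc -> loc -> loc := lock_op (fun r s =>
  frac ((repr r).1 * x ^+ (repr s).2 + (repr s).1 * x ^+ (repr r).2)
       ((repr r).2 + (repr s).2)).
Definition lscale : K -> loc -> loc := lock_op (fun k r =>
  frac (k *: (repr r).1) (repr r).2).
Definition lmul : loc -> loc -> loc := lock_op (fun r s =>
  let p := projT1 (cid (orex (repr s).1 (repr r).2)) in
  frac ((repr r).1 * p.2) ((repr s).2 + p.1)).

Let repr_frac a n : (repr (frac a n)).1 * x ^+ n = a * x ^+ (repr (frac a n)).2.
Proof. by apply/fracE; rewrite -frac_repr. Qed.

Let loppE a n : lopp (frac a n) = frac (- a) n.
Proof. by rewrite /lopp unlock; apply/fracE; rewrite !mulNr repr_frac. Qed.

Let lscaleE k a n : lscale k (frac a n) = frac (k *: a) n.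
Proof. by rewrite /lscale unlock; apply/fracE; rewrite -!scalerAl repr_frac. Qed.

Let laddE a b n : ladd (frac a n) (frac b n) = frac (a + b) n.
Proof.
rewrite /ladd unlock; apply/fracE.
have := repr_frac a n; have := repr_frac b n.
case: (repr (frac a n)) (repr (frac b n)) => a1 n1 [b1 k1] /= Eb Ea.
rewrite !mulrDl -!mulrA -!exprD ![(_ + n)%N]addnC !exprD !mulrA Ea Eb.
by rewrite -!mulrA -!exprD [(k1 + n1)%N]addnC.
Qed.

(** The equation says that [x^-n b = b' x^-l]. Any two witnesses give the same fraction: both are
    compared after multiplication by a common power of [x], which can be cancelled on either
    side. *)
Let lmulE a n b k l b' : b * x ^+ l = x ^+ n * b' ->
  lmul (frac a n) (frac b k) = frac (a * b') (k + l).
Proof.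
move=> E; rewrite /lmul unlock; case: cid => -[l1 b1'] /=.
have := repr_frac a n; have := repr_frac b k.
case: (repr (frac a n)) (repr (frac b k)) => a1 n1 [b1 k1] /= Eb Ea E1.
apply/fracE; rewrite -!mulrA.
set u := b' * _; set w := b1' * _.
have uw : x ^+ n * u = x ^+ n1 * w.
  rewrite /u /w !mulrA -E -E1 -!mulrA -!exprD.
  rewrite (_ : (l + (k1 + l1) = k1 + (l + l1))%N); last by lia.
  rewrite (_ : (l1 + (k + l) = k + (l + l1))%N); last by lia.
  by rewrite !exprD !mulrA Eb.
case/orP: (leq_total n n1) => [le|le].
  have {}uw : u = x ^+ (n1 - n) * w.
    by apply: (@mulxl n); rewrite mulrA -exprD subnKC.
  have {Ea}-> : a1 = a * x ^+ (n1 - n).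
    by apply: (@mulxr n); rewrite Ea -mulrA -exprD subnK.
  by rewrite uw mulrA.
have {}uw : w = x ^+ (n - n1) * u.
  by apply: (@mulxl n1); rewrite -uw mulrA -exprD subnKC.
have {Ea}-> : a = a1 * x ^+ (n - n1).
  by apply: (@mulxr n1); rewrite -Ea -mulrA -exprD subnK.
by rewrite uw mulrA.
Qed.

Let laddA : associative ladd.
Proof.
by move=> r s t; have [n [a [b [c [-> -> ->]]]]] := frac_com3 r s t; rewrite !laddE addrA.
Qed.
Let laddC : commutative ladd.
Proof. by move=> r s; have [n [a [b [-> ->]]]] := frac_com r s; rewrite !laddE addrC. Qed.
Let frac0 n : lzero = frac 0 n.
Proof. by apply/fracE; rewrite !mul0r. Qed.
Let ladd0 : left_id lzero ladd.
Proof. by move=> r; rewrite (frac_repr r) (frac0 (repr r).2) laddE add0r. Qed.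
Let laddN : left_inverse lzero lopp ladd.
Proof. by move=> r; rewrite (frac_repr r) loppE laddE addNr -frac0. Qed.
HB.instance Definition _ := GRing.isZmodule.Build loc laddA laddC ladd0 laddN.

Let lmulA : associative lmul.
Proof.
move=> r s t; rewrite (frac_repr r) (frac_repr s) (frac_repr t).
move: (repr r) (repr s) (repr t) => [a n] [b k] [c p] /=.
have [[l b'] /= Eb] := orex b n; have [[j c'] /= Ec] := orex c k.
have [[i c''] /= Ec'] := orex c' l.
rewrite (lmulE _ _ Eb) (lmulE _ _ Ec).
rewrite (@lmulE _ _ _ _ i (b' * c'')); last by rewrite -mulrA Ec' mulrA Eb mulrA.
rewrite (@lmulE _ _ _ _ (j + i) c''); first by rewrite mulrA addnA.
by rewrite exprD mulrA Ec -mulrA Ec' mulrA -exprD.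
Qed.
Let lmul1l : left_id lone lmul.
Proof.
move=> r; rewrite (frac_repr r) (@lmulE _ _ _ _ 0 (repr r).1) ?mul1r ?addn0 //.
by rewrite mulr1.
Qed.
Let lmul1r : right_id lone lmul.
Proof.
by move=> r; rewrite (frac_repr r) (@lmulE _ _ _ _ (repr r).2 1) ?mulr1 ?mul1r ?add0n.
Qed.
Let lmulDl : left_distributive lmul ladd.
Proof.
move=> r s t; have [n [a [b [-> ->]]]] := frac_com r s; rewrite (frac_repr t).
case: (repr t) => c k /=; have [[l c'] /= Ec] := orex c n.
by rewrite laddE !(lmulE _ _ Ec) laddE mulrDl.
Qed.
Let lmulDr : right_distributive lmul ladd.
Proof.
move=> t r s; have [n [a [b [-> ->]]]] := frac_com r s; rewrite (frac_repr t).
case: (repr t) => c k /=; have [[l a'] /= Ea] := orex a k.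
have [[j b'] /= Eb] := orex b k.
rewrite laddE (@lmulE _ _ a _ (l + j) (a' * x ^+ j)); last by rewrite exprD mulrA Ea mulrA.
rewrite (@lmulE _ _ b _ (l + j) (b' * x ^+ l)); last by rewrite addnC exprD mulrA Eb mulrA.
rewrite laddE -mulrDr; apply: lmulE.
by rewrite mulrDl mulrDr exprD !mulrA -Ea -Eb -!mulrA -!exprD [(j + l)%N]addnC.
Qed.
Let lone_neq0 : lone != lzero.
Proof.
by apply/eqP => /fracE/eqP; rewrite !mulr1 (negPf (oner_neq0 A)).
Qed.
HB.instance Definition _ :=
  GRing.Zmodule_isNzRing.Build loc lmulA lmul1l lmul1r lmulDl lmulDr lone_neq0.

Let lscaleA a b r : lscale a (lscale b r) = lscale (a * b) r.
Proof. by rewrite (frac_repr r) !lscaleE scalerA. Qed.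
Let lscale1 : left_id 1 lscale.
Proof. by move=> r; rewrite (frac_repr r) lscaleE scale1r. Qed.
Let lscaleDr : right_distributive lscale +%R.
Proof.
move=> k r s; have [n [a [b [-> ->]]]] := frac_com r s.
by rewrite -[LHS]/(lscale _ (ladd _ _)) -[RHS]/(ladd _ _) laddE !lscaleE laddE scalerDr.
Qed.
Let lscaleDl r : {morph lscale^~ r : a b / a + b}.
Proof.
move=> k l; rewrite (frac_repr r) !lscaleE.
by rewrite -[RHS]/(ladd _ _) laddE scalerDl.
Qed.
HB.instance Definition _ :=
  GRing.Zmodule_isLmodule.Build K loc lscaleA lscale1 lscaleDr lscaleDl.

Let lscaleAl (k : K) (r s : loc) : k *: (r * s) = (k *: r) * s.
Proof.
rewrite -[LHS]/(lscale _ (lmul _ _)) -[RHS]/(lmul (lscale _ _) _).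
rewrite (frac_repr r) (frac_repr s); move: (repr r) (repr s) => [a n] [b p] /=.
have [[l b'] /= E] := orex b n.
by rewrite (lmulE _ _ E) !lscaleE (lmulE _ _ E) scalerAl.
Qed.
HB.instance Definition _ := GRing.Lmodule_isLalgebra.Build K loc lscaleAl.

Let lscaleAr (k : K) (r s : loc) : k *: (r * s) = r * (k *: s).
Proof.
rewrite -[LHS]/(lscale _ (lmul _ _)) -[RHS]/(lmul _ (lscale _ _)).
rewrite (frac_repr r) (frac_repr s); move: (repr r) (repr s) => [a n] [b p] /=.
have [[l b'] /= E] := orex b n.
rewrite (lmulE _ _ E) !lscaleE (@lmulE _ _ _ _ l (k *: b')) ?scalerAr //.
by rewrite -scalerAl E scalerAr.
Qed.
HB.instance Definition _ := GRing.Lalgebra_isAlgebra.Build K loc lscaleAr.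

Definition loc_in (a : A) : loc := frac a 0.

Let loc_in_additive : additive loc_in.
Proof. by move=> a b; rewrite -[RHS]/(ladd _ (lopp _)) loppE laddE. Qed.
HB.instance Definition _ := GRing.isAdditive.Build A loc loc_in loc_in_additive.

Let loc_in_multiplicative : multiplicative loc_in.
Proof.
split=> // a b; rewrite -[RHS]/(lmul _ _) (@lmulE _ _ _ _ 0 b) //.
by rewrite mulr1 mul1r.
Qed.
HB.instance Definition _ :=
  GRing.isMultiplicative.Build A loc loc_in loc_in_multiplicative.

Let loc_in_scalable : scalable loc_in.
Proof. by move=> k a; rewrite -[RHS]/(lscale _ _) lscaleE. Qed.
HB.instance Definition _ := GRing.isScalable.Build K A loc *:%R loc_in loc_in_scalable.

(** These four properties are all that is used of the localization from here on; the quotient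
    construction stays hidden behind the existential. *)
Lemma localization_exists : exists (R : algType K) (i : {lrmorphism A -> R}) (xi : R),
  [/\ i x * xi = 1, xi * i x = 1, injective i
    & forall r, exists a n, r = i a * xi ^+ n].
Proof.
have mE (r s : loc) : r * s = lmul r s by [].
have xxi : loc_in x * frac 1 1 = 1.
  rewrite mE (@lmulE _ _ _ _ 0 1) ?mulr1 ?mul1r //.
  by apply/fracE; rewrite mul1r mulr1.
have xix : frac 1 1 * loc_in x = 1.
  by rewrite mE (@lmulE _ _ _ _ 0 1) ?mulr1 ?mul1r.
exists loc, loc_in, (frac 1 1); split=> //.
  by move=> a b /fracE; rewrite !mulr1.
move=> r; exists (repr r).1, (repr r).2; rewrite {1}(frac_repr r).
have -> : frac 1 1 ^+ (repr r).2 = frac 1 (repr r).2.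
  elim: (repr r).2 => // n IH; rewrite exprS IH mE (@lmulE _ _ _ _ 1 1) ?mul1r ?mulr1 //.
  by rewrite addn1.
by rewrite mE (@lmulE _ _ _ _ 0 1) ?mul1r ?mulr1 ?addn0.
Qed.

End Localization.

(** * A Hilbert basis theorem *)

Section HilbertBasis.
Variables (K : fieldType) (A : algType K).
Implicit Types S I : set A.

(** Subalgebras are kept as subsets of one ambient algebra, so that generators can be adjoined one
    after the other without changing the carrier. *)
Definition left_ideal_in S I : Prop :=
  [/\ I `<=` S, I 0, forall a b, I a -> I b -> I (a + b) &
      forall s a, S s -> I a -> I (s * a)].

Definition noetherian_set S : Prop := forall I : nat -> set A,
  (forall n, left_ideal_in S (I n)) -> (forall n, I n `<=` I n.+1) ->
  exists N, forall n, I n `<=` I N.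

Definition subalgebra_gen (l : seq A) : set A :=
  [set a | forall S, subalgebra S -> (forall y, y \in l -> S y) -> S a].

Lemma subalgebra_gen_subalgebra l : subalgebra (subalgebra_gen l).
Proof.
split=> /=; first by move=> S [].
- by move=> a b Sa Sb S /[dup] SS [_ SD _ _] Sl; apply: SD; [exact: Sa|exact: Sb].
- by move=> a b Sa Sb S /[dup] SS [_ _ SM _] Sl; apply: SM; [exact: Sa|exact: Sb].
- by move=> k a Sa S /[dup] SS [_ _ _ SZ] Sl; apply: SZ; exact: Sa.
Qed.

Lemma mem_subalgebra_gen l y : y \in l -> subalgebra_gen l y.
Proof. by move=> yl S _; exact. Qed.

Lemma chain_le (I : nat -> set A) n k : (forall n, I n `<=` I n.+1) -> (n <= k)%N ->
  I n `<=` I k.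
Proof.
move=> II /subnK <-; elim: (k - n)%N => // d IH; apply: subset_trans IH _.
by rewrite addSn; exact: II.
Qed.

(** * Adjoining one generator that quasi-commutes up to lower terms *)

Section Step.
Variables (S : set A) (y : A).
Hypotheses (SS : subalgebra S) (nS : noetherian_set S).
Hypothesis h1 : forall s, S s -> exists2 s', S s' & S (s * y - y * s').
Hypothesis h2 : forall s, S s -> exists2 s', S s' & S (y * s - s' * y).

Let SD a b : S a -> S b -> S (a + b). Proof. by case: SS => _ H _ _; exact: H. Qed.
Let SM a b : S a -> S b -> S (a * b). Proof. by case: SS => _ _ H _; exact: H. Qed.
Let S0 : S 0 := subalgebra0 SS.

(** Polynomials in [y] of degree less than [n] with coefficients on the right. The generator [y]
    need not be free over [S], so such an expression is not unique, and degrees and leading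
    coefficients are relations rather than functions. *)
Fixpoint poly_lt (n : nat) : set A :=
  if n is n'.+1 then [set a | exists t s, [/\ poly_lt n' t, S s & a = t + y ^+ n' * s]]
  else [set 0].

Let Lt0 n : poly_lt n 0.
Proof. by elim: n => //= n IH; exists 0, 0; rewrite mulr0 addr0. Qed.

Let LtS n a : poly_lt n a -> poly_lt n.+1 a.
Proof. by exists a, 0; rewrite mulr0 addr0. Qed.

Let LtD n a b : poly_lt n a -> poly_lt n b -> poly_lt n (a + b).
Proof.
elim: n a b => [a b /= -> ->|n IH _ _ /= [t [s [Lt Ss ->]]] [t' [s' [Lt' Ss' ->]]]].
  by rewrite addr0.
by exists (t + t'), (s + s'); split; [exact: IH|exact: SD|rewrite mulrDr addrACA].
Qed.

Let LtMr n a s : S s -> poly_lt n a -> poly_lt n (a * s).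
Proof.
move=> Ss; elim: n a => [a /= ->|n IH _ /= [t [s' [Lt Ss' ->]]]]; first by rewrite mul0r.
by exists (t * s), (s' * s); split; [exact: IH|exact: SM|rewrite mulrDl mulrA].
Qed.

Let LtN n a : poly_lt n a -> poly_lt n (- a).
Proof.
by rewrite -mulrN1; apply: LtMr; apply: subalgebraN => //; case: SS.
Qed.

Let LtX n s : S s -> poly_lt n.+1 (y ^+ n * s).
Proof. by move=> Ss; exists 0, s; rewrite add0r. Qed.

Let LtMy n a : poly_lt n a -> poly_lt n.+1 (a * y).
Proof.
elim: n a => [a -> /=|n IH _ [t [s [Lt Ss ->]]]].
  by exists 0, 0; rewrite mulr0 mul0r addr0.
have [s' Ss' E] := h1 Ss; rewrite mulrDl -mulrA -(subrK (y * s') (s * y)) mulrDr mulrA -exprSr.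
apply: LtD; first by apply: LtS; exact: IH.
by apply: LtD; [apply: LtS; exact: LtX|exact: LtX].
Qed.

Let LtyM n a : poly_lt n a -> poly_lt n.+1 (y * a).
Proof.
elim: n a => [a -> /=|n IH _ [t [s [Lt Ss ->]]]].
  by exists 0, 0; rewrite !mulr0 addr0.
by rewrite mulrDr mulrA -exprS; apply: LtD; [apply: LtS; exact: IH|exact: LtX].
Qed.

Let LtXM k n a : poly_lt n a -> poly_lt (k + n) (y ^+ k * a).
Proof.
move=> Lt; elim: k => [|k IH]; first by rewrite mul1r.
by rewrite exprS -mulrA; exact: LtyM.
Qed.

Let movel n s : S s -> exists2 s', S s' & poly_lt n (s * y ^+ n - y ^+ n * s').
Proof.
elim: n s => [|n IH] s Ss; first by exists s => //; rewrite mulr1 mul1r subrr.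
have [s' Ss' E] := IH _ Ss; have [s'' Ss'' E'] := h1 Ss'; exists s'' => //.
rewrite (_ : _ - _ = (s * y ^+ n - y ^+ n * s') * y + y ^+ n * (s' * y - y * s'')).
  by apply: LtD; [exact: LtMy|exact: LtX].
by rewrite mulrBl mulrBr -!mulrA -!exprSr [y ^+ n * (y * _)]mulrA -exprSr addrA subrK.
Qed.

(** Leading coefficients stand on the right of [y ^+ n]. To multiply one by [s] from the left, the
    polynomial is multiplied by an [s'] that becomes [s] after passing [y ^+ n]. *)
Let mover n s : S s -> exists2 s', S s' & poly_lt n (s' * y ^+ n - y ^+ n * s).
Proof.
elim: n s => [|n IH] s Ss; first by exists s => //; rewrite mulr1 mul1r subrr.
have [s1 Ss1 E] := h2 Ss; have [s' Ss' E'] := IH _ Ss1; exists s' => //.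
rewrite (_ : _ - _ = (s' * y ^+ n - y ^+ n * s1) * y - y ^+ n * (y * s - s1 * y)).
  by apply: LtD; [exact: LtMy|apply: LtN; exact: LtX].
by rewrite mulrBl mulrBr -!mulrA -!exprSr [y ^+ n * (y * _)]mulrA -exprSr opprB addrA subrK.
Qed.

Let LtSM n s a : S s -> poly_lt n a -> poly_lt n (s * a).
Proof.
elim: n s a => [s a _ /= ->|n IH s _ Ss [t [s0 [Lt Ss0 ->]]]]; first by rewrite mulr0.
have [s' Ss' E] := movel n Ss.
rewrite mulrDr mulrA -(subrK (y ^+ n * s') (s * y ^+ n)) mulrDl.
apply: LtD; first by apply: LtS; exact: IH.
apply: LtD; first by apply: LtS; exact: LtMr.
by rewrite -mulrA; apply: LtX; exact: SM.
Qed.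

Let Lt_le n k : (n <= k)%N -> poly_lt n `<=` poly_lt k.
Proof. by apply: chain_le => i a; exact: LtS. Qed.

Definition poly_set : set A := [set a | exists n, poly_lt n a].

Lemma poly_set_subalgebra : subalgebra poly_set.
Proof.
have [S1 _ _ SZ] := SS; split=> /=.
- by exists 1%N, 0, 1; rewrite add0r expr0 mulr1.
- move=> a b [n Ln] [k Lk]; exists (maxn n k); apply: LtD.
    exact: Lt_le (leq_maxl n k) _ Ln.
  exact: Lt_le (leq_maxr n k) _ Lk.
- move=> a b [n Ln] [k Lk]; elim: n a Ln => [a ->|n IH _ [t [s [Lt Ss ->]]]].
    by exists 0%N; rewrite mul0r.
  have [j Lj] := IH _ Lt; exists (maxn j (n + k)); rewrite mulrDl; apply: LtD.
    exact: Lt_le (leq_maxl _ _) _ Lj.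
  by rewrite -mulrA; apply: Lt_le (leq_maxr _ _) _ _; apply: LtXM; exact: LtSM.
- move=> k a [n Ln]; exists n; rewrite -mulr_algr; apply: LtMr => //; exact: SZ.
Qed.

Lemma poly_set_sub : S `<=` poly_set.
Proof. by move=> s Ss; exists 1%N, 0, s; rewrite expr0 mul1r add0r. Qed.

Lemma poly_set_var : poly_set y.
Proof.
by exists 2%N; rewrite -[y]mulr1 -[y]expr1; apply: LtX; case: SS.
Qed.

Lemma poly_set_min S' : subalgebra S' -> S `<=` S' -> S' y -> poly_set `<=` S'.
Proof.
move=> SS' sS y' a [n]; elim: n a => [a ->|n IH _ [t [s [/IH St Ss ->]]]].
  exact: subalgebra0.
have [_ SD' SM' _] := SS'; apply: (SD') => //; apply: SM'; last exact: sS.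
exact: subalgebraX.
Qed.

Lemma noetherian_poly_set : noetherian_set poly_set.
Proof.
move=> I idI II.
have I0 n : I n 0 by case: (idI n).
have IA n a b : I n a -> I n b -> I n (a + b) by case: (idI n) => _ _ H _; exact: H.
have IM n s a : poly_set s -> I n a -> I n (s * a).
  by case: (idI n) => _ _ _ H; exact: H.
have IN n a : I n a -> I n (- a).
  move=> Ia; rewrite -mulN1r; apply: IM => //.
  by apply: poly_set_sub; apply: subalgebraN => //; case: SS.
(* The leading coefficients in degree [k] of the elements of [I n]; they form a left ideal of [S]
   that increases with both [k] and [n]. *)
pose LC k n := [set s | S s /\ exists2 t, poly_lt k t & I n (t + y ^+ k * s)].
have idLC k n : left_ideal_in S (LC k n).
  split; first by move=> s [].
  - by split=> //; exists 0; rewrite // mulr0 addr0.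
  - move=> a b [Sa [t Lt It]] [Sb [t' Lt' It']]; split; first exact: SD.
    exists (t + t'); first exact: LtD.
    by rewrite mulrDr addrACA; exact: IA.
  - move=> s a Ss [Sa [t Lt It]]; split; first exact: SM.
    have [s' Ss' E] := mover k Ss.
    exists (s' * t + (s' * y ^+ k - y ^+ k * s) * a).
      by apply: LtD; [exact: LtSM|exact: LtMr].
    rewrite (_ : _ + _ + _ = s' * (t + y ^+ k * a)); last first.
      by rewrite mulrBl mulrDr !mulrA addrA subrK.
    by apply: IM => //; exact: poly_set_sub.
have LCn k n : LC k n `<=` LC k n.+1.
  by move=> s [Ss [t Lt It]]; split=> //; exists t => //; exact: II.
have LCk k n : LC k n `<=` LC k.+1 n.
  move=> s [Ss [t Lt It]]; split=> //; exists (y * t); first exact: LtyM.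
  by rewrite exprS -mulrA -mulrDr; apply: IM => //; exact: poly_set_var.
have LCle k n k' n' : (k <= k')%N -> (n <= n')%N -> LC k n `<=` LC k' n'.
  move=> kk nn; apply: (@subset_trans _ (LC k n')).
    exact: (@chain_le (LC k)).
  exact: (@chain_le (fun k => LC k n')).
(* The diagonal chain settles all degrees from [N] on at once; below [N] finitely many chains
   remain, and [M] bounds them together. *)
have [N HN] := nS (fun n => idLC n n) (fun n => LCle _ _ _ _ (leqnSn n) (leqnSn n)).
have [M HM] : exists M, forall k n, (k < N)%N -> LC k n `<=` LC k M.
  elim: (N) => [|N' [M HM]]; first by exists 0%N.
  have [M' HM'] := nS (idLC N') (LCn N').
  exists (maxn M M') => k n; rewrite ltnS leq_eqVlt => /orP[/eqP->|kN].
    by apply: subset_trans (HM' n) _; apply: LCle => //; exact: leq_maxr.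
  by apply: subset_trans (HM k n kN) _; apply: LCle => //; exact: leq_maxl.
exists (maxn N M) => n.
have HL k : LC k n `<=` LC k (maxn N M).
  have [kN|Nk] := ltnP k N.
    by apply: subset_trans (HM k n kN) _; apply: LCle => //; exact: leq_maxr.
  apply: (@subset_trans _ (LC (maxn k n) (maxn k n))).
    by apply: LCle; [exact: leq_maxl|exact: leq_maxr].
  by apply: subset_trans (HN _) _; apply: LCle => //; exact: leq_maxl.
wlog nM : n HL / (maxn N M <= n)%N.
  move=> H; have [le|/ltnW le] := leqP (maxn N M) n; first exact: H.
  exact: chain_le.
move=> a Ia; have [+ _ _ _] := idI n => /(_ _ Ia)[k Lk].
(* Descent on the degree: subtract an element of the stationary ideal with the same leading
   coefficient. *)
suff H j b : poly_lt j b -> I n b -> I (maxn N M) b by exact: (H k).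
elim: j b => [b ->|j IH b [t [s [Lt Ss E]]] Ib]; first by move=> _; exact: I0.
have [_ [t' Lt' It']] : LC j (maxn N M) s.
  by apply: HL; split=> //; exists t; rewrite -?E.
rewrite E (_ : t + _ = (t - t') + (t' + y ^+ j * s)); last by rewrite addrA subrK.
apply: (IA) => //; apply: IH; first by apply: LtD => //; exact: LtN.
rewrite (_ : t - t' = (t + y ^+ j * s) - (t' + y ^+ j * s)); last first.
  by rewrite opprD addrACA subrr addr0.
rewrite -E; exact: (IA _ _ _ Ib (IN _ _ (chain_le II nM It'))).

Qed.

End Step.

Lemma noetherian_scalars : noetherian_set (subalgebra_gen [::]).
Proof.
move=> I idI II.
have sc : subalgebra_gen [::] `<=` [set a | exists k : K, a = k *: 1].
  move=> a; apply=> //; split=> /=; first by exists 1; rewrite scale1r.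
  - by move=> _ _ [k ->] [l ->]; exists (k + l); rewrite scalerDl.
  - by move=> _ _ [k ->] [l ->]; exists (k * l); rewrite -scalerAl mul1r scalerA.
  - by move=> k _ [l ->]; exists (k * l); rewrite scalerA.
have [[N [k [k0 Ik]]]|nI] := pselect (exists N k, k != 0 /\ I N (k *: 1)).
  exists N => n a Ia; have [IS _ _ IM] := idI N.
  have [+ _ _ _] := idI n => /(_ _ Ia) Sa.
  rewrite (_ : a = (k^-1 *: a) * (k *: 1)); last first.
    by rewrite -scalerAl -scalerAr mulr1 scalerA mulVf // scale1r.
  by apply: IM => //; have [_ _ _ SZ] := subalgebra_gen_subalgebra [::]; exact: SZ.
exists 0%N => n a Ia; have [+ _ _ _] := idI n => /(_ _ Ia)/sc[k Ea].
have [k0|k0] := eqVneq k 0; first by rewrite Ea k0 scale0r; case: (idI 0%N).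
by case: nI; exists n, k; split=> //; rewrite -Ea.
Qed.

Lemma eq_subalgebra_gen (l l' : seq A) : l =i l' -> subalgebra_gen l = subalgebra_gen l'.
Proof.
move=> ll; apply/seteqP; split=> a Sa S SS Sl; apply: Sa => // y yl; apply: Sl.
  by rewrite -ll.
by rewrite ll.
Qed.

(** The commutation hypothesis is needed for every element of the smaller subalgebra but given on
    its generators; it spreads because the elements that pass [y] modulo that subalgebra form a
    subalgebra themselves. *)
Lemma noetherian_cons (y : A) (l : seq A) :
  noetherian_set (subalgebra_gen l) ->
  (forall z, z \in l ->
     exists2 c : K, c != 0 & subalgebra_gen l (y * z - c *: (z * y))) ->
  noetherian_set (subalgebra_gen (y :: l)).
Proof.
move=> IH Hl.
have SS := subalgebra_gen_subalgebra l; have [S1 SD SM SZ] := SS.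
set S := subalgebra_gen l in SS S1 SD SM SZ Hl IH.
have h1 : S `<=` [set s | S s /\ exists2 s', S s' & S (s * y - y * s')].
  move=> s; apply=> //; last first.
    move=> z zl; split; first exact: mem_subalgebra_gen.
    have [c c0 E] := Hl _ zl; exists (c^-1 *: z).
      by apply: SZ; exact: mem_subalgebra_gen.
    rewrite (_ : _ - _ = (- c^-1) *: (y * z - c *: (z * y))); first exact: SZ.
    by rewrite scalerBr !scaleNr scalerA mulVf // scale1r opprK -scalerAr addrC.
  split=> /=.
  - by split=> //; exists 1; rewrite // mulr1 mul1r subrr; exact: subalgebra0.
  - move=> a b [Sa [a' Sa' Ea]] [Sb [b' Sb' Eb]]; split; first exact: SD.
    exists (a' + b'); first exact: SD.
    by rewrite mulrDl mulrDr opprD addrACA; exact: SD.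
  - move=> a b [Sa [a' Sa' Ea]] [Sb [b' Sb' Eb]]; split; first exact: SM.
    exists (a' * b'); first exact: SM.
    rewrite (_ : _ - _ = a * (b * y - y * b') + (a * y - y * a') * b').
      by apply: SD; exact: SM.
    by rewrite mulrBr mulrBl !mulrA addrA subrK.
  - move=> k a [Sa [a' Sa' Ea]]; split; first exact: SZ.
    exists (k *: a'); first exact: SZ.
    by rewrite -scalerAl -scalerAr -scalerBr; exact: SZ.
have h2 : S `<=` [set s | S s /\ exists2 s', S s' & S (y * s - s' * y)].
  move=> s; apply=> //; last first.
    move=> z zl; split; first exact: mem_subalgebra_gen.
    have [c c0 E] := Hl _ zl; exists (c *: z); last by rewrite -scalerAl.
    by apply: SZ; exact: mem_subalgebra_gen.
  split=> /=.
  - by split=> //; exists 1; rewrite // mulr1 mul1r subrr; exact: subalgebra0.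
  - move=> a b [Sa [a' Sa' Ea]] [Sb [b' Sb' Eb]]; split; first exact: SD.
    exists (a' + b'); first exact: SD.
    by rewrite mulrDl mulrDr opprD addrACA; exact: SD.
  - move=> a b [Sa [a' Sa' Ea]] [Sb [b' Sb' Eb]]; split; first exact: SM.
    exists (a' * b'); first exact: SM.
    rewrite (_ : _ - _ = (y * a - a' * y) * b + a' * (y * b - b' * y)).
      by apply: SD; exact: SM.
    by rewrite mulrBr mulrBl !mulrA addrA subrK.
  - move=> k a [Sa [a' Sa' Ea]]; split; first exact: SZ.
    exists (k *: a'); first exact: SZ.
    by rewrite -scalerAl -scalerAr -scalerBr; exact: SZ.
suff -> : subalgebra_gen (y :: l) = poly_set S y.
  apply: noetherian_poly_set => // s Ss; first by have [] := h1 _ Ss.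
  by have [] := h2 _ Ss.
have PS : subalgebra (poly_set S y).
  by apply: poly_set_subalgebra => // s Ss; first by have [] := h1 _ Ss.
apply/seteqP; split.
  move=> a; apply=> // z; rewrite inE => /orP[/eqP->|zl].
    exact: poly_set_var.
  by apply: poly_set_sub => //; exact: mem_subalgebra_gen.
apply: poly_set_min => //; first exact: subalgebra_gen_subalgebra.
  move=> a Sa S' SS' S'l; apply: Sa => // z zl; apply: S'l.
  by rewrite inE zl orbT.
by apply: mem_subalgebra_gen; rewrite inE eqxx.
Qed.

End HilbertBasis.

(** * Localization and strata *)

Section LocalizationStrata.
Variables (K : fieldType) (G : Type) (A : algType K) (act : G -> {lrmorphism A -> A}).
Variable x : A.
Hypotheses (hp : hprime0 act) (wx : weight_vector act x).
Hypotheses (lf : forall a, locfin x a) (nA : noetherian_set [set: A]).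

Lemma str0_weight_vector P u : str0 act P -> weight_vector act u -> P u -> u = 0.
Proof.
move=> [/prime_idealP[idP _ _] cP] wu Pu; apply: cP => g.
by have [c _ ->] := wu g; exact: idealZ.
Qed.

Let ore_ideal I a n : ideal I -> I a -> exists k a', I a' /\ a * x ^+ k = x ^+ n * a'.
Proof.
move=> idI Ia; elim: n => [|n [k [a' [Ia' E]]]].
  by exists 0%N, a; rewrite mulr1 mul1r.
have [l [a'' [Ia'' E']]] := locfin_ore idI Ia' (lf a').
by exists (k + l)%N, a''; rewrite exprD mulrA E -mulrA E' mulrA exprSr.
Qed.

Let ore a n : exists k a', a * x ^+ k = x ^+ n * a'.
Proof.
have [k [a' [_ E]]] := @ore_ideal setT a n
  (And4 I (fun _ _ _ _ => I) (fun _ _ _ => I) (fun _ _ _ => I)) I.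
by exists k, a'.
Qed.

Let torsion P : set A := [set a | exists n, P (a * x ^+ n)].

(** The left ideals of those [a] with [a * x ^+ n] in [P] ascend with [n], so one exponent
    annihilates all torsion. *)
Let torsion_bound P : ideal P -> exists N, forall a, torsion P a -> P (a * x ^+ N).
Proof.
move=> idP; have [||N HN] := nA (I := fun n => [set a | P (a * x ^+ n)]).
- move=> n; split=> //=; first by rewrite mul0r; exact: ideal0.
    by move=> a b Pa Pb; rewrite mulrDl; exact: idealD.
  by move=> s a _ Pa; rewrite -mulrA; exact: idealMl.
- by move=> n a /= Pa; rewrite exprSr mulrA; exact: idealMr.
- by exists N => a [n]; exact: HN.
Qed.

Let torsion_ideal P : ideal P -> ideal (torsion P).
Proof.
move=> idP; split.
- by exists 0%N; rewrite mul0r; exact: ideal0.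
- move=> a b [n Pa] [k Pb]; exists (n + k)%N; rewrite mulrDl; apply: idealD => //.
    by rewrite exprD mulrA; exact: idealMr.
  by rewrite addnC exprD mulrA; exact: idealMr.
- by move=> a b [n Pb]; exists n; rewrite -mulrA; exact: idealMl.
- move=> b a [n Pa]; have [k [b' E]] := ore b n; exists k.
  by rewrite -mulrA E mulrA; exact: idealMr.
Qed.

Let xgen_torsion P N : ideal P -> (forall a, torsion P a -> P (a * x ^+ N)) ->
  forall a b, torsion P a -> ideal_gen [set x ^+ N] b -> P (a * b).
Proof.
move=> idP HN a b Ta /ideal_genP[l [lx ->]]; rewrite mulr_sumr big_seq.
apply: ideal_sum => // t /lx ->; rewrite !mulrA; apply: idealMr => //.
by apply: HN; apply: idealMr => //; exact: torsion_ideal.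
Qed.

Let xgen_stable N : stable act (ideal_gen [set x ^+ N]).
Proof.
move=> g b /ideal_genP[l [lx ->]]; rewrite rmorph_sum big_seq.
apply: (ideal_sum _ (ideal_gen_ideal _)) => t /lx ->; rewrite !rmorphM /=.
apply: (idealMr _ (ideal_gen_ideal _)); apply: (idealMl _ (ideal_gen_ideal _)).
have [c _ ->] := weight_vectorX N wx g.
by apply: (idealZ _ (ideal_gen_ideal _)); exact: sub_ideal_gen.
Qed.

Hypothesis xnil : forall n, x ^+ n <> 0.

(** The torsion ideal of 0 and the ideal generated by [x ^+ N], with [N] bounding the torsion, are
    stable and have zero product; the second is nonzero because [x] is not nilpotent. *)
Lemma regular_of_not_nilpotent a : a * x = 0 -> a = 0.
Proof.
have id0 := zero_ideal A.
have [N HN] := torsion_bound id0; move=> ax0.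
have [|H|/(_ (x ^+ N)) H] := hp (torsion_ideal id0) _ (ideal_gen_ideal [set x ^+ N])
   (@xgen_stable N) (xgen_torsion id0 HN).
- move=> g b [n /= E]; exists n => /=; have [c c0 Ec] := weight_vectorX n wx g.
  have := congr1 (act g) E; rewrite rmorphM /= Ec rmorph0 -scalerAr => /eqP.
  by rewrite scaler_eq0 (negPf c0) => /eqP.
- by apply: H; exists 1%N.
- by case: (xnil (n := N)); apply: H; exact: sub_ideal_gen.
Qed.

Let xr := regular_of_not_nilpotent.
Let xl a : x * a = 0 -> a = 0 := locfin_regl xr (lf a).

(** A prime with zero core contains no nonzero weight vector, hence not [x ^+ N]. As the torsion
    modulo [P] times the ideal of [x ^+ N] lies in [P], the torsion itself lies in [P]. *)
Lemma str0_saturated P a n : str0 act P -> P (a * x ^+ n) -> P a.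
Proof.
move=> /[dup] sP [/prime_idealP[idP nT PP] cP] Pa.
have [N HN] := torsion_bound idP.
have [] := PP _ _ (torsion_ideal idP) (ideal_gen_ideal [set x ^+ N])
  (xgen_torsion idP HN); first by apply; exists n.
move=> /(_ (x ^+ N)) H; case: (xnil (n := N)).
apply: (str0_weight_vector sP (weight_vectorX N wx)); apply: H.
exact: sub_ideal_gen.
Qed.

(** * Universal property of the fractions, extension and contraction of primes *)

Section Fractions.
Variables (R : algType K) (i : {lrmorphism A -> R}) (xi : R).
Hypotheses (xxi : i x * xi = 1) (xix : xi * i x = 1) (inji : injective i).
Hypothesis fr : forall r, exists a n, r = i a * xi ^+ n.

Let inv_exp (B : algType K) (u v : B) n : u * v = 1 -> u ^+ n * v ^+ n = 1.
Proof.
move=> uv; elim: n => [|n IH]; first by rewrite mulr1.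
by rewrite exprSr exprS mulrA -(mulrA _ u) uv mulr1.
Qed.

Let xiX (B : algType K) (f : {lrmorphism A -> B}) (y : B) a a' n k :
  f x * y = 1 -> y * f x = 1 ->
  a * x ^+ k = x ^+ n * a' -> y ^+ n * f a = f a' * y ^+ k.
Proof.
move=> fy yf /(congr1 f); rewrite !rmorphM !rmorphXn /= => E.
rewrite -[LHS]mulr1 -(inv_exp k fy) mulrA -[_ * f a * _]mulrA E mulrA.
by rewrite (inv_exp n yf) mul1r.
Qed.

Let cross (B : algType K) (p r u w : B) n k :
  u * w = 1 -> p * u ^+ k = r * u ^+ n -> p * w ^+ n = r * w ^+ k.
Proof.
move=> uw E; rewrite -[p]mulr1 -(inv_exp k uw) mulrA E -!mulrA -exprD addnC exprD.
by rewrite (mulrA (u ^+ n)) (inv_exp n uw) mul1r.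
Qed.

Let common r s : exists a b n, r = i a * xi ^+ n /\ s = i b * xi ^+ n.
Proof.
have [a [n ->]] := fr r; have [b [k ->]] := fr s.
exists (a * x ^+ k), (b * x ^+ n), (n + k)%N.
rewrite !rmorphM !rmorphXn /= -!mulrA; split; congr (_ * _).
  by rewrite addnC exprD mulrA (inv_exp k xxi) mul1r.
by rewrite exprD mulrA (inv_exp n xxi) mul1r.
Qed.

(** The extension is defined by a chosen representative of each fraction; [FE] shows that the choice
    does not matter. It is used to extend each automorphism, which sends [x] to a nonzero multiple
    of itself. *)
Lemma frac_extend (B : algType K) (f : {lrmorphism A -> B}) (y : B) :
  f x * y = 1 -> y * f x = 1 -> exists f' : {lrmorphism R -> B}, forall a, f' (i a) = f a.
Proof.
move=> fy yf.
have fr2 r : exists p : A * nat, r = i p.1 * xi ^+ p.2.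
  by have [a [n ->]] := fr r; exists (a, n).
pose F r := let p := projT1 (cid (fr2 r)) in f p.1 * y ^+ p.2.
have FE a n : F (i a * xi ^+ n) = f a * y ^+ n.
  rewrite /F; case: cid => -[b k] /= E.
  have {}E : a * x ^+ k = b * x ^+ n.
    by apply: inji; rewrite !rmorphM !rmorphXn /=; exact: cross E.
  by apply: (cross fy); rewrite -!rmorphXn -!rmorphM E.
have FD : {morph F : r s / r + s}.
  move=> r s; have [a [b [n [-> ->]]]] := common r s.
  by rewrite -mulrDl -rmorphD !FE rmorphD mulrDl.
have F1 : F 1 = 1 by have := FE 1 0%N; rewrite !rmorph1 !expr0 !mulr1.
have FM : {morph F : r s / r * s}.
  move=> r s; have [a [n ->]] := fr r; have [b [k ->]] := fr s.
  have [l [b' E]] := ore b n.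
  rewrite mulrA -[_ * _ * i b]mulrA (xiX xxi xix E) mulrA -rmorphM -mulrA -exprD !FE.
  by rewrite rmorphM exprD !mulrA; congr (_ * _); rewrite -!mulrA (xiX fy yf E).
have FZ : scalable F.
  by move=> k r; have [a [n ->]] := fr r; rewrite scalerAl -linearZ !FE linearZ scalerAl.
have [F' F'E] := lrmorphism_exists FD FM F1 FZ.
by exists F' => a; rewrite F'E; have := FE a 0%N; rewrite !mulr1.
Qed.

Lemma frac_act : exists actR : G -> {lrmorphism R -> R},
  forall g a, actR g (i a) = i (act g a).
Proof.
suff H g : exists f : {lrmorphism R -> R}, forall a, f (i a) = i (act g a).
  by exists (fun g => projT1 (cid (H g))) => g a; case: cid.
have [c c0 Ec] := wx g.
apply: (@frac_extend _ (i \o act g : {lrmorphism A -> R}) (c^-1 *: xi)) => /=.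
  by rewrite Ec linearZ -scalerAl -scalerAr scalerA mulfV // scale1r.
by rewrite Ec linearZ -scalerAl -scalerAr scalerA mulVf // scale1r.
Qed.

Variable actR : G -> {lrmorphism R -> R}.
Hypothesis actRi : forall g a, actR g (i a) = i (act g a).

Let e (I : set A) : set R := [set r | exists a n, I a /\ r = i a * xi ^+ n].
Let c (I : set R) : set A := [set a | I (i a)].

Let e_ideal I : ideal I -> ideal (e I).
Proof.
move=> idI; split.
- by exists 0, 0%N; split; [exact: ideal0|rewrite rmorph0 mul0r].
- move=> _ _ [a [n [Ia ->]]] [b [k [Ib ->]]].
  exists (a * x ^+ k + b * x ^+ n), (n + k)%N; split.
    by apply: idealD => //; exact: idealMr.
  rewrite rmorphD !rmorphM !rmorphXn /= mulrDl; congr (_ + _).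
    by rewrite -mulrA addnC exprD (mulrA (i x ^+ k)) (inv_exp k xxi) mul1r.
  by rewrite -mulrA exprD (mulrA (i x ^+ n)) (inv_exp n xxi) mul1r.
- move=> r _ [a [n [Ia ->]]]; have [b [k ->]] := fr r.
  have [l [a' [Ia' E]]] := ore_ideal k idI Ia.
  exists (b * a'), (l + n)%N; split; first exact: idealMl.
  by rewrite mulrA -[_ * _ * i a]mulrA (xiX xxi xix E) mulrA -rmorphM -mulrA -exprD.
- move=> r _ [a [n [Ia ->]]]; have [b [k ->]] := fr r.
  have [l [b' E]] := ore b n.
  exists (a * b'), (l + k)%N; split; first exact: idealMr.
  by rewrite mulrA -[_ * _ * i b]mulrA (xiX xxi xix E) mulrA -rmorphM -mulrA -exprD.
Qed.

Let c_ideal I : ideal I -> ideal (c I).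
Proof. exact: ideal_preimage. Qed.

Let ce I : I `<=` c (e I).
Proof. by move=> a Ia; exists a, 0%N; rewrite mulr1. Qed.

Let ec I : ideal I -> I `<=` e (c I).
Proof.
move=> idI r Ir; have [a [n E]] := fr r; exists a, n; split=> //.
rewrite /c /= -[i a]mulr1 -(inv_exp n xix) mulrA -E; exact: idealMr.
Qed.

Let em I J : I `<=` J -> e I `<=` e J.
Proof. by move=> IJ _ [a [n [Ia ->]]]; exists a, n; split=> //; exact: IJ. Qed.

Lemma frac_hprime0 : hprime0 actR.
Proof.
move=> I J idI sI idJ sJ IJ.
have st I0 : stable actR I0 -> stable act (c I0).
  by move=> s0 g a ca; rewrite /c /= -actRi; exact: s0.
have cI0 I0 : ideal I0 -> c I0 `<=` [set 0] -> I0 `<=` [set 0].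
  move=> idI0 I00 r /(ec idI0)[a [n [/I00 -> ->]]].
  by rewrite rmorph0 mul0r.
have [] := hp (c_ideal idI) (st _ sI) (c_ideal idJ) (st _ sJ).
- by move=> a b Ia Jb; apply: inji; rewrite rmorphM rmorph0; exact: IJ.
- by move=> /(cI0 _ idI); left.
- by move=> /(cI0 _ idJ); right.
Qed.

Lemma frac_spec_equiv : spec_equiv (str0 act) (str0 actR).
Proof.
apply: (@spec_equiv_galois _ _ _ _ e c) => //.
- by move=> I J IJ a; exact: IJ.
- move=> P sP; have [/prime_idealP[idP nT PP] cP] := sP.
  have ceP : c (e P) `<=` P.
    move=> a [p [n [Pp E]]]; apply: (str0_saturated (n := n) sP).
    rewrite (_ : a * x ^+ n = p) //; apply: inji.
    by rewrite rmorphM rmorphXn /= E -mulrA (inv_exp n xix) mulr1.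
  split=> //; split; last first.
    move=> r Pr; have [a [n E]] := fr r.
    suff -> : r = 0 by [].
    (* A denominator can be cleared after acting: the action multiplies [x ^+ n] by a nonzero
       scalar, and multiplying the translate of [r] by the translate of [x ^+ n] gives that of [a],
       which contracts into [P]. *)
    rewrite E (cP a) ?rmorph0 ?mul0r // => g; apply: ceP; rewrite /c /= -actRi.
    have [k k0 Ek] := weight_vectorX n wx g.
    have := idealMr (i (act g (x ^+ n))) (e_ideal idP) (Pr g).
    rewrite -actRi -rmorphM E -mulrA rmorphXn /= (inv_exp n xix) mulr1.
    by [].
  apply/prime_idealP; split; first exact: e_ideal.
    by move=> e1; apply: nT; apply: ceP; rewrite /c /= rmorph1.
  move=> I J idI idJ IJ.
  have [|IP|JP] := PP _ _ (c_ideal idI) (c_ideal idJ).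
  + by move=> a b Ia Jb; apply: ceP; rewrite /c /= rmorphM; exact: IJ.
  + by left; apply: subset_trans (ec idI) _; exact: em.
  + by right; apply: subset_trans (ec idJ) _; exact: em.
- move=> Q [/prime_idealP[idQ nT QQ] cQ].
  have ecQ : e (c Q) `<=` Q by move=> _ [a [n [ca ->]]]; exact: idealMr.
  split=> //; split; last first.
    by move=> a ca; apply: inji; rewrite rmorph0; apply: cQ => g; rewrite actRi; exact: ca.
  apply/prime_idealP; split; first exact: c_ideal.
    by rewrite /c /= rmorph1.
  move=> I J idI idJ IJ.
  have [|IP|JP] := QQ _ _ (e_ideal idI) (e_ideal idJ).
  + move=> _ _ [a [n [Ia ->]]] [b [k [Jb ->]]].
    have [l [b' [Jb' E]]] := ore_ideal n idJ Jb.
    rewrite mulrA -[_ * _ * i b]mulrA (xiX xxi xix E) mulrA -rmorphM.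
    by do 2!apply: idealMr => //; exact: IJ.
  + by left => a Ia; apply: IP; exact: ce.
  + by right => a Ja; apply: JP; exact: ce.
Qed.

End Fractions.

Lemma localization_str0 : exists (R : algType K) (i : {lrmorphism A -> R}) (xi : R)
    (actR : G -> {lrmorphism R -> R}),
  [/\ i x * xi = 1 /\ xi * i x = 1, injective i, forall r, exists a n, r = i a * xi ^+ n,
      forall g a, actR g (i a) = i (act g a)
    & hprime0 actR /\ spec_equiv (str0 act) (str0 actR)].
Proof.
have [|R [i [xi [xxi xix inji fr]]]] := localization_exists xr xl.
  by move=> a; have [k [a' E]] := ore a 1; exists k, a'; rewrite E expr1.
have [actR actRi] := frac_act xxi xix inji fr.
exists R, i, xi, actR; split=> //; split; first exact: (@frac_hprime0 _ _ _ xix inji fr _ actRi).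
exact: (@frac_spec_equiv _ _ _ xxi xix inji fr _ actRi).
Qed.

End LocalizationStrata.

(** * Nilpotent entries of two-by-two quantum matrices *)

Section TwoByTwo.
Variables (K : fieldType) (A : algType K) (q : K).
Hypotheses (q_neq0 : q != 0) (q_not_root1 : forall k : nat, (0 < k)%N -> q ^+ k != 1).

Lemma foldl_mul (T : Type) (F : T -> A) (s : seq T) (w u : A) :
  (forall t, GRing.comm u (F t)) ->
  foldl (fun w t => w * F t) (w * u) s = foldl (fun w t => w * F t) w s * u.
Proof.
by move=> uF; elim: s w => //= t s IH w; rewrite -IH -!mulrA uF.
Qed.

(* Homogeneous polynomials in two commuting variables with no common factor
   generate an ideal containing a power of each variable. *)
Lemma coprime_nilpotent (D Z : A) (s t : seq K) (w : A) : GRing.comm D Z ->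
  (forall c d, c \in s -> d \in t -> c != d) ->
  foldl (fun w c => w * (D + c *: Z)) w s = 0 ->
  foldl (fun w c => w * (D + c *: Z)) w t = 0 -> exists M, w * Z ^+ M = 0.
Proof.
move=> DZ; have cDZ c d : GRing.comm (D + c *: Z) (D + d *: Z).
  have cZ (u w' : A) (k : K) : GRing.comm u w' -> GRing.comm u (k *: w').
    by move=> E; rewrite /GRing.comm -scalerAr -scalerAl E.
  apply: commrD; last apply: (cZ).
    by apply: commr_sym; apply: commrD => //; exact: cZ.
  by apply: commr_sym; apply: commrD; [exact: commr_sym|exact: cZ].
have [N] := ubnP (size s + size t)%N.
elim: N s t w => // N IH [|c s] [|d t] w lt st Hs Ht; try by exists 0%N; rewrite expr0 mulr1.
have cd : c != d by apply: st; rewrite inE eqxx.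
have [||||M1 E1] := IH s (d :: t) (w * (D + c *: Z)).
- by move: lt => /=; rewrite !addSn.
- by move=> c' d' cs ds; apply: st; rewrite // inE cs orbT.
- exact: Hs.
- by rewrite foldl_mul ?Ht ?mul0r.
have [||||M2 E2] := IH (c :: s) t (w * (D + d *: Z)).
- by move: lt => /=; rewrite !addnS.
- by move=> c' d' cs ds; apply: st; rewrite // inE ds orbT.
- by rewrite foldl_mul ?Hs ?mul0r.
- exact: Ht.
(* The difference of the two linear factors is [(c - d) *: Z], and each factor is annihilated, after
   [w], by a power of [Z] by induction. *)
exists (M1 + M2).+1; apply: (@scalerI _ _ (c - d)); first by rewrite subr_eq0.
rewrite scaler0 exprS mulrA scalerAl.
have -> : (c - d) *: (w * Z) = w * (D + c *: Z) - w * (D + d *: Z).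
  by rewrite -mulrBr opprD addrACA subrr add0r -scalerBl scalerAr.
rewrite mulrBl {1}exprD mulrA E1 mul0r addnC exprD mulrA E2.
by rewrite mul0r subr0.
Qed.

(** [D] is the quantum determinant and commutes with [a], [x] and [Z], while [x a = D + q^-1 Z] and
    [a x = D + q Z]. Hence [x^N a^N] and [a^N x^N] are products of linear forms in [D] and [Z]. Both
    vanish when [x^N = 0], and they have no common factor. *)
Lemma qmat2_nilpotent (x a Z : A) (N : nat) :
  x * a = a * x - (q - q^-1) *: Z -> x * Z = q^-2 *: (Z * x) -> Z * a = q^-2 *: (a * Z) ->
  x ^+ N = 0 -> exists M, Z ^+ M = 0.
Proof.
move=> xa xZ Za xN; set D := a * x - q *: Z.
have xaD : x * a = D + q^-1 *: Z by rewrite xa /D scalerBl opprB addrA [RHS]addrAC.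
have axD : a * x = D + q *: Z by rewrite /D subrK.
have Zx : Z * x = q^+2 *: (x * Z).
  by rewrite xZ scalerA mulfV ?scale1r // expf_neq0.
have aZ : a * Z = q^+2 *: (Z * a).
  by rewrite Za scalerA mulfV ?scale1r // expf_neq0.
have DZ : GRing.comm D Z.
  rewrite /GRing.comm /D mulrBl mulrBr -scalerAl -scalerAr; congr (_ - _).
  by rewrite -mulrA xZ -scalerAr !mulrA aZ -scalerAl scalerA mulVf ?scale1r ?expf_neq0.
have aD : GRing.comm D a.
  rewrite /GRing.comm; have {2}-> : D = x * a - q^-1 *: Z by rewrite xaD addrK.
  rewrite /D mulrBl mulrBr !mulrA -scalerAl -scalerAr Za scalerA.
  by congr (_ - _ *: _); rewrite expr2 invfM mulrA mulfV // mul1r.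
have Dx : GRing.comm D x.
  rewrite /GRing.comm; have {1}-> : D = x * a - q^-1 *: Z by rewrite xaD addrK.
  rewrite /D mulrBl mulrBr !mulrA -scalerAl -scalerAr xZ scalerA.
  rewrite expr2 invfM mulrA mulfV // mul1r; congr (_ - _); by rewrite -mulrA.
have ZXx k : Z * x ^+ k = q ^+ (2 * k) *: (x ^+ k * Z).
  elim: k => [|k IH]; first by rewrite mulr1 mul1r muln0 scale1r.
  rewrite exprSr mulrA IH -scalerAl -(mulrA _ Z) Zx -scalerAr scalerA (mulrA _ x Z).
  by rewrite mulnS addnC exprD.
have ZXa k : Z * a ^+ k = q ^- (2 * k) *: (a ^+ k * Z).
  elim: k => [|k IH]; first by rewrite mulr1 mul1r muln0 invr1 scale1r.
  rewrite exprSr mulrA IH -scalerAl -(mulrA _ Z) Za -scalerAr scalerA (mulrA _ a Z).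
  by rewrite mulnS addnC exprD (invfM (q ^+ (2 * k))).
pose F (w : A) c := w * (D + c *: Z).
(* Moving [Z] past [a ^+ k] costs [q ^- (2 * k)], whence the odd exponents [(2 * i).+1], with the
   opposite sign in the other order. *)
have xaN k : x ^+ k * a ^+ k = foldl F 1 [seq q ^- (2 * i).+1 | i <- iota 0 k].
  elim: k => [|k IH]; first by rewrite mulr1.
  have -> : iota 0 k.+1 = iota 0 k ++ [:: k] by rewrite -addn1 iotaD.
  rewrite map_cat foldl_cat -IH /= /F.
  rewrite exprSr exprS mulrA -[_ * x * a]mulrA xaD -!mulrA; congr (_ * _).
  rewrite mulrDl mulrDr (commrX k aD) -scalerAl ZXa scalerA -scalerAr; congr (_ + _ *: _).
  by rewrite exprS invfM.
have axN k : a ^+ k * x ^+ k = foldl F 1 [seq q ^+ (2 * i).+1 | i <- iota 0 k].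
  elim: k => [|k IH]; first by rewrite mulr1.
  have -> : iota 0 k.+1 = iota 0 k ++ [:: k] by rewrite -addn1 iotaD.
  rewrite map_cat foldl_cat -IH /= /F.
  rewrite exprSr exprS mulrA -[_ * a * x]mulrA axD -!mulrA; congr (_ * _).
  rewrite mulrDl mulrDr (commrX k Dx) -scalerAl ZXx scalerA -scalerAr; congr (_ + _ *: _).
  by rewrite exprS.
have := xaN N; rewrite xN mul0r => /esym Hs.
have := axN N; rewrite xN mulr0 => /esym Ht.
have [|M] := coprime_nilpotent DZ _ Hs Ht; last by rewrite mul1r; exists M.
move=> _ _ /mapP[i _ ->] /mapP[j _ ->]; apply/eqP => E.
have /eqP := q_not_root1 (isT : (0 < (2 * i).+1 + (2 * j).+1)%N); apply.
by rewrite exprD -E mulfV // expf_neq0.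
Qed.

End TwoByTwo.

(** * Partially deleted quantum matrices *)

Section Boxes.
Variables m n : nat.
Local Notation box := ('I_m * 'I_n)%type.

Definition pos (s : box) : nat := (s.1 * n + s.2)%N.
Definition nw (p s : box) : bool := (p.1 < s.1)%N && (p.2 < s.2)%N.
(** The exponent in [Y p * Y s = q ^ omega p s *: (Y s * Y p)] for quasi-commuting generators: 1 if
    [p] comes before [s] in the same row or column, -1 if it comes after, and 0 otherwise. *)
Definition omega (p s : box) : int :=
  (p.1 == s.1)%:Z * ((p.2 < s.2)%N%:Z - (s.2 < p.2)%N%:Z) +
  (p.2 == s.2)%:Z * ((p.1 < s.1)%N%:Z - (s.1 < p.1)%N%:Z).

Lemma pos_lt p s : (pos p < pos s)%N = (p.1 < s.1)%N || ((p.1 == s.1) && (p.2 < s.2)%N).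
Proof.
case: p s => [i a] [j b]; rewrite /pos /= -val_eqE /=.
have := ltn_ord a; have := ltn_ord b; case: (ltngtP i j) => [ij|ij|->] lb la /=.
- nia.
- nia.
- by rewrite ltn_add2l.
Qed.

Lemma pos_inj : injective pos.
Proof.
move=> p s E; have := pos_lt p s; have := pos_lt s p; rewrite E ltnn.
case: p s {E} => [i a] [j b] /=; rewrite -!val_eqE /= => H1 H2.
by congr pair; apply: val_inj => /=; lia.
Qed.

Lemma nw_pos p s : nw p s -> (pos p < pos s)%N.
Proof. by rewrite pos_lt => /andP[->]. Qed.

Lemma pos_surj k : (k < m * n)%N -> exists r, pos r = k.
Proof.
move=> kmn; have n0 : (0 < n)%N by case: (n) kmn => //; rewrite muln0.
have h1 : (k %/ n < m)%N by rewrite ltn_divLR.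
have h2 : (k %% n < n)%N by rewrite ltn_mod.
by exists (Ordinal h1, Ordinal h2); rewrite /pos /= -divn_eq.
Qed.

Lemma pos_max s : (pos s < m * n)%N.
Proof. by case: s => i a; rewrite /pos /=; have := ltn_ord i; have := ltn_ord a; nia. Qed.

Lemma omegaC p s : omega s p = - omega p s.
Proof.
by rewrite /omega ![s.1 == _]eq_sym ![s.2 == _]eq_sym opprD -!mulrN !opprB.
Qed.

Lemma omega_nw p s : nw p s -> omega p s = 0.
Proof.
by move=> /andP[l1 l2]; rewrite /omega -!val_eqE /= !ltn_eqF // !mul0r.
Qed.

End Boxes.

Section QuantumClass.
Variables (m n : nat) (K : fieldType) (q : K).
Hypotheses (q_neq0 : q != 0) (q_not_root1 : forall k : nat, (0 < k)%N -> q ^+ k != 1).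
Variables (G : Type) (chi : G -> 'I_m * 'I_n -> K).
Hypothesis chi_neq0 : forall g s, chi g s != 0.

Local Notation box := ('I_m * 'I_n)%type.

Definition gens (A : algType K) (Y Yi : box -> A) (t : box * bool) : A :=
  if t.2 then Y t.1 else Yi t.1.

(* The algebras met by the deleting-derivations algorithm: the quadratic
   correction survives only when the lower right box comes before position [k],
   and the later generators are zero or invertible, with inverse [Yi]. *)
Record qclass (k : nat) (A : algType K) (Y Yi : box -> A)
    (act : G -> {lrmorphism A -> A}) : Prop := QClass {
  qc_gen : generated (gens Y Yi);
  qc_act : forall g s, act g (Y s) = chi g s *: Y s;
  qc_comm : forall p s, ~~ nw p s -> ~~ nw s p ->
    Y p * Y s = q ^ (omega p s) *: (Y s * Y p);
  qc_diag : forall (i j : 'I_m) (a b : 'I_n), (i < j)%N -> (a < b)%N ->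
    Y (j, b) * Y (i, a) = Y (i, a) * Y (j, b)
      - (if (pos (j, b) < k)%N then q - q^-1 else 0) *: (Y (i, b) * Y (j, a));
  qc_inv : forall s, (k <= pos s)%N ->
    (Y s = 0 /\ Yi s = 0) \/ (Y s * Yi s = 1 /\ Yi s * Y s = 1);
  qc_ninv : forall s, (pos s < k)%N -> Yi s = 0;
  qc_hprime : hprime0 act }.

Lemma expqz_neq0 (z : int) : q ^ z != 0.
Proof. exact: expfz_neq0. Qed.

(** * Commutation rules and noetherianity at one stage of the algorithm *)

Section Class.
Variables (k : nat) (A : algType K) (Y Yi : box -> A) (act : G -> {lrmorphism A -> A}).
Hypothesis qc : qclass k Y Yi act.

(** The pairs whose relation still carries the quadratic correction at stage [k]; all other pairs
    quasi-commute. *)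
Definition active (p s : box) : bool := nw p s && (pos s < k)%N.

Lemma Ydiag p s : nw s p -> Y p * Y s = Y s * Y p
  - (if (pos p < k)%N then q - q^-1 else 0) *: (Y (s.1, p.2) * Y (p.1, s.2)).
Proof.
by move=> /andP[l1 l2]; have := qc_diag qc l1 l2; rewrite -!surjective_pairing.
Qed.

Lemma Ycomm p s : ~~ active p s -> ~~ active s p ->
  Y p * Y s = q ^ (omega p s) *: (Y s * Y p).
Proof.
rewrite /active => np ns.
have [nps|/(qc_comm qc) H] := boolP (nw p s); last first.
  have [nsp|/H//] := boolP (nw s p); move: ns; rewrite nsp /= => /negPf ns.
  rewrite (Ydiag nsp) ns scale0r subr0.
  by rewrite omegaC omega_nw // oppr0 expr0z scale1r.
move: np; rewrite nps /= => /negPf np; rewrite (Ydiag nps) np scale0r subr0.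
by rewrite omega_nw // expr0z scale1r.
Qed.

Lemma Yqcomm p s : ~~ active p s -> ~~ active s p -> qcomm (Y p) (Y s).
Proof. by move=> np ns; exists (q ^ omega p s); [exact: expqz_neq0|exact: Ycomm]. Qed.

Lemma qcomm0 (u : A) : qcomm u 0.
Proof. by exists 1; rewrite ?oner_neq0 // mulr0 mul0r scaler0. Qed.

Lemma qcomm_inv (u w wi : A) : w * wi = 1 -> wi * w = 1 -> qcomm u w -> qcomm u wi.
Proof.
move=> wwi wiw [c c0 E]; exists c^-1; first by rewrite invr_eq0.
rewrite -[LHS]mul1r -wiw -mulrA (mulrA w).
have -> : w * u = c^-1 *: (u * w) by rewrite E scalerA mulVf // scale1r.
by rewrite -scalerAl -scalerAr -!mulrA wwi mulr1.
Qed.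

Lemma qcomm_Yi u s : qcomm u (Y s) -> qcomm u (Yi s).
Proof.
have [ks|ks] := leqP k (pos s); last by rewrite (qc_ninv qc ks) => _; exact: qcomm0.
have [[_ ->] _|[E1 E2]] := qc_inv qc ks; first exact: qcomm0.
exact: qcomm_inv.
Qed.

Lemma YYi_qcomm t s : qcomm (Y t) (Yi s).
Proof.
have [ks|ks] := leqP k (pos s); last by rewrite (qc_ninv qc ks); exact: qcomm0.
apply: qcomm_Yi; apply: Yqcomm; rewrite /active; first by rewrite ltnNge ks andbF.
by apply/negP => /andP[/nw_pos]; lia.
Qed.

Lemma YiYi_qcomm t s : qcomm (Yi t) (Yi s).
Proof. by apply: qcomm_Yi; apply: qcommC; exact: YYi_qcomm. Qed.

Lemma Y_weight s : weight_vector act (Y s).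
Proof. by move=> g; exists (chi g s) => //; exact: qc_act qc g s. Qed.

(** The generators are adjoined in the order of [pos], followed by the inverses. Each one
    quasi-commutes with the earlier ones up to an element of the subalgebra that those generate. *)
Lemma qclass_noetherian : noetherian_set [set: A].
Proof.
pose L j := [seq Y s | s <- enum (predT : pred box) & (pos s < j)%N].
have mL j s : (pos s < j)%N -> Y s \in L j.
  by move=> sj; apply: map_f; rewrite mem_filter sj mem_enum.
have nL j : noetherian_set (subalgebra_gen (L j)).
  elim: j => [|j IH].
    rewrite (_ : L 0%N = [::]); first exact: noetherian_scalars.
    by rewrite /L (eq_filter (a2 := pred0)) ?filter_pred0.
  have [[p pj]|np] := pselect (exists p : box, pos p = j); last first.
    rewrite (_ : L j.+1 = L j) // /L (@eq_filter _ _ (fun s => (pos s < j)%N)) // => s.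
    by rewrite ltnS leq_eqVlt; case: eqP => // E; case: np; exists s.
  rewrite (@eq_subalgebra_gen _ _ _ (Y p :: L j)); last first.
    move=> z; rewrite inE; apply/mapP/orP.
      move=> [s]; rewrite mem_filter ltnS leq_eqVlt => /andP[/orP[/eqP sj _ ->|sj _ ->]].
        by left; rewrite (pos_inj (etrans sj (esym pj))).
      by right; exact: mL.
    case=> [/eqP->|/mapP[s]]; first by exists p; rewrite // mem_filter pj ltnSn mem_enum.
    by rewrite mem_filter => /andP[sj _] ->; exists s; rewrite // mem_filter ltnW ?mem_enum.
  apply: noetherian_cons => // _ /mapP[s + ->]; rewrite mem_filter => /andP[sj _].
  have [/andP[sp pk]|asp] := boolP (active s p); last first.
    have [|c c0 E] := @Yqcomm p s _ asp.
      by apply/negP => /andP[/nw_pos]; lia.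
    by exists c; rewrite // E subrr; exact: subalgebra0 (subalgebra_gen_subalgebra _).
  (* Both factors of the correction precede [p]: one lies in a higher row, the other in the row of
     [p] further to the left. *)
  exists 1; rewrite ?oner_neq0 // scale1r; have /andP[l1 l2] := sp.
  rewrite (Ydiag sp) addrAC subrr sub0r.
  apply: (@subalgebraN _ _ (subalgebra_gen (L j)) _ (subalgebra_gen_subalgebra _)).
  have [_ _ SM SZ] := subalgebra_gen_subalgebra (L j).
  apply: SZ; apply: SM; apply: mem_subalgebra_gen; apply: mL.
    by rewrite -pj pos_lt /= l1.
  by rewrite -pj pos_lt /= eqxx l2 orbT.
have nB (bs : seq box) : noetherian_set (subalgebra_gen (map Yi bs ++ L (m * n)%N)).
  elim: bs => [|s bs IH]; first exact: nL.
  apply: noetherian_cons => // z.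
  rewrite mem_cat => zl; have [c c0 E] : qcomm (Yi s) z.
    case/orP: zl => /mapP[t _ ->]; first exact: YiYi_qcomm.
    by apply: qcommC; exact: YYi_qcomm.
  by exists c; rewrite // E subrr; exact: subalgebra0 (subalgebra_gen_subalgebra _).
rewrite (_ : setT = subalgebra_gen (map Yi (enum (predT : pred box)) ++ L (m * n)%N)) //.
apply/seteqP; split=> // a _; apply: (qc_gen qc).
  exact: subalgebra_gen_subalgebra.
case=> s [] /=; apply: mem_subalgebra_gen; rewrite mem_cat.
  by apply/orP; right; apply: mL; exact: pos_max.
by apply/orP; left; apply: map_f; rewrite mem_enum.
Qed.

End Class.

(** * The pivot: local finiteness and non-nilpotency *)

Section Corner.
Variables (k : nat) (A : algType K) (Y Yi : box -> A) (act : G -> {lrmorphism A -> A}).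
Hypothesis qc : qclass k.+1 Y Yi act.
Variable r : box.
Hypothesis rk : pos r = k.

Local Notation x := (Y r).
Local Notation j := r.1.
Local Notation b := r.2.

Let x_not_active s : ~~ active k.+1 r s.
Proof. by apply/negP => /andP[/nw_pos]; rewrite rk; lia. Qed.

Let active_r s : active k.+1 s r = nw s r.
Proof. by rewrite /active rk ltnSn andbT. Qed.

Lemma corner_comm s : ~~ nw s r -> x * Y s = q ^ (omega r s) *: (Y s * x).
Proof. by move=> ns; apply: (Ycomm qc) (x_not_active s) _; rewrite active_r. Qed.

Lemma corner_diag s : nw s r ->
  x * Y s = Y s * x - (q - q^-1) *: (Y (s.1, b) * Y (j, s.2)).
Proof.
by move=> sr; rewrite (Ydiag qc sr) rk ltnSn.
Qed.

Lemma corner_Z s : nw s r ->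
  x * (Y (s.1, b) * Y (j, s.2)) = q ^- 2 *: ((Y (s.1, b) * Y (j, s.2)) * x).
Proof.
move=> /andP[l1 l2].
have E1 : x * Y (s.1, b) = q^-1 *: (Y (s.1, b) * x).
  rewrite corner_comm; last by rewrite /nw /= ltnn andbF.
  rewrite /omega /= -!val_eqE /= eqxx (gtn_eqF l1) mul0r add0r mul1r.
  by rewrite l1 ltnNge (ltnW l1) sub0r -invr_expz.
have E2 : x * Y (j, s.2) = q^-1 *: (Y (j, s.2) * x).
  rewrite corner_comm; last by rewrite /nw /= ltnn.
  rewrite /omega /= -!val_eqE /= eqxx (gtn_eqF l2) mul0r addr0 mul1r.
  by rewrite l2 ltnNge (ltnW l2) sub0r -invr_expz.
by rewrite mulrA E1 -scalerAl -(mulrA _ x) E2 -scalerAr scalerA -expr2 exprVn mulrA.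
Qed.

(** A generator north-west of the pivot is killed by two twists: parameter 1 leaves a multiple of
    the antidiagonal product, which is an eigenvector with eigenvalue [q ^- 2]. All other generators
    quasi-commute with the pivot. *)
Lemma corner_locfin a : locfin x a.
Proof.
apply: (qc_gen qc); first exact: locfin_subalgebra.
case=> s [] /=; last first.
  by have [c c0] := YYi_qcomm qc r s; exact: locfin_eigen.
have [ns|ns] := boolP (nw s r); last first.
  by apply: (@locfin_eigen _ _ _ (q ^ omega r s)); [exact: expqz_neq0|exact: corner_comm].
apply: (LocfinS (oner_neq0 K)); rewrite /twist scale1r corner_diag // addrAC subrr sub0r -scaleNr.
apply: locfinZ; apply: (@locfin_eigen _ _ _ (q ^- 2)); last exact: corner_Z.
by rewrite invr_eq0 expf_neq0.
Qed.

(** Without corrections the pivot quasi-commutes with every generator, so it is a normal weight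
    vector and therefore regular. *)
Let Zqcomm_of_zero : (forall s, nw s r -> Y (s.1, b) * Y (j, s.2) = 0) ->
  x != 0 -> forall N, x ^+ N <> 0.
Proof.
move=> Z0 x0; have xq t : qcomm x (gens Y Yi t).
  case: t => s []; last exact: (YYi_qcomm qc).
  have [sr|/corner_comm] := boolP (nw s r).
    by exists 1; rewrite ?oner_neq0 // corner_diag // Z0 // scaler0 subr0 scale1r.
  by exists (q ^ omega r s); first exact: expqz_neq0.
have [xr _] := normal_regular (qc_gen qc) (qc_hprime qc) xq (Y_weight qc r) x0.
elim=> [|N IH]; first by move/eqP; rewrite expr0 (negPf (oner_neq0 A)).
by rewrite exprSr => /xr.
Qed.

Let Z_nilpotent N s : nw s r -> x ^+ N = 0 ->
  exists M, (Y (s.1, b) * Y (j, s.2)) ^+ M = 0.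
Proof.
move=> sr xN; apply: (qmat2_nilpotent q_neq0 q_not_root1 (corner_diag sr) (corner_Z sr) _ xN).
have /andP[l1 l2] := sr.
have E1 : Y (s.1, b) * Y s = q^-1 *: (Y s * Y (s.1, b)).
  rewrite (Ycomm qc); try by rewrite /active /nw /= ltnn.
  rewrite /omega /= -!val_eqE /= eqxx (gtn_eqF l2) mul0r addr0 mul1r.
  by rewrite l2 ltnNge (ltnW l2) sub0r -invr_expz.
have E2 : Y (j, s.2) * Y s = q^-1 *: (Y s * Y (j, s.2)).
  rewrite (Ycomm qc); try by rewrite /active /nw /= ltnn andbF.
  rewrite /omega /= -!val_eqE /= eqxx (gtn_eqF l1) mul0r add0r mul1r.
  by rewrite l1 ltnNge (ltnW l1) sub0r -invr_expz.
rewrite -(mulrA _ _ (Y s)) E2 -scalerAr (mulrA _ (Y s)) E1 -scalerAl scalerA -expr2 exprVn.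
by rewrite -mulrA.
Qed.

Let colC := fun i : 'I_m => Y (i, b).

(* The elements of [colV N] are sums of products [Y_{i_1,b} ... Y_{i_N,b} a]
   with all [i_l < j]; these are the powers of a two-sided ideal. *)
Fixpoint colV (N : nat) : set A :=
  if N is N'.+1 then
    [set a | exists2 f, forall i, colV N' (f i) & a = \sum_(i < m | (i < j)%N) colC i * f i]
  else setT.

Let colV0 N : colV N 0.
Proof.
by elim: N => //= N IH; exists (fun=> 0); rewrite ?big1 // => i _; rewrite mulr0.
Qed.

Let colVD N u w : colV N u -> colV N w -> colV N (u + w).
Proof.
elim: N u w => //= N IH _ _ [f Vf ->] [h Vh ->]; exists (fun i => f i + h i) => [i|].
  exact: IH.
by rewrite -big_split; apply: eq_bigr => i _; rewrite mulrDr.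
Qed.

Let colVMr N u a : colV N u -> colV N (u * a).
Proof.
elim: N u a => //= N IH _ a [f Vf ->]; exists (fun i => f i * a) => [i|]; first exact: IH.
by rewrite mulr_suml; apply: eq_bigr => i _; rewrite mulrA.
Qed.

Let colV_sum N (F : 'I_m -> A) : (forall i : 'I_m, (i < j)%N -> colV N (F i)) ->
  colV N (\sum_(i < m | (i < j)%N) F i).
Proof.
move=> VF; apply: (big_ind (colV N)); [exact: colV0| |exact: VF].
by move=> u w; exact: colVD.
Qed.

Let colVS N (i : 'I_m) u : (i < j)%N -> colV N u -> colV N.+1 (colC i * u).
Proof.
move=> ij Vu; exists (fun l => if l == i then u else 0) => [l|].
  by case: eqP => // _; exact: colV0.
rewrite (bigD1 i) //= eqxx big1 ?addr0 // => l /andP[_ /negPf->].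
by rewrite mulr0.
Qed.

(** This is what makes the right ideal generated by the entries above the pivot two-sided: every
    correction met when a generator passes such an entry contains another entry of the same column
    above the pivot. *)
Let colC_swap a (i : 'I_m) : (i < j)%N ->
  exists h : 'I_m -> A, a * colC i = \sum_(l < m | (l < j)%N) colC l * h l.
Proof.
have one (l : 'I_m) w : (l < j)%N -> exists h : 'I_m -> A,
    colC l * w = \sum_(l < m | (l < j)%N) colC l * h l.
  by move=> lj; have [h _ E] := @colVS 0 l w lj I; exists h.
move: a i; suff H a : [set a | forall i : 'I_m, (i < j)%N -> exists h : 'I_m -> A,
    a * colC i = \sum_(l < m | (l < j)%N) colC l * h l] a.
  by move=> a i; exact: H.
move: a; apply: (qc_gen qc).
  split=> /=.
  - by move=> i ij; rewrite mul1r -[colC i]mulr1; exact: one.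
  - move=> u w Hu Hw i ij; have [h E] := Hu i ij; have [h' E'] := Hw i ij.
    exists (fun l => h l + h' l); rewrite mulrDl E E' -big_split.
    by apply: eq_bigr => l _; rewrite mulrDr.
  - move=> u w Hu Hw i ij; have [h E] := Hw i ij; rewrite -mulrA E mulr_sumr.
    have /choice[H HE] (l : 'I_m) : exists h' : 'I_m -> A, (l < j)%N ->
        u * colC l = \sum_(l' < m | (l' < j)%N) colC l' * h' l'.
      have [/Hu[h' E']|nl] := boolP (l < j)%N; first by exists h'.
      by exists (fun=> 0).
    exists (fun l' => \sum_(l < m | (l < j)%N) H l l' * h l).
    under [RHS]eq_bigr do rewrite mulr_sumr.
    rewrite exchange_big; apply: eq_bigr => l lj.
    by rewrite mulrA HE // mulr_suml; apply: eq_bigr => l' _; rewrite mulrA.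
  - move=> c u Hu i ij; have [h E] := Hu i ij; exists (fun l => c *: h l).
    rewrite -scalerAl E scaler_sumr; apply: eq_bigr => l _.
    by rewrite scalerAr.
have qc1 u (i : 'I_m) : (i < j)%N -> qcomm u (colC i) -> exists h : 'I_m -> A,
    u * colC i = \sum_(l < m | (l < j)%N) colC l * h l.
  by move=> ij [c _ ->]; rewrite scalerAr; exact: one.
case=> s [] /= i ij; last first.
  by apply: qc1 => //; apply: qcommC; exact: (YYi_qcomm qc).
have two (l l' : 'I_m) w w' : (l < j)%N -> (l' < j)%N -> exists h : 'I_m -> A,
    colC l * w + colC l' * w' = \sum_(l < m | (l < j)%N) colC l * h l.
  move=> /one-/(_ w)[h ->] /one-/(_ w')[h' ->]; exists (fun l => h l + h' l).
  by rewrite -big_split; apply: eq_bigr => i' _; rewrite mulrDr.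
have [/andP[s1 _]|a1] := boolP (active k.+1 s (i, b)).
  have := Ydiag qc s1; set c := if _ then _ else _ => /= E.
  have -> : Y s * colC i = colC i * Y s + colC s.1 * (c *: Y (i, s.2)).
    by rewrite -scalerAr [colC i * Y s]E subrK.
  by apply: two => //; case/andP: s1 => /= si _; apply: ltn_trans si ij.
have [/andP[s1 sk]|a2] := boolP (active k.+1 (i, b) s); last first.
  by apply: qc1 => //; exact: (Yqcomm qc).
have /andP[/= l1 l2] := s1.
(* The box [s] is not after the pivot and lies to the right of its column, so it cannot be in the
   row of the pivot. *)
have sj : (s.1 < j)%N.
  move: sk; rewrite ltnS -rk leqNgt pos_lt negb_or -leqNgt leq_eqVlt => /andP[/orP[/eqP E|//]].
  by rewrite -val_eqE /= E eqxx /= l2.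
rewrite (Ydiag qc s1) /=; set c := if _ then _ else _.
have -> : Y (i, s.2) * Y (s.1, b) = colC s.1 * Y (i, s.2).
  rewrite (Ycomm qc); last 2 first.
  - by rewrite /active /nw /= [(s.2 < b)%N]ltnNge (ltnW l2) andbF.
  - by rewrite /active /nw /= [(s.1 < i)%N]ltnNge (ltnW l1).
  by rewrite /omega /= -!val_eqE /= (ltn_eqF l1) (gtn_eqF l2) !mul0r expr0z scale1r.
by rewrite -scaleNr scalerAr; exact: two.
Qed.

Let colVMl N u a : colV N u -> colV N (a * u).
Proof.
elim: N u a => // N IH _ a [f Vf ->]; rewrite mulr_sumr; apply: colV_sum => i ij.
have [h E] := colC_swap a ij; rewrite mulrA E mulr_suml; apply: colV_sum => l lj.
by rewrite -mulrA; exact: (colVS lj (IH _ _ (Vf i))).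
Qed.

Let colV_ideal N : ideal (colV N).
Proof.
split; [exact: colV0|by move=> u w; exact: colVD|by move=> a u; exact: colVMl|].
by move=> a u; exact: colVMr.
Qed.

Let colV_stable N : stable act (colV N).
Proof.
elim: N => // N IH g _ [f Vf ->].
have -> : act g (\sum_(i < m | (i < j)%N) colC i * f i) =
    \sum_(i < m | (i < j)%N) chi g (i, b) *: (colC i * act g (f i)).
  rewrite rmorph_sum; apply: eq_bigr => i _.
  by rewrite rmorphM /= (qc_act qc) scalerAl.
apply: colV_sum => i ij.
exact: (idealZ _ (colV_ideal N.+1) (colVS ij (IH _ _ (Vf i)))).
Qed.

Let colVM N M u w : colV N u -> colV M w -> colV (N + M) (u * w).
Proof.
move=> Vu Vw; elim: N u Vu => [u _|N IH _ [f Vf ->]]; first exact: colVMl.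
rewrite mulr_suml addSn; apply: colV_sum => i ij; rewrite -mulrA.
exact: (colVS ij (IH _ (Vf i))).
Qed.

Let colV_mono N M : (N <= M)%N -> colV M `<=` colV N.
Proof.
move=> /subnK <-; elim: (M - N)%N => // d IH u [f Vf ->]; apply: colV_sum => i ij.
exact: (colVMl _ (IH _ (Vf i))).
Qed.

Let colC_qcomm i l : qcomm (colC i) (colC l).
Proof.
by apply: (Yqcomm qc); rewrite /active /nw /= ltnn andbF.
Qed.

(** Pigeonhole: a word of length [m * M + 1] in at most [m] letters has a letter occurring at least
    [M] times, and collecting its occurrences produces a vanishing power. *)
Let colV_nil M : (forall i : 'I_m, (i < j)%N -> colC i ^+ M = 0) -> exists N, colV N `<=` [set 0].
Proof.
move=> CM; exists (m * M).+1.
(* Entries of one column quasi-commute, so the letter [i] can be gathered in front at the cost of a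
   nonzero scalar. *)
have wd s i : exists2 c : K, c != 0 &
    \prod_(l <- s) colC l = c *: (colC i ^+ count_mem i s * \prod_(l <- s | l != i) colC l).
  elim: s => [|l s [c c0 E]].
    by exists 1; rewrite ?oner_neq0 // !big_nil mulr1 scale1r.
  rewrite !big_cons E /=; case: eqP => [->|_] /=.
    by exists c => //; rewrite -scalerAr exprS mulrA.
  have [d d0 E'] := qcommX (count_mem i s) (colC_qcomm l i).
  exists (c * d); first exact: mulf_neq0.
  by rewrite -scalerAr (mulrA (colC l)) E' -scalerAl scalerA add0n !mulrA.
have w0 s : size s = (m * M).+1 -> all (fun l : 'I_m => (l < j)%N) s ->
    \prod_(l <- s) colC l = 0.
  move=> ss /allP sj; have [i Mi] : exists i, (M <= count_mem i s)%N.
    apply: contrapT => H; have : (size s <= m * M)%N; last by rewrite ss ltnn.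
    rewrite -(sum1_size s) (eq_bigr (fun l => \sum_(i < m) (l == i)%N)%N); last first.
      by move=> l _; rewrite (bigD1 l) //= eqxx big1 // => i /negPf; rewrite eq_sym => ->.
    rewrite exchange_big /= -[X in (_ <= X * M)%N]card_ord -sum_nat_const.
    apply: leq_sum => i _; rewrite (_ : \sum_(l <- s) _ = count_mem i s)%N.
      by rewrite leqNgt; apply/negP => /ltnW Mi; apply: H; exists i.
    by rewrite -sum1_count [RHS]big_mkcond; apply: eq_bigr => l _ /=; case: eqP.
  (* For [M = 0] the hypothesis on any letter reads 1 = 0, and the word is nonempty. *)
  have [M0|M0] := posnP M.
    have := oner_neq0 A; have : (0 < size s)%N by rewrite ss.
    case: s {ss Mi} sj => // l s sj _; have := CM l (sj l _); rewrite inE eqxx => /(_ isT).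
    by rewrite M0 expr0 => ->; rewrite eqxx.
  have is_ : i \in s by rewrite -has_pred1 has_count (leq_trans M0).
  have [c _ ->] := wd s i.
  by rewrite -(subnK Mi) addnC exprD CM ?sj // !mul0r scaler0.
move=> v Vv; suff H N p u : (forall s, size s = N -> all (fun l : 'I_m => (l < j)%N) s ->
    p * \prod_(l <- s) colC l = 0) -> colV N u -> p * u = 0.
  by rewrite /= -[v]mul1r; apply: H Vv => s ss sj; rewrite mul1r; exact: w0.
elim: N p u => [p u /(_ [::] erefl isT)|N IH p _ H [f Vf ->]].
  by rewrite big_nil mulr1 => -> _; rewrite mul0r.
rewrite mulr_sumr big1 // => i ij; rewrite mulrA; apply: (IH _ _ _ (Vf i)) => s ss sj.
by have := H (i :: s); rewrite big_cons mulrA /= ss ij; apply.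
Qed.

(** If the pivot row is zero left of the pivot, all corrections vanish. Otherwise the leftmost
    nonzero entry of that row is regular, and a nilpotent pivot would make every entry above it
    nilpotent; the ideal they generate is then nilpotent, hence zero by H-primeness, and the
    corrections vanish again. *)
Lemma corner_not_nilpotent : x != 0 -> forall N, x ^+ N <> 0.
Proof.
have [rowZ|/existsNP[a1 /not_implyP[a1b Ya1]]] :=
  pselect (forall a : 'I_n, (a < b)%N -> Y (j, a) = 0).
  by apply: Zqcomm_of_zero => s /andP[_ sb]; rewrite rowZ ?mulr0.
move=> x0 N xN.
pose P (a : 'I_n) := (a < b)%N && (Y (j, a) != 0).
have Pa1 : P a1 by rewrite /P a1b; apply/eqP.
pose a0 := [arg min_(a < a1 | P a) (a : nat)].
have [a0b Ya0 mina0] : [/\ (a0 < b)%N, Y (j, a0) != 0 &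
    forall a : 'I_n, (a < a0)%N -> Y (j, a) = 0].
  rewrite /a0; case: arg_minnP => // a /andP[ab Ya] mina; split=> // c ca.
  apply: contraPeq (ca) => Yc; apply/negP; rewrite -leqNgt; apply: mina.
  by rewrite /P Yc (ltn_trans ca).
(* A correction with a box north-west of [(j, a0)] contains an entry of row [j] left of [a0], which
   is zero; boxes south-east of it come after the pivot and are no longer active. *)
have wq t : qcomm (Y (j, a0)) (gens Y Yi t).
  case: t => s []; last exact: (YYi_qcomm qc).
  have [/andP[s1 _]|as1] := boolP (active k.+1 s (j, a0)).
    exists 1; rewrite ?oner_neq0 // (Ydiag qc s1) /= (mina0 s.2); last by case/andP: s1.
    by rewrite mulr0 scaler0 subr0 scale1r.
  apply: (Yqcomm qc) => //; apply/negP => /andP[/andP[/= js _]].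
  by rewrite ltnS leqNgt -rk pos_lt js.
have [wr _] := normal_regular (qc_gen qc) (qc_hprime qc) wq (Y_weight qc _) Ya0.
have wrX u M : u * Y (j, a0) ^+ M = 0 -> u = 0.
  by elim: M => [|M IH]; [rewrite mulr1|rewrite exprSr mulrA => /wr/IH].
(* The two factors of the nilpotent antidiagonal product commute, and the second one is regular and
   can be cancelled. *)
have colnil (i : 'I_m) : exists M, (i < j)%N -> colC i ^+ M = 0.
  have [ij|_] := boolP (i < j)%N; last by exists 0%N.
  have sr : nw (i, a0) r by rewrite /nw /= ij.
  have [M /= E] := Z_nilpotent sr xN; exists M => _; apply: (wrX _ M).
  rewrite -exprMn_comm //; rewrite /GRing.comm (Ycomm qc).
  - by rewrite /omega /= -!val_eqE /= (ltn_eqF ij) (gtn_eqF a0b) !mul0r expr0z scale1r.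
  - by rewrite /active /nw /= [(b < a0)%N]ltnNge (ltnW a0b) andbF.
  - by rewrite /active /nw /= [(j < i)%N]ltnNge (ltnW ij).
have /choice[Mf HM] := colnil.
have [|N0 HN0] := @colV_nil (\sum_i Mf i).
  by move=> i ij; rewrite (bigD1 i) //= exprD HM // mul0r.
have ex : exists N, `[< colV N `<=` [set 0] >] by exists N0; apply/asboolP.
(* For the least vanishing power [N]: [N = 0] means 1 = 0, [N = 1] means that the column above the
   pivot is zero, and for [N] at least 2 the power [N - 1] is a stable ideal with zero square,
   contradicting minimality. *)
case: (ex_minnP ex) => -[|[|N1]] /asboolP VN minN.
- by have /eqP := VN 1 I; rewrite (negPf (oner_neq0 A)).
- have C0 (i : 'I_m) : (i < j)%N -> Y (i, b) = 0.
    by move=> ij; have := VN _ (@colVS 0%N i 1 ij I); rewrite mulr1.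
  apply: (Zqcomm_of_zero _ x0 xN) => s /andP[sj _].
  by rewrite C0 // mul0r.
- have hp := qc_hprime qc.
  have [u w Vu Vw|H|H] := hp _ _ (colV_ideal N1.+1) (@colV_stable N1.+1)
    (colV_ideal N1.+1) (@colV_stable N1.+1); last 2 first.
  + by have /asboolP/minN := H; rewrite ltnn.
  + by have /asboolP/minN := H; rewrite ltnn.
  by apply: VN; apply: colV_mono (colVM Vu Vw); rewrite addSn !addnS ltnS leq_addr.
Qed.

End Corner.
End QuantumClass.

(** * Deleting one derivation *)

Section Deletion.
Variables (m n : nat) (K : fieldType) (q : K).
Hypotheses (q_neq0 : q != 0) (q_not_root1 : forall k : nat, (0 < k)%N -> q ^+ k != 1).
Variables (G : Type) (chi : G -> 'I_m * 'I_n -> K).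
Hypothesis chi_neq0 : forall g s, chi g s != 0.
Hypothesis chi_rect : forall g i j a b,
  chi g (i, b) * chi g (j, a) = chi g (i, a) * chi g (j, b).

Local Notation box := ('I_m * 'I_n)%type.

(** Under this condition every correction is zero and a deletion only maps the generators into the
    localization, so the boxes that survive the algorithm can be read off at the start. It serves
    the diagonal strata. *)
Definition sparse (A : algType K) (Y : box -> A) : Prop :=
  forall p s : box, nw s p -> Y (s.1, p.2) * Y (p.1, s.2) = 0.

Lemma expqz_inj (a b : int) : q ^ a = q ^ b -> a = b.
Proof.
wlog : a b / (a <= b)%R.
  by move=> H; case/orP: (le_total a b) => ab E; [|symmetry]; exact: H.
move=> ab E; have [l El] : exists l : nat, b = a + l%:Z.
  by exists `|b - a|%N; rewrite gez0_abs ?subr_ge0 // [RHS]addrC subrK.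
case: l El => [|l] El; first by rewrite El addr0.
have : q ^+ l.+1 = 1.
  have := E; rewrite El expfzDr // => /esym; rewrite -[RHS]mulr1 => /mulfI; apply.
  exact: expqz_neq0.
by move/eqP; rewrite (negPf (q_not_root1 _)).
Qed.

(* Only the component of the leading eigenvalue is needed: the relations of the
   deleted algebra are the leading components, under conjugation by the pivot,
   of the relations that hold before the deletion. *)
Lemma eigen_leading (R : algType K) (X xi E0 E1 E2 : R) (M : int) :
  X * xi = 1 -> X * E0 = q ^ M *: (E0 * X) -> X * E1 = q ^ (M - 2) *: (E1 * X) ->
  X * E2 = q ^ (M - 4) *: (E2 * X) -> E0 + E1 + E2 = 0 -> E0 = 0.
Proof.
move=> Xxi H0 H1 H2 E.
have tw c mu F : X * F = mu *: (F * X) -> twist X c F = (mu - c) *: (F * X).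
  by move=> H; rewrite /twist H -scalerBl.
have HX mu F k : X * F = mu *: (F * X) -> X * (k *: (F * X)) = mu *: ((k *: (F * X)) * X).
  by move=> H; rewrite -scalerAr mulrA H -!scalerAl !scalerA mulrC.
have T0 c : twist X c 0 = 0 by rewrite /twist mulr0 mul0r scaler0 subrr.
(* This twist removes [E1], and the next one removes [E2]; what remains is a nonzero multiple of
   [E0 * X * X]. *)
have := congr1 (twist X (q ^ (M - 2))) E.
rewrite T0 (twistD _ _ (E0 + E1)) (twistD _ _ E0) (tw _ _ _ H0) (tw _ _ _ H1) (tw _ _ _ H2).
rewrite subrr scale0r addr0 => /(congr1 (twist X (q ^ (M - 4)))).
rewrite T0 (twistD _ _ (_ *: (E0 * X))).
rewrite (tw _ _ _ (HX _ _ _ H2)) subrr scale0r addr0 (tw _ _ _ (HX _ _ _ H0)).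
have ne d : d != 0 -> q ^ M - q ^ (M - d) != 0.
  by move=> d0; rewrite subr_eq0; apply/eqP => /expqz_inj; move/eqP: d0; lia.
move=> /eqP; rewrite scaler_eq0 (negPf (ne _ _)) //= -scalerAl scaler_eq0 (negPf (ne _ _)) //=.
move=> /eqP/(congr1 (fun F => F * xi * xi)).
by rewrite -[_ * X * X * xi]mulrA Xxi mulr1 -mulrA Xxi mulr1 !mul0r.
Qed.

Section Step.
Variables (k : nat) (A : algType K) (Y Yi : box -> A) (act : G -> {lrmorphism A -> A}).
Hypothesis qc : qclass q chi k.+1 Y Yi act.
Variable r : box.
Hypothesis rk : pos r = k.

Lemma qclass_zero : Y r = 0 -> qclass q chi k Y Yi act.
Proof.
move=> r0; have Yir : Yi r = 0 by apply: (qc_ninv qc); rewrite rk.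
split; [exact: qc_gen qc|exact: qc_act qc|exact: qc_comm qc| | | |exact: qc_hprime qc].
- move=> i j a b ij ab; have [E|ne] := eqVneq (j, b) r.
    by rewrite E r0 rk ltnn mul0r mulr0 scale0r subr0.
  rewrite (qc_diag qc ij ab) ltnS leq_eqVlt -rk.
  by case: eqP => // /pos_inj E; rewrite E eqxx in ne.
- move=> s; rewrite leq_eqVlt => /orP[/eqP ks|]; last exact: (qc_inv qc).
  by left; rewrite -(pos_inj (etrans rk ks)).
- by move=> s sk; apply: (qc_ninv qc); exact: ltnW.
Qed.

Hypothesis x_neq0 : Y r != 0.

Lemma qclass_delete : exists (R : algType K) (Y' Yi' : box -> R)
    (act' : G -> {lrmorphism R -> R}),
  [/\ qclass q chi k Y' Yi' act', spec_equiv (str0 act) (str0 act') &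
      sparse Y -> sparse Y' /\ forall s, Y' s = 0 <-> Y s = 0].
Proof.
have lf := corner_locfin q_neq0 qc rk.
have [R [i [xi [act' [[Xxi xiX] inji fr acti [hp' se]]]]]] :=
  localization_str0 (qc_hprime qc) (Y_weight chi_neq0 qc r) lf
    (qclass_noetherian q_neq0 qc)
    (corner_not_nilpotent q_neq0 q_not_root1 chi_neq0 qc rk x_neq0).
set X := i (Y r) in Xxi xiX.
pose Z s := if nw s r then i (Y (s.1, r.2)) * i (Y (r.1, s.2)) * xi else 0.
(* Since [Z s] has eigenvalue [q ^- 2] under conjugation by [X], the coefficient [q] is the one for
   which [Y' s] commutes with [X] when [s] is north-west of the pivot: it solves
   [c - c q^-2 = q - q^-1]. *)
pose Y' s := i (Y s) - q *: Z s.
pose Yi' s := if s == r then xi else i (Yi s).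
have Y'E s : ~~ nw s r -> Y' s = i (Y s) by rewrite /Y' /Z => /negPf->; rewrite scaler0 subr0.
have iYE s : i (Y s) = Y' s + q *: Z s by rewrite subrK.
have nwrow a : ~~ nw (r.1, a) r by rewrite /nw /= ltnn.
have nwcol l : ~~ nw (l, r.2) r by rewrite /nw /= ltnn andbF.
have nwr : ~~ nw r r by rewrite /nw ltnn.
have XZ0 s : nw s r -> X * Z s = q ^- 2 *: (Z s * X).
  move=> sr; rewrite /Z sr; have := congr1 i (corner_Z q_neq0 qc rk sr).
  rewrite linearZ !rmorphM /= -/X => E; rewrite mulrA E -scalerAl.
  by rewrite -(mulrA _ X) Xxi mulr1 -(mulrA _ xi) xiX mulr1.
have XZ s : X * Z s = q ^ (omega r s - 2) *: (Z s * X).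
  have [sr|/negPf sr] := boolP (nw s r); last by rewrite /Z sr mulr0 mul0r scaler0.
  by rewrite XZ0 // omegaC omega_nw // oppr0 sub0r.
have XY s : X * Y' s = q ^ (omega r s) *: (Y' s * X).
  have [sr|sr] := boolP (nw s r); last first.
    by rewrite Y'E // /X -!rmorphM /= (corner_comm q_neq0 qc rk sr) linearZ.
  rewrite omegaC omega_nw // oppr0 expr0z scale1r.
  have ZX : Z s * X = i (Y (s.1, r.2)) * i (Y (r.1, s.2)).
    by rewrite /Z sr -(mulrA _ xi) xiX mulr1.
  have Xy : X * i (Y s) = i (Y s) * X - (q - q^-1) *: (Z s * X).
    by rewrite ZX /X -!rmorphM /= (corner_diag qc rk sr) rmorphB /= [i (_ *: _)]linearZ /= !rmorphM.
  rewrite /Y' mulrBr mulrBl Xy -scalerAr XZ0 // -scalerAl scalerA -addrA -opprD -scalerDl.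
  by congr (_ - _ *: _); rewrite expr2 invfM mulrA mulfV // mul1r subrK.
have XM (u w : R) (c d : int) : X * u = q ^ c *: (u * X) -> X * w = q ^ d *: (w * X) ->
    forall l : K, forall e, (l = 0 \/ c + d = e) ->
      X * (l *: (u * w)) = q ^ e *: (l *: (u * w) * X).
  move=> Hu Hw l e [->|<-]; first by rewrite !scale0r mulr0 mul0r scaler0.
  rewrite -scalerAr mulrA Hu -!scalerAl -mulrA Hw -scalerAr !scalerA mulrA expfzDr //.
  by congr (_ *: _); ring.
have evD (u w : R) e : X * u = q ^ e *: (u * X) -> X * w = q ^ e *: (w * X) ->
    X * (u + w) = q ^ e *: ((u + w) * X).
  by move=> Hu Hw; rewrite mulrDr Hu Hw mulrDl scalerDr.
pose Z1 s := q *: Z s.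
have XZ1 s : X * Z1 s = q ^ (omega r s - 2) *: (Z1 s * X).
  by rewrite /Z1 -scalerAr XZ -scalerAl !scalerA mulrC.
(* Substituting [Y' + Z1] for each generator splits a quadratic relation into parts of weights [M],
   [M - 2] and [M - 4] under conjugation by [X]. The leading part is the relation for [Y'], provided
   that the correction has the same weight as the other products or is absent. *)
have quad (p s t u : box) (c d : K) :
    c = 0 \/ omega r t + omega r u = omega r p + omega r s ->
    i (Y p) * i (Y s) = d *: (i (Y s) * i (Y p)) - c *: (i (Y t) * i (Y u)) ->
    Y' p * Y' s = d *: (Y' s * Y' p) - c *: (Y' t * Y' u).
  move=> cE E; set M := omega r p + omega r s in cE.
  have sq (l : K) p' s' : l *: (i (Y p') * i (Y s')) = l *: (Y' p' * Y' s') +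
      (l *: (Y' p' * Z1 s') + l *: (Z1 p' * Y' s')) + l *: (Z1 p' * Z1 s').
    by rewrite !iYE mulrDl !mulrDr !scalerDr -/(Z1 _) -/(Z1 _) !addrA.
  have sum3 (x0 x1 x2 y0 y1 y2 : R) : (x0 + x1 + x2) + (y0 + y1 + y2) =
      (x0 + y0) + (x1 + y1) + (x2 + y2) by rewrite addrACA (addrACA x0).
  have sum33 (x0 x1 x2 y0 y1 y2 z0 z1 z2 : R) :
      (x0 + x1 + x2) + (y0 + y1 + y2) + (z0 + z1 + z2) =
      (x0 + y0 + z0) + (x1 + y1 + z1) + (x2 + y2 + z2) by rewrite (sum3 x0) sum3.
  have lam (l : K) p' s' : (l = 0 \/ omega r p' + omega r s' = M) ->
    [/\ X * (l *: (Y' p' * Y' s')) = q ^ M *: (l *: (Y' p' * Y' s') * X),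
        X * (l *: (Y' p' * Z1 s') + l *: (Z1 p' * Y' s')) =
          q ^ (M - 2) *: ((l *: (Y' p' * Z1 s') + l *: (Z1 p' * Y' s')) * X) &
        X * (l *: (Z1 p' * Z1 s')) = q ^ (M - 4) *: (l *: (Z1 p' * Z1 s') * X)].
    move=> lE; split.
    - by apply: (XM) (XY _) (XY _) _ _ _.
    - apply: evD; first by apply: (XM) (XY _) (XZ1 _) _ _ _; case: lE => [|<-]; [left|right; ring].
      by apply: (XM) (XZ1 _) (XY _) _ _ _; case: lE => [|<-]; [left|right; ring].
    - by apply: (XM) (XZ1 _) (XZ1 _) _ _ _; case: lE => [|<-]; [left|right; ring].
  have [e1 e2 e3] := lam 1 p s (or_intror erefl).
  have [f1 f2 f3] := lam (- d) s p (or_intror (addrC _ _)).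
  have [|g1 g2 g3] := lam c t u; first by case: cE; [left|right].
  have := eigen_leading Xxi (evD _ _ _ (evD _ _ _ e1 f1) g1) (evD _ _ _ (evD _ _ _ e2 f2) g2)
    (evD _ _ _ (evD _ _ _ e3 f3) g3).
  rewrite -sum33 -!sq !scale1r E scaleNr [X in X + _ = 0]addrAC subrr sub0r addNr => /(_ erefl)/eqP.
  by rewrite addrAC scaleNr subr_eq0 => /eqP <-; rewrite addrK.
have yact g s : act' g (i (Y s)) = chi g s *: i (Y s).
  by rewrite acti (qc_act qc) linearZ.
have xiact g : act' g xi = (chi g r)^-1 *: xi.
  have E : act' g xi * act' g X = 1 by rewrite -rmorphM xiX rmorph1.
  rewrite -[LHS]mulr1 -Xxi mulrA.
  have -> : act' g xi * X = (chi g r)^-1 *: 1.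
    by rewrite -E yact -scalerAr scalerA mulVf // scale1r.
  by rewrite -scalerAl mul1r.
exists R, Y', Yi', act'; split=> //; last first.
  move=> sY; have Z0 s : Z s = 0.
    by rewrite /Z; case: ifP => // sr; rewrite -rmorphM (sY r s sr) rmorph0 mul0r.
  have Y'i s : Y' s = i (Y s) by rewrite /Y' Z0 scaler0 subr0.
  split=> [p s ps|s]; first by rewrite !Y'i -rmorphM sY // rmorph0.
  rewrite Y'i; split=> [E|->]; last exact: rmorph0.
  by apply: inji; rewrite E rmorph0.
split=> //.
- move=> S SS Sg.
  have [S1 SD SM SZ] := SS.
  have SY' s : S (Y' s) by have := Sg (s, true).
  have Sxi : S xi by have := Sg (r, false); rewrite /gens /Yi' /= eqxx.
  have Si a : S (i a).
    move: a; apply: (qc_gen qc (S := [set a | S (i a)])).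
      split=> /=; first by rewrite rmorph1.
      + by move=> u w Su Sw; rewrite rmorphD; exact: SD.
      + by move=> u w Su Sw; rewrite rmorphM; exact: SM.
      + by move=> c u Su; rewrite linearZ; exact: SZ.
    case=> s []; rewrite /gens /=; last first.
      have [->|sr] := eqVneq s r.
        by rewrite (qc_ninv qc) ?rk // rmorph0; exact: subalgebra0.
      by have := Sg (s, false); rewrite /gens /Yi' /= (negPf sr).
    (* The factors of [Z s] lie in the row and column of the pivot, where deletion changes nothing,
       so they are among the new generators. *)
    rewrite iYE; apply: SD => //; apply: SZ; rewrite /Z.
    case: ifP => _; last exact: subalgebra0.
    by apply: (SM) => //; rewrite -!Y'E //; exact: SM.
  by move=> w; have [a [N ->]] := fr w; apply: SM => //; exact: subalgebraX.
- move=> g s; rewrite /Y' rmorphB /= yact [act' g (_ *: _)]linearZ /= scalerBr; congr (_ - _).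
  rewrite scalerA mulrC -scalerA; congr (_ *: _); rewrite /Z.
  case: ifP => _; last by rewrite rmorph0 scaler0.
  rewrite !rmorphM /= !yact xiact -!scalerAl -!scalerAr -!scalerAl !scalerA; congr (_ *: _).
  by rewrite mulrAC chi_rect -!surjective_pairing mulfK.
- move=> p s ps sp.
  have := quad p s p s 0 (q ^ omega p s) (or_introl erefl).
  rewrite !scale0r !subr0; apply.
  by rewrite -!rmorphM /= (qc_comm qc ps sp) linearZ.
- move=> i0 j0 a0 b0 ij ab; set p := (j0, b0); set s := (i0, a0).
  have nsp : nw s p by rewrite /nw ij.
  have E := congr1 i (qc_diag qc ij ab); rewrite rmorphB /= [i (_ *: _)]linearZ !rmorphM /= in E.
  have [pr|pr] := eqVneq p r.
    rewrite pr rk ltnn scale0r subr0 Y'E // XY omegaC omega_nw -?pr //.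
    by rewrite oppr0 expr0z scale1r pr.
  rewrite -[Y' s * Y' p]scale1r; apply: quad; last first.
    by rewrite scale1r E ltnS leq_eqVlt -rk (inj_eq (@pos_inj _ _)) (negPf pr).
  case: ifP => pk; [right|by left].
  move: pk; rewrite -rk pos_lt /omega /= -!val_eqE /=.
  move: (r.1 : nat) (r.2 : nat) => j b.
  by do !case: eqP => ? //=; lia.
- move=> s ks; rewrite /Yi'; have [->|sr] := eqVneq s r.
    by right; rewrite Y'E.
  have ks' : (k < pos s)%N.
    by rewrite ltn_neqAle ks -rk (inj_eq (@pos_inj _ _)) eq_sym sr.
  rewrite Y'E; last by apply/negP => /nw_pos; rewrite rk; lia.
  by case: (qc_inv qc ks') => -[E1 E2]; [left|right]; rewrite -?rmorphM ?E1 ?E2 ?rmorph0 ?rmorph1.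
- move=> s sk; rewrite /Yi'; case: eqP => [E|_]; first by rewrite E rk ltnn in sk.
  by rewrite (qc_ninv qc) ?rmorph0 // ltnW.
Qed.

End Step.
End Deletion.

(** * Monomials in quasi-commuting invertible elements *)

Section IntegerPowers.
Variables (K : fieldType) (A : algType K).

Definition ipow (u v : A) (z : int) : A :=
  match z with Posz k => u ^+ k | Negz k => v ^+ k.+1 end.

Variables u v : A.
Hypotheses (uv : u * v = 1) (vu : v * u = 1).

Let ipow_succ z : ipow u v (z + 1) = ipow u v z * u.
Proof.
case: z => [k|[|k]]; first by rewrite -PoszD addn1 /= exprSr.
  by rewrite /= expr1 vu.
have -> : Negz k.+1 + 1 = Negz k by rewrite !NegzE; lia.
by rewrite /= [in RHS]exprSr -mulrA vu mulr1.
Qed.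

Let ipow_pred z : ipow u v (z - 1) = ipow u v z * v.
Proof.
by rewrite -[in RHS](subrK 1 z) ipow_succ -mulrA uv mulr1.
Qed.

Lemma ipowD a b : ipow u v (a + b) = ipow u v a * ipow u v b.
Proof.
case: b => [k|k].
  elim: k => [|k IH]; first by rewrite addr0 mulr1.
  by rewrite -addn1 PoszD addrA ipow_succ IH /= addn1 exprSr mulrA.
elim: k => [|k IH]; first by rewrite ipow_pred /= expr1.
rewrite (_ : a + Negz k.+1 = a + Negz k - 1); last by rewrite !NegzE; lia.
by rewrite ipow_pred IH -mulrA -exprSr.
Qed.

End IntegerPowers.

Lemma ipow_morph (K : fieldType) (A B : algType K) (f : {lrmorphism A -> B}) (u v : A) z :
  f (ipow u v z) = ipow (f u) (f v) z.
Proof. by case: z => k /=; rewrite rmorphXn. Qed.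

Lemma ipowZ (K : fieldType) (A : algType K) (u v : A) (c : K) z :
  ipow (c *: u) (c^-1 *: v) z = c ^ z *: ipow u v z.
Proof. by case: z => k /=; rewrite exprZn // exprVn. Qed.

Section Monomials.
Variables (K : fieldType) (q : K) (A : algType K) (I : finType).
Hypothesis q_neq0 : q != 0.
Variables (u v : I -> A) (w : I -> I -> int).
Hypotheses (uv : forall i, u i * v i = 1) (vu : forall i, v i * u i = 1).
Hypothesis uu : forall i j, u i * u j = q ^ (w i j) *: (u j * u i).

Definition mon (e : {ffun I -> int}) : A := \prod_(i : I) ipow (u i) (v i) (e i).

Definition wform (e : {ffun I -> int}) (j : I) : int := \sum_i e i * w i j.

Let ipow_u i j a : ipow (u i) (v i) a * u j = q ^ (a * w i j) *: (u j * ipow (u i) (v i) a).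
Proof.
have vj : v i * u j = q ^ (- w i j) *: (u j * v i).
  have E : u j * u i = q ^ (- w i j) *: (u i * u j).
    by rewrite (uu i j) scalerA -expfzDr // addNr expr0z scale1r.
  by rewrite -[LHS]mulr1 -(uv i) mulrA -[v i * u j * u i]mulrA E -scalerAr -scalerAl
    (mulrA (v i)) vu mul1r.
case: a => k /=; elim: k => [|k IH].
- by rewrite mul0r expr0z scale1r mulr1 mul1r.
- rewrite exprSr -mulrA uu -scalerAr (mulrA _ (u j)) IH -scalerAl scalerA -expfzDr // -mulrA.
  by congr (_ ^ _ *: _); lia.
- by rewrite expr1 vj; congr (_ ^ _ *: _); lia.
rewrite exprSr -mulrA vj -scalerAr (mulrA _ (u j)) IH -scalerAl scalerA -expfzDr // -mulrA.
by congr (_ ^ _ *: _); rewrite !NegzE; lia.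
Qed.

Lemma mon_u e j : mon e * u j = q ^ (wform e j) *: (u j * mon e).
Proof.
rewrite /mon /wform; elim: (index_enum I) => [|i l IH].
  by rewrite !big_nil mulr1 mul1r scale1r.
rewrite !big_cons -mulrA IH -scalerAr (mulrA _ (u j)) ipow_u -scalerAl scalerA -expfzDr //.
by rewrite addrC -mulrA.
Qed.

Lemma mon0 : mon 0 = 1.
Proof. by rewrite /mon big1 // => i _; rewrite ffunE. Qed.

Let qcomm_ipow (x : A) i a : qcomm x (u i) -> qcomm x (ipow (u i) (v i) a).
Proof.
move=> xu; have xv : qcomm x (v i) := qcomm_inv (uv i) (vu i) xu.
by case: a => k; exact: qcommX.
Qed.

Let mon_seq (l : seq I) (e f : {ffun I -> int}) : exists2 c : K, c != 0 &
  (\prod_(i <- l) ipow (u i) (v i) (e i)) * (\prod_(i <- l) ipow (u i) (v i) (f i)) =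
  c *: \prod_(i <- l) ipow (u i) (v i) ((e + f) i).
Proof.
elim: l => [|i l [c c0 IH]].
  by exists 1; rewrite ?oner_neq0 // !big_nil mulr1 scale1r.
have [d d0 E] : qcomm (\prod_(i <- l) ipow (u i) (v i) (e i)) (ipow (u i) (v i) (f i)).
  apply: qcommC; elim: (l) => [|j l' IH'].
    by rewrite big_nil; exists 1; rewrite ?oner_neq0 // mulr1 mul1r scale1r.
  rewrite big_cons; apply: qcommM => //; apply: qcomm_ipow; apply: qcommC; apply: qcomm_ipow.
  by exists (q ^ w j i); [rewrite expfz_neq0|exact: uu].
exists (d * c); first exact: mulf_neq0.
rewrite !big_cons ffunE ipowD //; move: E IH.
set P := \prod_(i <- l) ipow _ _ (e i); set F := ipow _ _ (f i) => E IH.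
rewrite -(mulrA _ P) (mulrA P) E -scalerAl -scalerAr -(mulrA F) IH -!scalerAr scalerA.
by rewrite mulrA.
Qed.

Lemma monM e f : exists2 c : K, c != 0 & mon e * mon f = c *: mon (e + f).
Proof. exact: mon_seq. Qed.

Lemma monV e : exists2 c : K, c != 0 & mon e * mon (- e) = c%:A.
Proof. by have [c c0 E] := monM e (- e); exists c; rewrite // E subrr mon0. Qed.

Definition delta i : {ffun I -> int} := [ffun j => (j == i)%:Z].

Lemma mon_single i (z : int) : mon [ffun j => (j == i)%:Z * z] = ipow (u i) (v i) z.
Proof.
have H (l : seq I) : uniq l ->
    \prod_(j <- l) ipow (u j) (v j) ([ffun j => (j == i)%:Z * z] j) =
    if i \in l then ipow (u i) (v i) z else 1.
  elim: l => [|j l IH] /=; first by rewrite big_nil.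
  move=> /andP[jl /IH E]; rewrite big_cons E ffunE inE.
  case: eqVneq => [Eij|_] /=; last by rewrite mul0r mul1r.
  by rewrite -Eij (negPf jl) mul1r mulr1.
by rewrite /mon H ?index_enum_uniq // mem_index_enum.
Qed.

Lemma mon_morph (f : {lrmorphism A -> A}) (chi : I -> K) :
  (forall i, chi i != 0) -> (forall i, f (u i) = chi i *: u i) ->
  forall e, f (mon e) = (\prod_i chi i ^ e i) *: mon e.
Proof.
move=> chi0 fu e; have fv i : f (v i) = (chi i)^-1 *: v i.
  have E : f (v i) * f (u i) = 1 by rewrite -rmorphM vu rmorph1.
  rewrite -[LHS]mulr1 -(uv i) mulrA.
  have -> : f (v i) * u i = (chi i)^-1 *: 1.
    by rewrite -E fu -scalerAr scalerA mulVf // scale1r.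
  by rewrite -scalerAl mul1r.
rewrite /mon; elim: (index_enum I) => [|i l IH].
  by rewrite !big_nil rmorph1 scale1r.
by rewrite !big_cons rmorphM /= IH ipow_morph fu fv ipowZ -scalerAl -scalerAr scalerA.
Qed.

Lemma mon_span : generated (fun t : I * bool => if t.2 then u t.1 else v t.1) ->
  forall a, exists l : seq (K * {ffun I -> int}), a = \sum_(t <- l) t.1 *: mon t.2.
Proof.
move=> gA; apply: gA; last first.
  case=> i []; rewrite /=.
    exists [:: (1, [ffun j => (j == i)%:Z * 1])].
    by rewrite big_seq1 scale1r mon_single.
  exists [:: (1, [ffun j => (j == i)%:Z * (- 1)])].
  by rewrite big_seq1 scale1r mon_single.
split=> /=.
- by exists [:: (1, 0)]; rewrite big_seq1 mon0 scale1r.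
- by move=> _ _ [l ->] [l' ->]; exists (l ++ l'); rewrite big_cat.
- move=> _ _ [l ->] [l' ->]; elim: l => [|t l [r IH]].
    by exists [::]; rewrite !big_nil mul0r.
  suff [r' E] : exists r', t.1 *: mon t.2 * (\sum_(t <- l') t.1 *: mon t.2) =
      \sum_(t <- r') t.1 *: mon t.2.
    by exists (r' ++ r); rewrite big_cons mulrDl IH E big_cat.
  elim: l' {IH} => [|t' l' [r' IH]]; first by exists [::]; rewrite !big_nil mulr0.
  have [c _ E] := monM t.2 t'.2.
  exists ((t.1 * t'.1 * c, t.2 + t'.2) :: r').
  by rewrite !big_cons mulrDr IH -scalerAl -scalerAr E !scalerA.
- move=> k _ [l ->]; exists [seq (k * t.1, t.2) | t <- l].
  by rewrite big_map scaler_sumr; apply: eq_bigr => t _; rewrite scalerA.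
Qed.

End Monomials.

Lemma big_collect (K : fieldType) (V : lmodType K) (E : eqType) (F : E -> V)
    (l : seq (K * E)) : exists c : E -> K, \sum_(t <- l) t.1 *: F t.2 =
  \sum_(e <- undup [seq t.2 | t <- l]) c e *: F e.
Proof.
exists (fun e => \sum_(t <- l | t.2 == e) t.1).
under [RHS]eq_bigr do rewrite scaler_suml big_mkcond.
rewrite exchange_big /= !big_seq; apply: eq_bigr => t tl.
rewrite -big_mkcond /= (eq_bigl (pred1 t.2)); last by move=> e; rewrite eq_sym.
by rewrite -big_filter filter_pred1_uniq ?undup_uniq ?mem_undup ?map_f // big_seq1.
Qed.

(** * Laurent polynomial algebras *)

Lemma quotalg_universal (K : fieldType) (A B : algType K) (S : set A)
    (h : ~ ideal_gen S 1) (f : {lrmorphism A -> B}) :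
  (forall s, S s -> f s = 0) ->
  exists g : {lrmorphism quotalg h -> B}, forall a, g (quotalg_pi h a) = f a.
Proof.
move=> fS; have [gD gM g1 gZ] := quotalg_lift_lrmorphism h fS.
have [g gE] := lrmorphism_exists gD gM g1 gZ.
by exists g => a; rewrite gE; exact: quotalg_liftE.
Qed.

Section Laurent.
Variables (K : fieldType) (d : nat).
Local Notation L := (laurent K d).

Definition zgen (t : 'I_d * bool) : L := quotalg_pi (@laurent_proper K d) (gen K t).

Lemma zgen_generated : generated zgen.
Proof.
apply: (@generated_image K _ L (quotalg_pi (@laurent_proper K d)) _ (@gen K _)).
  exact: freealg_generated.
exact: quotalg_surj.
Qed.

Lemma laurent_relatorE s : laurent_relator s -> quotalg_pi (@laurent_proper K d) s = 0.
Proof. by move=> rs; apply/quotalg_pi_eq0; exact: sub_ideal_gen. Qed.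

Lemma zgenC s t : zgen s * zgen t = zgen t * zgen s.
Proof.
apply/eqP; rewrite -subr_eq0 -!rmorphM -rmorphB; apply/eqP.
by apply: laurent_relatorE; exact: LaurentComm.
Qed.

Lemma zgenV i : zgen (i, true) * zgen (i, false) = 1.
Proof.
apply/eqP; rewrite -subr_eq0 -rmorphM -[1](rmorph1 (quotalg_pi (@laurent_proper K d))) -rmorphB.
by apply/eqP; apply: laurent_relatorE; exact: LaurentInv.
Qed.

Lemma laurentC (a b : L) : a * b = b * a.
Proof.
apply: (zgen_generated (centralizer_subalgebra b)) => t; apply/esym.
by apply: (zgen_generated (centralizer_subalgebra (zgen t))) => s; exact: zgenC.
Qed.

Lemma laurent_universal (B : algType K) (x y : 'I_d -> B) :
  (forall i, x i * y i = 1) -> (forall i, y i * x i = 1) ->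
  (forall i j, x i * x j = x j * x i) ->
  exists f : {lrmorphism L -> B}, forall i, f (zgen (i, true)) = x i /\ f (zgen (i, false)) = y i.
Proof.
move=> xy yx xx; pose v (t : 'I_d * bool) := if t.2 then x t.1 else y t.1.
have comm (a b c : B) : a * b = 1 -> b * a = 1 -> a * c = c * a -> b * c = c * b.
  move=> ab ba ac; rewrite -[LHS]mulr1 -ab mulrA -(mulrA b) -ac (mulrA b) ba.
  by rewrite mul1r.
have vv s t : v s * v t = v t * v s.
  case: s t => i [] [j []]; rewrite /v /=; first exact: xx.
  - by symmetry; apply: (comm (x j)).
  - exact: (comm (x i)).
  - by apply: (comm (x i)) => //; symmetry; apply: (comm (x j)).
have [s|g gE] := quotalg_universal (@laurent_proper K d) (f := free_eval v).
  case=> [t t'|i].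
    by rewrite /= free_evalB [X in X - _]free_evalM free_evalM 2!free_eval_gen vv subrr.
  by rewrite /= free_evalB free_evalM 2!free_eval_gen free_eval1 /v /= xy subrr.
by exists g => i; rewrite /zgen !gE /= !free_eval_gen.
Qed.

Definition zmon (e : {ffun 'I_d -> int}) : L :=
  mon (fun i => zgen (i, true)) (fun i => zgen (i, false)) e.

Let zV i : zgen (i, true) * zgen (i, false) = 1 := zgenV i.
Let Vz i : zgen (i, false) * zgen (i, true) = 1.
Proof. by rewrite zgenC zgenV. Qed.
Let zz i j : zgen (i, true) * zgen (j, true) = 1 ^ (0 : int) *: (zgen (j, true) * zgen (i, true)).
Proof. by rewrite expr0z scale1r zgenC. Qed.

Lemma zmon_span a : exists c : {ffun 'I_d -> int} -> K, exists2 l, uniq l &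
  a = \sum_(e <- l) c e *: zmon e.
Proof.
have [|l ->] := mon_span (oner_neq0 K) zV Vz zz _ a.
  move=> S SS Sz; apply: zgen_generated => // -[i []].
    exact: (Sz (i, true)).
  exact: (Sz (i, false)).
have [c E] := big_collect (fun e => zmon e) l.
by exists c; eexists; last exact: E; rewrite undup_uniq.
Qed.

Lemma zmonM e f : exists2 c : K, c != 0 & zmon e * zmon f = c *: zmon (e + f).
Proof. exact: (monM (oner_neq0 K) zV Vz zz). Qed.

Variable q : K.
Hypothesis q_neq0 : q != 0.

(** The automorphism [f i] multiplies the [i]-th variable by [q] and fixes the others. Together they
    have distinct eigenvalues on distinct monomials when [q] is not a root of unity, which stands in
    for coefficient functions on the presented algebra. *)
Lemma laurent_twist : exists f : 'I_d -> {lrmorphism L -> L},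
  forall i e, f i (zmon e) = q ^ (e i) *: zmon e.
Proof.
suff H i : exists f : {lrmorphism L -> L}, forall e, f (zmon e) = q ^ (e i) *: zmon e.
  by exists (fun i => projT1 (cid (H i))) => i e; case: cid.
pose c (j : 'I_d) := if j == i then q else 1.
have c0 j : c j != 0 by rewrite /c; case: ifP; rewrite ?oner_neq0.
have [|||f fE] := @laurent_universal L (fun j => c j *: zgen (j, true))
    (fun j => (c j)^-1 *: zgen (j, false)).
- by move=> j; rewrite -scalerAl -scalerAr scalerA zV mulfV // scale1r.
- by move=> j; rewrite -scalerAl -scalerAr scalerA Vz mulVf // scale1r.
- by move=> j j'; rewrite -!scalerAl -!scalerAr !scalerA zgenC mulrC.
exists f => e; have fz j : f (zgen (j, true)) = c j *: zgen (j, true) by case: (fE j).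
rewrite (mon_morph zV Vz c0 fz) (bigD1 i) //= /c eqxx big1 ?mulr1 // => j /negPf ->.
by rewrite exp1rz.
Qed.

End Laurent.

(** * Integer kernels *)

(** From the Smith normal form [M = L D R]: the rows of the inverse of [L] indexed by the zero rows
    of [D] form a basis of the left kernel. *)
Lemma int_kernel (N p : nat) (M : 'M[int]_(N, p)) :
  exists (d : nat) (B : 'M[int]_(d, N)), [/\ B *m M = 0,
    forall v : 'rV_N, v *m M = 0 -> exists a, v = a *m B,
    forall a : 'rV_d, a *m B = 0 -> a = 0 & (N - p <= d)%N].
Proof.
have [L uL [R uR [ds _ ->]]] := int_Smith_normal_form M.
set D := \matrix_(_, _) _.
pose F := [pred i : 'I_N | [forall j : 'I_p, D i j == 0]].
pose B := \matrix_(k < #|F|) row (enum_val k) (invmx L).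
have BL k : row k B *m L = delta_mx 0 (enum_val k).
  by rewrite rowK -row_mul mulVmx // row1.
exists #|F|, B; split.
- apply/row_matrixP => k; rewrite !row_mul row0 !mulmxA BL -rowE.
  have -> : row (enum_val k) D = 0; last by rewrite mul0mx.
  apply/rowP => j; rewrite [LHS]mxE [RHS]mxE; apply/eqP.
  by have := enum_valP k; rewrite inE => /forallP.
- move=> v; rewrite !mulmxA => /(congr1 (mulmx^~ (invmx R))); rewrite mulmxK // mul0mx => E.
  set w := v *m L in E.
  exists (\row_k w 0 (enum_val k)).
  have -> : v = w *m invmx L by rewrite mulmxK.
  rewrite [LHS]mulmx_sum_row [RHS]mulmx_sum_row (bigID F) /= [X in _ + X]big1 ?addr0.
    rewrite (big_enum_val (A := F) (fun i => w 0 i *: row i (invmx L))).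
    by apply: eq_bigr => k _; rewrite [in RHS]mxE rowK.
  move=> i /forallPn[j Dij]; suff -> : w 0 i = 0 by rewrite scale0r.
  have := congr1 (fun X : 'rV_p => X 0 j) E; rewrite mxE [RHS]mxE (bigD1 i) //= big1 ?addr0.
    by move=> /eqP; rewrite mulf_eq0 (negPf Dij) orbF => /eqP.
  move=> l li; rewrite [D l j]mxE; case: eqP => [lj|_]; last by rewrite /= mulr0n mulr0.
  move: Dij; rewrite mxE; case: (i =P j :> nat) => [ij|_]; last by rewrite /= ?eqxx.
  by case/eqP: li; apply: val_inj; rewrite /= lj ij.
- move=> a /(congr1 (mulmx^~ L)); rewrite mul0mx => E; apply/rowP => k.
  have EE l : (a 0 l *: row l (B *m L)) 0 (enum_val k) = a 0 l * (k == l)%:R.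
    by rewrite row_mul BL !mxE (inj_eq enum_val_inj).
  have := congr1 (fun X : 'rV_N => X 0 (enum_val k)) E.
  rewrite -mulmxA mulmx_sum_row summxE (bigD1 k) //= big1 ?addr0 => [|l lk].
    by rewrite EE eqxx mulr1 => ->; rewrite !mxE.
  by rewrite EE eq_sym (negPf lk) mulr0.
(* All rows of [D] of index at least [p] are zero, which gives [N - p] kernel vectors. *)
have lt (k : 'I_(N - p)) : (p + k < N)%N by have := ltn_ord k; lia.
have f_inj : injective (fun k => Ordinal (lt k)).
  by move=> k l /(congr1 val) /= /addnI/val_inj.
rewrite -[X in (X <= _)%N]card_ord -(card_codom f_inj).
apply: subset_leq_card; apply/fintype.subsetP => i /codomP[k ->]; rewrite inE.
apply/forallP => j; have /negPf kj : (p + k != j)%N by have := ltn_ord j; lia.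
by rewrite mxE /= kj.
Qed.

(** * Bases of lattices given by integer equations *)

Section KernelBasis.
Variables (I J : finType) (M : I -> J -> int).
Implicit Types e : {ffun I -> int}.

Definition in_kernel e : Prop := forall j, \sum_i e i * M i j = 0.

Definition lattice_basis d (P : {ffun I -> int} -> Prop) (bs : 'I_d -> {ffun I -> int}) : Prop :=
  [/\ forall k, P (bs k),
      forall e, P e -> exists a : {ffun 'I_d -> int}, e = \sum_k bs k *~ a k &
      forall a : {ffun 'I_d -> int}, \sum_k bs k *~ a k = 0 -> a = 0].

Lemma kernel_basis : exists d (bs : 'I_d -> {ffun I -> int}),
  lattice_basis in_kernel bs /\ (#|I| - #|J| <= d)%N.
Proof.
pose MM : 'M[int]_(#|I|, #|J|) := \matrix_(i, j) M (enum_val i) (enum_val j).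
have [d [B [BM Bk Bi Bd]]] := int_kernel MM.
pose rv e : 'rV[int]_#|I| := \row_i e (enum_val i).
have rvM e : in_kernel e <-> rv e *m MM = 0.
  have E j : (rv e *m MM) 0 j = \sum_i e i * M i (enum_val j).
    rewrite mxE (reindex (@enum_val _ I)) /=; last exact: onW_bij (enum_val_bij _).
    by apply: eq_bigr => i _; rewrite !mxE.
  split=> [Pe|E0 j]; first by apply/rowP => j; rewrite E Pe mxE.
  by have := E (enum_rank j); rewrite E0 mxE enum_rankK.
pose bs k : {ffun I -> int} := [ffun i => B k (enum_rank i)].
have rvbs (a : 'I_d -> int) : rv (\sum_k bs k *~ a k) = (\row_k a k) *m B.
  apply/rowP => i; rewrite !mxE sum_ffunE; apply: eq_bigr => k _.
  by rewrite ffunMzE ffunE enum_valK mxE mulrC -mulrzz.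
have rv_inj : injective rv.
  by move=> e f /rowP E; apply/ffunP => i; have := E (enum_rank i); rewrite !mxE enum_rankK.
exists d, bs; split=> //; split.
- move=> k; apply/rvM; rewrite (_ : rv (bs k) = row k B); first by rewrite -row_mul BM row0.
  by apply/rowP => i; rewrite !mxE ffunE enum_valK.
- move=> e /rvM/Bk[a E]; exists [ffun k => a 0 k]; apply: rv_inj; rewrite rvbs E.
  by congr (_ *m _); apply/rowP => k; rewrite mxE ffunE.
- move=> a E; have := Bi (\row_k a k); rewrite -rvbs E => /(_ _)/rowP H.
  apply/ffunP => k; have := H _ k; rewrite !mxE ffunE; apply.
  by apply/rowP => i; rewrite !mxE ffunE.
Qed.

End KernelBasis.

(** If [d] exceeded [m], the images of the basis vectors under the [m] functionals would satisfy a
    nontrivial integer relation; the same combination of the basis itself is then zero, against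
    independence. *)
Lemma basis_rank (I : finType) (P : {ffun I -> int} -> Prop) d (bs : 'I_d -> {ffun I -> int})
    m (R : I -> 'I_m -> int) :
  (forall a : {ffun 'I_d -> int}, P (\sum_k bs k *~ a k)) -> lattice_basis P bs ->
  (forall e, P e -> (forall j, \sum_i e i * R i j = 0) -> e = 0) -> (d <= m)%N.
Proof.
move=> Pc [Pbs _ bi] PR; rewrite leqNgt; apply/negP => md.
pose N (k : 'I_d) (j : 'I_m) : int := \sum_i bs k i * R i j.
have [d' [cs [[Pcs _ ci]]]] := kernel_basis N.
rewrite !card_ord => le; have d'0 : (0 < d')%N by apply: leq_trans le; rewrite subn_gt0.
have cs0 : cs (Ordinal d'0) = 0.
  apply: bi; apply: PR; first exact: Pc.
  move=> j; rewrite -[RHS](Pcs (Ordinal d'0) j).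
  under eq_bigr do rewrite sum_ffunE mulr_suml.
  rewrite exchange_big; apply: eq_bigr => k _; rewrite mulr_sumr; apply: eq_bigr => i _.
  by rewrite ffunMzE -mulrzl intz mulrA.
have := ci (delta (Ordinal d'0)).
rewrite (bigD1 (Ordinal d'0)) //= big1 ?addr0 => [|k /negPf kn]; last first.
  by rewrite ffunE kn mulr0z.
by rewrite ffunE eqxx mulr1z cs0 => /(_ erefl)/ffunP/(_ (Ordinal d'0)); rewrite !ffunE eqxx.
Qed.

(** * The radical of the commutation form *)

Section Radical.
Variables (m n : nat).
Local Notation box := ('I_m * 'I_n)%type.
Implicit Types (S : {set box}) (e : {ffun box -> int}).

Definition radical S e : Prop :=
  (forall s, s \notin S -> e s = 0) /\
  (forall s, s \in S -> \sum_p e p * omega p s = 0).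

(* With [a i l] the sum of the first [l] entries of row [i], the equations make
   [\sum_i (a i l) ^ 2] independent of [l], hence equal to its value at 0. *)
Lemma radical_row_sums S e : radical S e -> (forall i, \sum_a e (i, a) = 0) -> e = 0.
Proof.
move=> [eS eR] row0.
pose a (i : 'I_m) (l : nat) : int := \sum_(c < n | (c < l)%N) e (i, c).
pose c (k : nat) (al : 'I_n) : int := \sum_(i < m | (i < k)%N) e (i, al).
have aS i (al : 'I_n) : a i al.+1 = a i al + e (i, al).
  rewrite /a (bigD1 al) ?ltnSn //= addrC; congr (_ + _); apply: eq_bigl => l.
  by rewrite ltnS ltn_neqAle andbC.
have cS (i : 'I_m) al : c i.+1 al = c i al + e (i, al).
  rewrite /c (bigD1 i) ?ltnSn //= addrC; congr (_ + _); apply: eq_bigl => l.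
  by rewrite ltnS ltn_neqAle andbC.
(* As row [i] sums to zero, the part right of [al] is minus the part up to [al]. Columns need not
   sum to zero, so the total [c m al] remains in [colE]. *)
have rowE (i : 'I_m) (al : 'I_n) :
    \sum_(g < n) e (i, g) * ((g < al)%N%:Z - (al < g)%N%:Z) = 2 * a i al + e (i, al).
  have := row0 i; rewrite (bigID (fun g : 'I_n => (g < al)%N)) /= -/(a i al).
  rewrite (bigD1 al) ?ltnn //= => E.
  rewrite (bigID (fun g : 'I_n => (g < al)%N)) /= (eq_bigr (fun g => e (i, g))); last first.
    by move=> g lt; rewrite lt ltnNge (ltnW lt) subr0 mulr1.
  rewrite -/(a i al) (bigD1 al) ?ltnn //= subrr mulr0 add0r.
  rewrite [X in _ + X](eq_bigr (fun g => - e (i, g))); last first.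
    move=> g /andP[nlt ne]; rewrite (negPf nlt) ltn_neqAle leqNgt nlt andbT eq_sym.
    by rewrite -val_eqE in ne; rewrite ne sub0r mulrN mulr1.
  by rewrite sumrN; move/eqP: E; rewrite addrA addr_eq0 => /eqP <-; ring.
have colE (i : 'I_m) (al : 'I_n) :
    \sum_(k < m) e (k, al) * ((k < i)%N%:Z - (i < k)%N%:Z) = 2 * c i al + e (i, al) - c m al.
  have : c m al = \sum_(k < m) e (k, al) by apply: eq_bigl => k; rewrite ltn_ord.
  rewrite (bigID (fun k : 'I_m => (k < i)%N)) /= -/(c i al).
  rewrite (bigD1 i) ?ltnn //= => E.
  rewrite (bigID (fun k : 'I_m => (k < i)%N)) /= (eq_bigr (fun k => e (k, al))); last first.
    by move=> g lt; rewrite lt ltnNge (ltnW lt) subr0 mulr1.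
  rewrite -/(c i al) (bigD1 i) ?ltnn //= subrr mulr0 add0r.
  rewrite [X in _ + X](eq_bigr (fun k => - e (k, al))); last first.
    move=> g /andP[nlt ne]; rewrite (negPf nlt) ltn_neqAle leqNgt nlt andbT eq_sym.
    by rewrite -val_eqE in ne; rewrite ne sub0r mulrN mulr1.
  rewrite sumrN E opprD opprD; set X := \sum_(_ < m | _) _.
  by ring.
(* The factor [e (i, al)] makes the radical equation, available on [S], valid at every box. *)
have key (i : 'I_m) (al : 'I_n) :
    e (i, al) * (2 * a i al + 2 * c i al + 2 * e (i, al) - c m al) = 0.
  have [/eR E|/eS ->] := boolP ((i, al) \in S); last by rewrite mul0r.
  rewrite (_ : 2 * a i al + _ + _ - _ = 0) ?mulr0 // -[RHS]E.
  rewrite (eq_bigr (fun p : box =>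
     (p.2 == al)%:Z * (e (p.1, al) * ((p.1 < i)%N%:Z - (i < p.1)%N%:Z))
     + (p.1 == i)%:Z * (e (i, p.2) * ((p.2 < al)%N%:Z - (al < p.2)%N%:Z)))); last first.
    case=> k g _; rewrite /omega /= mulrDr addrC.
    by congr (_ + _); case: eqP => [->|]; rewrite /= ?mul0r ?mulr0 ?mul1r.
  rewrite big_split /=.
  rewrite -(pair_bigA _ (fun k g => (g == al)%:Z * (e (k, al) * ((k < i)%N%:Z - (i < k)%N%:Z)))).
  rewrite -(pair_bigA _ (fun k g => (k == i)%:Z * (e (i, g) * ((g < al)%N%:Z - (al < g)%N%:Z)))).
  have -> : \sum_(k < m) \sum_(g < n) (g == al)%:Z * (e (k, al) * ((k < i)%N%:Z - (i < k)%N%:Z)) =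
      2 * c i al + e (i, al) - c m al.
    rewrite -colE; apply: eq_bigr => k _; rewrite (bigD1 al) //= eqxx mul1r big1 ?addr0 //.
    by move=> g /negPf ->; rewrite mul0r.
  rewrite (bigD1 i) //= [X in _ + (_ + X)]big1 => [|k /negPf ki]; last first.
    by apply: big1 => g _; rewrite ki mul0r.
  rewrite (eq_bigr (fun g => e (i, g) * ((g < al)%N%:Z - (al < g)%N%:Z))); last first.
    by move=> g _; rewrite eqxx mul1r.
  by rewrite rowE; ring.
have T (al : 'I_n) : \sum_i a i al.+1 ^+ 2 = \sum_i a i al ^+ 2.
  (* By [key] the increments of [f] are -4 times the increments of the squares [a i ^+ 2]; they
     telescope to zero because [f] equals [c m al ^+ 2] at both ends. *)
  pose f k := (2 * c k al - c m al) ^+ 2.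
  have tel : \sum_(i < m) (f i.+1 - f i) = 0.
    rewrite -(big_mkord predT (fun i => f i.+1 - f i)) telescope_sumr // /f.
    have -> : c 0%N al = 0 by rewrite /c big_pred0.
    by ring.
  have : 4 * \sum_i (a i al.+1 ^+ 2 - a i al ^+ 2) = 0.
    rewrite -oppr0 -[in RHS]tel mulr_sumr -sumrN; apply: eq_bigr => i _.
    apply/eqP; rewrite -subr_eq0 /f aS cS; apply/eqP.
    by rewrite -[RHS](mulr0 4) -[in RHS](key i al); ring.
  by rewrite sumrB => /eqP; rewrite mulf_eq0 /= subr_eq0 => /eqP.
have a0 (l : nat) : (l <= n)%N -> forall i, a i l = 0.
  move=> ln; suff : \sum_i a i l ^+ 2 = 0.
    move=> /eqP; rewrite psumr_eq0 => [/allP H i|i _]; last exact: sqr_ge0.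
    by have := H i (mem_index_enum i); rewrite sqrf_eq0 => /eqP.
  elim: l ln => [_|l IH ln].
    by apply: big1 => i _; rewrite /a big_pred0 // expr0n.
  by rewrite -[RHS](IH (ltnW ln)) (T (Ordinal ln)).
apply/ffunP => -[i al]; rewrite ffunE.
by have := aS i al; rewrite !a0 ?add0r // ltnW.
Qed.

End Radical.

(** Exchanging rows and columns preserves [omega]. *)
Lemma radical_col_sums (m n : nat) (S : {set 'I_m * 'I_n}) e :
  radical S e -> (forall a, \sum_i e (i, a) = 0) -> e = 0.
Proof.
move=> [eS eR] col0.
pose tr (p : 'I_n * 'I_m) : 'I_m * 'I_n := (p.2, p.1).
suff : [ffun p => e (tr p)] = 0.
  by move=> /ffunP H; apply/ffunP => -[i a]; have := H (a, i); rewrite !ffunE.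
apply: (@radical_row_sums n m [set p | tr p \in S]).
  split=> [s|s]; rewrite inE; first by rewrite ffunE; exact: eS.
  move=> /eR E; rewrite -[RHS]E [RHS](reindex tr) /=; last by exists (fun p => (p.2, p.1)); case.
  by apply: eq_bigr => p _; rewrite ffunE /omega addrC.
by move=> i; under eq_bigr do rewrite ffunE; exact: col0.
Qed.

Lemma radical_basis (m n : nat) (S : {set 'I_m * 'I_n}) :
  exists d (bs : 'I_d -> {ffun 'I_m * 'I_n -> int}),
    lattice_basis (radical S) bs /\ (d <= minn m n)%N.
Proof.
(* For [s] outside [S] the column of [s] imposes [e s = 0], so that the support condition becomes
   part of a kernel. *)
pose M (p s : 'I_m * 'I_n) : int := if s \in S then omega p s else (p == s)%:Z.
have kr e : in_kernel M e <-> radical S e.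
  have E s : \sum_p e p * M p s = if s \in S then \sum_p e p * omega p s else e s.
    rewrite /M; case: ifP => // _; rewrite (bigD1 s) //= eqxx mulr1 big1 ?addr0 //.
    by move=> p /negPf ->; rewrite mulr0.
  split=> [H|[H1 H2] s]; first split=> s sS.
  - by have := H s; rewrite E (negPf sS).
  - by have := H s; rewrite E sS.
  - by rewrite E; case: ifP => [/H2|/negbT/H1].
have [d [bs [[Pbs bsp bi] _]]] := kernel_basis M.
have lb : lattice_basis (radical S) bs.
  by split=> // [k|e /kr]; [apply/kr|exact: bsp].
have Pc (a : {ffun 'I_d -> int}) : radical S (\sum_k bs k *~ a k).
  apply/kr => s; under eq_bigr do rewrite sum_ffunE mulr_suml.
  rewrite exchange_big big1 // => k _.
  under eq_bigr do rewrite ffunMzE -mulrzl -mulrA.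
  by rewrite -mulr_sumr Pbs mulr0.
exists d, bs; split=> //; rewrite leq_min; apply/andP; split.
  apply: (basis_rank (R := fun p i => (p.1 == i)%:Z) Pc lb) => e Pe H.
  apply: radical_row_sums Pe _ => i; rewrite -[RHS](H i).
  rewrite [RHS](eq_bigr (fun p => e (p.1, p.2) * (p.1 == i)%:Z)); last by case.
  rewrite -(pair_bigA _ (fun k g => e (k, g) * (k == i)%:Z)) /=.
  rewrite [RHS](bigD1 i) //= [X in _ = _ + X]big1 => [|k /negPf ki]; last first.
    by apply: big1 => g _; rewrite ki mulr0.
  by rewrite addr0; apply: eq_bigr => g _; rewrite eqxx mulr1.
apply: (basis_rank (R := fun p i => (p.2 == i)%:Z) Pc lb) => e Pe H.
apply: radical_col_sums Pe _ => i; rewrite -[RHS](H i).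
rewrite [RHS](eq_bigr (fun p => e (p.1, p.2) * (p.2 == i)%:Z)); last by case.
rewrite -(pair_bigA _ (fun k g => e (k, g) * (g == i)%:Z)) /=.
apply: eq_bigr => k _; rewrite (bigD1 i) //= eqxx mulr1 big1 ?addr0 // => g /negPf ->.
by rewrite mulr0.
Qed.

(** * The quantum torus case *)

Section QuantumTorus.
Variables (m n : nat) (K : fieldType) (q : K).
Hypotheses (q_neq0 : q != 0) (q_not_root1 : forall k : nat, (0 < k)%N -> q ^+ k != 1).
Variables (G : Type) (chi : G -> 'I_m * 'I_n -> K) (g0 : G).
Hypothesis chi_neq0 : forall g s, chi g s != 0.
Hypothesis chi_mul : forall g h, exists gh, forall s, chi gh s = chi g s * chi h s.
Hypothesis chi_row : forall i, exists g, forall s, chi g s = if s.1 == i then q else 1.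

Local Notation box := ('I_m * 'I_n)%type.
Local Notation expo := {ffun box -> int}.

Variables (A : algType K) (Y Yi : box -> A) (act : G -> {lrmorphism A -> A}).
Hypothesis qc : qclass q chi 0 Y Yi act.

Let S : {set box} := [set s | Y s != 0].
(** Boxes outside [S] carry the unit 1 and zero commutation exponents, so monomials can be indexed
    by all boxes; their exponents there have no effect and are normalized to 0 by [supp]. *)
Let U s := if s \in S then Y s else 1.
Let V s := if s \in S then Yi s else 1.
Let w p s : int := if (p \in S) && (s \in S) then omega p s else 0.

Let YYi s : s \in S -> Y s * Yi s = 1 /\ Yi s * Y s = 1.
Proof.
by rewrite inE => ys; case: (qc_inv qc (leq0n (pos s))) => // -[E]; rewrite E eqxx in ys.
Qed.

Let UV s : U s * V s = 1.
Proof. by rewrite /U /V; case: ifP => [/YYi[]//|_]; rewrite mulr1. Qed.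

Let VU s : V s * U s = 1.
Proof. by rewrite /U /V; case: ifP => [/YYi[]//|_]; rewrite mulr1. Qed.

Let UU p s : U p * U s = q ^ (w p s) *: (U s * U p).
Proof.
rewrite /U /w; case: ifP => pS; case: ifP => sS /=; rewrite ?expr0z ?scale1r ?mulr1 ?mul1r //.
by apply: (Ycomm qc); rewrite /active ltn0 andbF.
Qed.

Local Notation M := (mon U V).

Let UVgen : generated (fun t : box * bool => if t.2 then U t.1 else V t.1).
Proof.
move=> T ST Tt; apply: (qc_gen qc ST); case=> s b; rewrite /gens /=.
have := Tt (s, b); rewrite /U /V /=; have [sS|] := boolP (s \in S); first by case: b.
rewrite inE negbK => /eqP ys _.
have [[_ yis]|[E _]] := qc_inv qc (leq0n (pos s)).
  by case: b; rewrite ?ys ?yis; exact: subalgebra0.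
by have := oner_neq0 A; rewrite -E ys mul0r eqxx.
Qed.

Let supp (e : expo) := forall s, s \notin S -> e s = 0.

Let Mspan a : exists l : seq (K * expo),
  (forall t, t \in l -> supp t.2) /\ a = \sum_(t <- l) t.1 *: M t.2.
Proof.
have [l ->] := mon_span q_neq0 UV VU UU UVgen a.
pose tr (e : expo) : expo := [ffun s => if s \in S then e s else 0].
exists [seq (t.1, tr t.2) | t <- l]; split.
  by move=> _ /mapP[t _ ->] s sS; rewrite ffunE (negPf sS).
rewrite big_map; apply: eq_bigr => t _; congr (_ *: _); apply: eq_bigr => s _.
rewrite ffunE /U /V; case: ifP => //= _.
by case: (t.2 s) => k /=; rewrite expr1n.
Qed.

Let wformE e j : supp e -> j \in S -> wform w e j = \sum_p e p * omega p j.
Proof.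
move=> se jS; apply: eq_bigr => p _; rewrite /w jS andbT.
by have [//|/se ->] := boolP (p \in S); rewrite !mul0r.
Qed.

Let wform_out e j : j \notin S -> wform w e j = 0.
Proof. by move=> /negPf jS; apply: big1 => p _; rewrite /w jS andbF mulr0. Qed.

Let conj j (x : A) : A := V j * x * U j.

Let conj_linear j : linear (conj j).
Proof. by move=> k x y; rewrite /conj mulrDr mulrDl -scalerAr -scalerAl. Qed.

Let conjM j e : conj j (M e) = q ^ (wform w e j) *: M e.
Proof.
by rewrite /conj -mulrA (mon_u q_neq0 UV VU UU) -scalerAr mulrA VU mul1r.
Qed.

Let conj_ideal j I x : ideal I -> I x -> I (conj j x).
Proof. by move=> idI Ix; apply: idealMr => //; exact: idealMl. Qed.

Let pm (x : A) (e : expo) := exists2 c : K, c != 0 & x = c *: M e.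

Let pm1 : pm 1 0. Proof. by exists 1; rewrite ?oner_neq0 // mon0 scale1r. Qed.

Let pmM x y e f : pm x e -> pm y f -> pm (x * y) (e + f).
Proof.
move=> [c c0 ->] [d d0 ->]; have [k k0 E] := monM q_neq0 UV VU UU e f.
exists (c * d * k); first by rewrite !mulf_neq0.
by rewrite -scalerAl -scalerAr E !scalerA.
Qed.

Let pmX x e k : pm x e -> pm (x ^+ k) (e *+ k).
Proof.
by move=> xe; elim: k => [|k IH]; [exact: pm1|rewrite exprS mulrS; exact: pmM].
Qed.

Let pm_unit I x e : ideal I -> pm x e -> I x -> I 1.
Proof.
move=> idI [c c0 ->] /(idealZE idI c0) IM.
have [d d0 E] := monV q_neq0 UV VU UU e.
by apply: (idealZE idI d0); rewrite -E; exact: idealMr.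
Qed.

Let actM g e : act g (M e) = (\prod_s (if s \in S then chi g s else 1) ^ e s) *: M e.
Proof.
apply: (mon_morph UV VU) => s; first by case: ifP; rewrite ?oner_neq0.
by rewrite /U; case: ifP => _; [exact: (qc_act qc)|rewrite rmorph1 scale1r].
Qed.

Let actM_row i : exists g, forall e, supp e ->
  act g (M e) = q ^ (\sum_a e (i, a)) *: M e.
Proof.
have [g gE] := chi_row i; exists g => e se; rewrite actM; congr (_ *: _).
transitivity (\prod_s q ^ ((s.1 == i)%:Z * e s)).
  apply: eq_bigr => s _; rewrite gE; have [_|/se ->] := boolP (s \in S); last by rewrite mulr0.
  by case: eqP => _; rewrite ?mul1r ?mul0r ?exp1rz.
have -> (r : seq box) : \prod_(s <- r) q ^ ((s.1 == i)%:Z * e s) =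
    q ^ (\sum_(s <- r) (s.1 == i)%:Z * e s).
  by elim: r => [|s r IH]; [rewrite !big_nil|rewrite !big_cons IH expfzDr].
congr (_ ^ _); rewrite (eq_bigr (fun s => (s.1 == i)%:Z * e (s.1, s.2))); last by case.
rewrite -(pair_bigA _ (fun k a => (k == i)%:Z * e (k, a))) /= (bigD1 i) //=.
rewrite [X in _ + X]big1 ?addr0 => [|k /negPf ki]; last by apply: big1 => a _; rewrite ki mul0r.
by apply: eq_bigr => a _; rewrite eqxx mul1r.
Qed.

Let supp_sub e f : supp e -> supp f -> supp (e - f).
Proof. by move=> se sf s sS; rewrite !ffunE se // sf // subr0. Qed.

Let wformB e f j : wform w (e - f) j = wform w e j - wform w f j.
Proof. by rewrite /wform -sumrB; apply: eq_bigr => p _; rewrite !ffunE mulrBl. Qed.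

Let radical_of_wform e f : supp e -> supp f ->
  (forall j, q ^ (wform w e j) = q ^ (wform w f j)) -> radical S (e - f).
Proof.
move=> se sf H; split; first exact: supp_sub.
move=> s sS; rewrite -wformE //; last exact: supp_sub.
by rewrite wformB (expqz_inj q_neq0 q_not_root1 (H s)) subrr.
Qed.

(** Two supported exponents with the same eigenvalues under all conjugations differ by a radical
    vector; if the row elements of the torus do not distinguish them either, its row sums vanish and
    [radical_row_sums] makes it zero. So every term of a sum in [W] lies in [W]. *)
Let separate (I : eqType) (W : set A) (r : seq I) (ex : I -> expo) (c : I -> K) :
  ideal W -> stable act W -> uniq r -> {in r, forall i, supp (ex i)} -> {in r &, injective ex} ->
  W (\sum_(i <- r) c i *: M (ex i)) -> forall i, i \in r -> W (c i *: M (ex i)).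
Proof.
move=> idW sW ur sex iex Wr i0 ir.
pose T (j : box + G) (x : A) : A :=
  match j with inl s => conj s x | inr g => act g x end.
pose lam (j : box + G) i := match j with
  | inl s => q ^ (wform w (ex i) s)
  | inr g => \prod_s (if s \in S then chi g s else 1) ^ (ex i) s end.
have : W (\sum_(i <- r | `[< forall j, lam j i = lam j i0 >]) c i *: M (ex i)).
  apply: (@eigen_separation K A W _ _ (box + G) T _ _ _
    (fun i => c i *: M (ex i)) lam _ r i0 Wr).
  - by move=> u v; exact: idealD.
  - by move=> k u; exact: idealZ.
  - by case=> [s|g] k u v; [exact: conj_linear|rewrite /T linearP].
  - by case=> [s|g] u Wu; [exact: conj_ideal|exact: sW].
  - case=> [s|g] i /=; last by rewrite linearZ /= actM !scalerA mulrC.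
    by rewrite /conj -scalerAr -scalerAl -/(conj _ _) conjM !scalerA mulrC.
rewrite big_seq_cond (eq_bigl (pred1 i0)) => [|i]; last first.
  apply/andP/eqP => [[ir' /asboolP H]|->]; last by split=> //; apply/asboolP.
  apply: iex => //; apply/eqP; rewrite -subr_eq0; apply/eqP.
  have si := sex i ir'; have si0 := sex i0 ir.
  apply: (@radical_row_sums _ _ S).
    by apply: radical_of_wform => // j; exact: H (inl j).
  move=> k; have [g gE] := actM_row k.
  have := H (inr g); rewrite /= => Hg.
  (* The two expressions for the eigenvalue of [g] agree because monomials are units, hence
     nonzero. *)
  have Eg e : supp e -> q ^ (\sum_a e (k, a)) =
      \prod_s (if s \in S then chi g s else 1) ^ e s.
    move=> se; have := gE e se; rewrite actM => /eqP; rewrite -subr_eq0 -scalerBl scaler_eq0.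
    case/orP => [|/eqP M0]; first by rewrite subr_eq0 => /eqP.
    have [d d0 E] := monV q_neq0 UV VU UU e; move: E; rewrite M0 mul0r => /esym/eqP.
    by rewrite scaler_eq0 (negPf d0) (negPf (oner_neq0 A)).
  under eq_bigr do rewrite !ffunE.
  rewrite sumrB; apply/eqP; rewrite subr_eq0; apply/eqP.
  by apply: (expqz_inj q_neq0 q_not_root1); rewrite !Eg.
by rewrite -big_filter filter_pred1_uniq // big_seq1.
Qed.

Let torus_simple (W : set A) x : ideal W -> stable act W -> ~ W 1 -> W x -> x = 0.
Proof.
move=> idW sW nW1; have [l [sl ->]] := Mspan x.
have [c ->] := big_collect (fun e => M e) l.
set r := undup _; have sr e : e \in r -> supp e.
  by rewrite mem_undup => /mapP[t /sl + ->].
move=> Wx; rewrite big_seq; apply: big1 => e er.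
have [->|ce] := eqVneq (c e) 0; first by rewrite scale0r.
case: nW1; apply: (pm_unit idW (x := c e *: M e) (e := e)); first by exists (c e).
by apply: (separate (ex := id) idW sW (undup_uniq _) _ _ Wx) => //; move=> e' /sr.
Qed.

Let zero_stable : stable act [set (0 : A)].
Proof. by move=> g _ ->; rewrite /= rmorph0. Qed.

Variables (d : nat) (bs : 'I_d -> expo).
Hypothesis lb : lattice_basis (radical S) bs.

Local Notation L := (laurent K d).

Let phi (a : {ffun 'I_d -> int}) : expo := \sum_k bs k *~ a k.

Let wform_radical e j : radical S e -> wform w e j = 0.
Proof.
move=> [se eR]; have [jS|/wform_out//] := boolP (j \in S).
by rewrite wformE // eR.
Qed.

Let radical0 : radical S 0.
Proof.
by split=> [s _|s _]; [rewrite ffunE|apply: big1 => p _; rewrite ffunE mul0r].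
Qed.

Let radicalD e f : radical S e -> radical S f -> radical S (e + f).
Proof.
move=> [se eR] [sf fR]; split=> [s sS|s sS]; first by rewrite ffunE se // sf // addr0.
by under eq_bigr do rewrite ffunE mulrDl; rewrite big_split /= eR // fR // addr0.
Qed.

Let radicalN e : radical S e -> radical S (- e).
Proof.
move=> [se eR]; split=> [s sS|s sS]; first by rewrite ffunE se // oppr0.
by under eq_bigr do rewrite ffunE mulNr; rewrite sumrN eR // oppr0.
Qed.

Let radical_phi a : radical S (phi a).
Proof.
have [bR _ _] := lb.
apply: (big_ind (radical S)); [exact: radical0|exact: radicalD|move=> k _].
have Rn N : radical S (bs k *+ N).
  by elim: N => [|N IH]; [exact: radical0|rewrite mulrS; exact: radicalD].
case: (a k) => N; first by rewrite -pmulrn; exact: Rn.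
by rewrite NegzE mulrNz; apply: radicalN; rewrite -pmulrn; exact: Rn.
Qed.

Let phi_inj : injective phi.
Proof.
move=> a b E; have [_ _ bi] := lb.
suff : a - b = 0 by move/eqP; rewrite subr_eq0 => /eqP.
apply: bi; under eq_bigr do rewrite !ffunE mulrzBr.
by rewrite sumrB -/(phi a) -/(phi b) E subrr.
Qed.

Let M_central e x : radical S e -> M e * x = x * M e.
Proof.
move=> eR; have MU j : M e * U j = U j * M e.
  by rewrite (mon_u q_neq0 UV VU UU) wform_radical // expr0z scale1r.
have MV j : M e * V j = V j * M e.
  by rewrite -[LHS]mul1r -(VU j) -(mulrA (V j)) (mulrA (U j)) -MU -!mulrA UV mulr1.
apply/esym; apply: (UVgen (centralizer_subalgebra (M e))).
by case=> s [] /=; [rewrite MU|rewrite MV].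
Qed.

(** Each variable goes to the monomial of a basis vector of the radical, which is central; [pm]
    absorbs the scalars from reordering. *)
Let center_embedding : exists psi : {lrmorphism L -> A}, forall a, pm (psi (zmon K a)) (phi a).
Proof.
have [bR _ _] := lb.
have /choice[y yP] k : exists y, M (bs k) * y = 1 /\ pm y (- bs k).
  have [c c0 E] := monV q_neq0 UV VU UU (bs k); exists (c^-1 *: M (- bs k)); split.
    by rewrite -scalerAr E scalerA mulVf // scale1r.
  by exists c^-1; rewrite ?invr_eq0.
have [|||psi psiE] := @laurent_universal K d A (fun k => M (bs k)) y.
- by move=> k; case: (yP k).
- by move=> k; rewrite -M_central //; case: (yP k).
- by move=> k l; exact: M_central.
exists psi => a; rewrite /zmon /mon /phi.
elim: (index_enum _) => [|k r IH]; first by rewrite !big_nil rmorph1.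
rewrite !big_cons rmorphM /=; apply: pmM => //; rewrite ipow_morph.
have [-> ->] := psiE k; have [_ ypm] := yP k.
case: (a k) => N /=; first by rewrite -pmulrn; apply: pmX; exists 1; rewrite ?oner_neq0 // scale1r.
by rewrite NegzE mulrNz -pmulrn -mulNrn; exact: pmX.
Qed.

Lemma qclass0_spec_equiv : spec_equiv (str0 act) [set P : set L | prime_ideal P].
Proof.
have [psi psiM] := center_embedding; have [_ bsp _] := lb.
have psi_onto e : radical S e -> exists y, psi y = M e.
  move=> /bsp[a ->]; have [c c0 E] := psiM a; exists (c^-1 *: zmon K a).
  by rewrite linearZ /= E scalerA mulVf // scale1r.
(* Applying [separate] to the zero ideal shows that the monomials are linearly independent. *)
have psi_inj y : psi y = 0 -> y = 0.
  have [c [r ur ->]] := zmon_span y; move=> E; rewrite big_seq; apply: big1 => a ar.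
  have /choice[k kP] a' : exists k : K, k != 0 /\ psi (zmon K a') = k *: M (phi a').
    by have [k k0 E'] := psiM a'; exists k.
  have E0 : \sum_(a <- r) (c a * k a) *: M (phi a) = 0.
    rewrite -[RHS]E rmorph_sum; apply: eq_bigr => a' _.
    by rewrite /= linearZ /= (kP a').2 scalerA.
  have := separate (ex := phi) (c := fun a => c a * k a) (zero_ideal A) zero_stable ur _ _ E0 ar.
  move=> /(_ (fun a _ => (radical_phi a).1) (fun a b _ _ H => phi_inj H)) /eqP.
  rewrite scaler_eq0 mulf_eq0 (negPf (kP a).1) orbF => /orP[/eqP->|/eqP M0].
    by rewrite scale0r.
  have [d' d0 E'] := monV q_neq0 UV VU UU (phi a); move: E'; rewrite M0 mul0r => /esym/eqP.
  by rewrite scaler_eq0 (negPf d0) (negPf (oner_neq0 A)).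
have psiC y x : psi y * x = x * psi y.
  have [c [r _ ->]] := zmon_span y; rewrite rmorph_sum mulr_suml mulr_sumr.
  apply: eq_bigr => a _; rewrite /= linearZ /=; have [k _ ->] := psiM a.
  by rewrite -!scalerAl -!scalerAr M_central.
pose e (Q : set L) := ideal_gen (psi @` Q).
pose c (P : set A) : set L := [set y | P (psi y)].
have e_ideal Q : ideal (e Q) := ideal_gen_ideal _.
have c_ideal P : ideal P -> ideal (c P).
  move=> idP; split; rewrite /c /=; first by rewrite rmorph0; exact: ideal0.
  - by move=> a b Pa Pb; rewrite rmorphD; exact: idealD.
  - by move=> a b Pb; rewrite rmorphM; exact: idealMl.
  - by move=> a b Pb; rewrite rmorphM; exact: idealMr.
have e_min Q P : ideal P -> Q `<=` c P -> e Q `<=` P.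
  by move=> idP QP x; apply; split=> // _ [y Qy <-]; exact: QP.
have ce Q : Q `<=` c (e Q) by move=> y Qy; apply: sub_ideal_gen; exists y.
(* The terms with the conjugation eigenvalues of the first one have a sum in [P]; multiplied by the
   inverse of the first monomial, this sum becomes central and comes from [c P]. The remaining sum
   is shorter. *)
have ec P : ideal P -> P `<=` e (c P).
  move=> idP x; have [l [sl ->]] := Mspan x.
  have [N] := ubnP (size l); elim: N l sl => // N IH [|t0 l] sl sN Px.
    by rewrite big_nil; exact: (ideal0 (e_ideal _)).
  pose sim (t : K * expo) := `[< forall j, q ^ (wform w t.2 j) = q ^ (wform w t0.2 j) >].
  have Psim : P (\sum_(t <- t0 :: l | sim t) t.1 *: M t.2).
    apply: (@eigen_separation K A P _ _ box conj conj_linear _ _ (fun t => t.1 *: M t.2)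
      (fun j t => q ^ (wform w t.2 j)) _ (t0 :: l) t0 Px).
    - by move=> u v; exact: idealD.
    - by move=> k u; exact: idealZ.
    - by move=> j u; exact: conj_ideal.
    - by move=> j t; rewrite /conj -scalerAr -scalerAl -/(conj _ _) conjM !scalerA mulrC.
  have st0 : supp t0.2 by apply: sl; rewrite inE eqxx.
  have esim : e (c P) (\sum_(t <- t0 :: l | sim t) t.1 *: M t.2).
    have [k k0 Ek] := monV q_neq0 UV VU UU t0.2.
    have [y Ey] : exists y, psi y = (\sum_(t <- t0 :: l | sim t) t.1 *: M t.2) * M (- t0.2).
      rewrite mulr_suml big_seq_cond.
      apply: (big_ind (fun x => exists y, psi y = x)).
      + by exists 0; rewrite rmorph0.
      + by move=> _ _ [y <-] [y' <-]; exists (y + y'); rewrite rmorphD.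
      move=> t /andP[tl /asboolP simt].
      have [y Ey] := psi_onto _ (radical_of_wform (sl t tl) st0 simt).
      have [k' _ Ek'] := monM q_neq0 UV VU UU t.2 (- t0.2).
      by exists ((t.1 * k') *: y); rewrite linearZ /= Ey -scalerAl Ek' scalerA.
    have cy : c P y by rewrite /c /= Ey; exact: idealMr.
    have [k2 k20 Ek2] : exists2 k2 : K, k2 != 0 & M (- t0.2) * M t0.2 = k2%:A.
      by have [k2 k20 E2] := monV q_neq0 UV VU UU (- t0.2); rewrite opprK in E2; exists k2.
    apply: (idealZE (e_ideal _) k20); rewrite -mulr_algr -Ek2 mulrA -Ey.
    exact: (idealMr _ (e_ideal _) (ce _ _ cy)).
  rewrite (bigID sim) /=; apply: (idealD (e_ideal _)) => //.
  rewrite -big_filter; apply: IH.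
  - by move=> t; rewrite mem_filter => /andP[_ /sl].
  - rewrite /= (_ : sim t0 = true) /=; last by apply/asboolP.
    by rewrite size_filter; rewrite ltnS in sN; exact: leq_ltn_trans (count_size _ _) sN.
  - rewrite big_filter; have := idealB idP Px Psim.
    by rewrite [X in P (X - _)](bigID sim) /= addrAC subrr add0r.
have eP Q x : ideal Q -> e Q x -> exists l : seq (L * expo),
    (forall t, t \in l -> Q t.1 /\ supp t.2) /\ x = \sum_(t <- l) psi t.1 * M t.2.
  move=> idQ /ideal_genP[l [lQ ->]]; elim: l lQ => [|t l IH] lQ.
    by exists [::]; rewrite !big_nil.
  have [r [rQ E]] : exists l0 : seq (L * expo), (forall t, t \in l0 -> Q t.1 /\ supp t.2) /\
      \sum_(t <- l) t.1.1 * t.1.2 * t.2 = \sum_(t <- l0) psi t.1 * M t.2.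
    by apply: IH => t' tl; apply: lQ; rewrite inE tl orbT.
  have [y Qy yE] := lQ t (mem_head _ _).
  have [l' [sl' E']] := Mspan (t.1.1 * t.2).
  exists ([seq (s.1 *: y, s.2) | s <- l'] ++ r); split.
    move=> s; rewrite mem_cat => /orP[/mapP[s' /sl' ss' ->]|/rQ//].
    by split=> //; exact: idealZ.
  rewrite big_cons big_cat E big_map /=; congr (_ + _).
  rewrite -yE -psiC -mulrA E' mulr_sumr; apply: eq_bigr => s _.
  by rewrite linearZ /= -scalerAl -scalerAr.
have ceQ Q : ideal Q -> c (e Q) `<=` Q.
  move=> idQ y /(eP _ _ idQ)[l [lQ E]].
  (* With [y] placed at exponent 0, the component fixed by all conjugations involves radical
     exponents only and lies in the image of [psi]; injectivity then expresses [y] through elements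
     of [Q]. *)
  have suml : \sum_(t <- (- y, 0) :: l) psi t.1 * M t.2 = 0.
    by rewrite big_cons -E mon0 mulr1 rmorphN addNr.
  pose sim (t : L * expo) := `[< forall j, q ^ (wform w t.2 j) = q ^ (wform w 0 j) >].
  have : [set 0] (\sum_(t <- (- y, 0) :: l | sim t) psi t.1 * M t.2).
    apply: (@eigen_separation K A [set 0] _ _ box conj conj_linear _ _
      (fun t : L * expo => psi t.1 * M t.2)
      (fun j t => q ^ (wform w t.2 j)) _ ((- y, 0) :: l) (- y, 0) suml).
    - by move=> u v -> ->; rewrite /= addr0.
    - by move=> k u ->; rewrite /= scaler0.
    - by move=> j u ->; rewrite /conj /= mulr0 mul0r.
    - by move=> j t; rewrite scalerAr -conjM /conj (mulrA (V j)) -psiC -!mulrA.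
  have supp0 : supp 0 by move=> s _; rewrite ffunE.
  have /choice[h hP] (f : expo) : exists z : L, radical S f -> psi z = M f.
    have [fR|nf] := pselect (radical S f); last by exists 0.
    by have [z Ez] := psi_onto f fR; exists z.
  have lsupp t : t \in (- y, 0) :: l -> sim t -> radical S t.2.
    move=> tl /asboolP H; rewrite -[t.2]subr0; apply: radical_of_wform => //.
    by move: tl; rewrite inE => /orP[/eqP->//|/lQ[]].
  have -> : \sum_(t <- (- y, 0) :: l | sim t) psi t.1 * M t.2 =
      psi (\sum_(t <- (- y, 0) :: l | sim t) t.1 * h t.2).
    rewrite rmorph_sum big_seq_cond [RHS]big_seq_cond; apply: eq_bigr => t /andP[tl st].
    by rewrite /= rmorphM /= hP //; exact: lsupp.
  move=> /psi_inj; rewrite big_cons (_ : sim (- y, 0) = true); last by apply/asboolP.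
  have h0 : h 0 = 1.
    apply/eqP; rewrite -subr_eq0; apply/eqP; apply: psi_inj.
    by rewrite rmorphB rmorph1 /= hP ?mon0 ?subrr //; exact: radical0.
  rewrite /= h0 mulr1 addrC => /eqP; rewrite subr_eq0 => /eqP <-.
  rewrite big_seq_cond; apply: ideal_sum => // t /andP[/lQ[Qt _] _].
  exact: idealMr.
(* Composites of the action are again given by elements of [G], so the elements all of whose
   translates lie in a given ideal form a stable set. *)
have act_mul g h : exists gh, forall x, act g (act h x) = act gh x.
  have [gh ghE] := chi_mul g h; exists gh => x.
  have aU f s : act f (U s) = (if s \in S then chi f s else 1) *: U s.
    by rewrite /U; case: ifP => _; [exact: (qc_act qc)|rewrite rmorph1 scale1r].
  have aV f s : act f (V s) = (if s \in S then chi f s else 1)^-1 *: V s.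
    set k := (if _ then _ else _); have k0 : k != 0 by rewrite /k; case: ifP; rewrite ?oner_neq0.
    have E : act f (V s) * act f (U s) = 1 by rewrite -rmorphM VU rmorph1.
    rewrite -[LHS]mulr1 -(UV s) mulrA.
    have -> : act f (V s) * U s = k^-1 *: 1.
      by rewrite -E aU -scalerAr scalerA mulVf // scale1r.
    by rewrite -scalerAl mul1r.
  apply: (generated_eq (f := act g \o act h) (g := act gh) UVgen); case=> s [] /=.
    rewrite (aU h) (aU gh) linearZ /= (aU g) ghE; case: ifP => _; first by rewrite scalerA mulrC.
    by rewrite !scale1r.
  rewrite (aV h) (aV gh) linearZ /= (aV g) ghE; case: ifP => _.
    by rewrite scalerA -invfM mulrC.
  by rewrite !invr1 !scale1r.
have cprime P : prime_ideal P -> prime_ideal (c P).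
  move=> /prime_idealP[idP nT PP]; apply/prime_idealP; split; first exact: c_ideal.
    by rewrite /c /= rmorph1.
  move=> I J idI idJ IJ.
  have [|IP|JP] := PP _ _ (e_ideal I) (e_ideal J).
  - move=> x y /(eP _ _ idI)[l [lI ->]] /(eP _ _ idJ)[r [rJ ->]].
    rewrite mulr_suml big_seq; apply: ideal_sum => // t /lI[It _].
    rewrite mulr_sumr big_seq; apply: ideal_sum => // s /rJ[Js _].
    rewrite mulrA -(mulrA (psi t.1)) -psiC mulrA -rmorphM -mulrA.
    by apply: idealMr => //; exact: IJ.
  - by left=> y Iy; apply: IP; exact: ce.
  - by right=> y Jy; apply: JP; exact: ce.
have eprime Q : prime_ideal Q -> prime_ideal (e Q).
  move=> /prime_idealP[idQ nT QQ]; apply/prime_idealP; split; first exact: e_ideal.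
    by move=> e1; apply: nT; apply: (ceQ _ idQ); rewrite /c /= rmorph1.
  move=> I J idI idJ IJ.
  have [|IQ|JQ] := QQ _ _ (c_ideal _ idI) (c_ideal _ idJ).
  - by move=> x y Ix Jy; apply: (ceQ _ idQ); rewrite /c /= rmorphM; exact: IJ.
  - left; apply: subset_trans (ec _ idI) _; apply: e_min; first exact: e_ideal.
    by move=> y /IQ; exact: ce.
  - right; apply: subset_trans (ec _ idJ) _; apply: e_min; first exact: e_ideal.
    by move=> y /JQ; exact: ce.
apply: spec_equiv_sym; apply: (@spec_equiv_galois _ _ _ _ e c) => //.
- by move=> I J IJ; apply: e_min; [exact: e_ideal|move=> y /IJ; exact: ce].
- by move=> I J IJ y; exact: IJ.
- move=> Q pQ; have /prime_idealP[idQ _ _] := pQ; split=> //; last exact: ceQ.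
  have peQ := eprime _ pQ; split=> //; have /prime_idealP[_ n1 _] := peQ.
  (* The core of the extended prime is a stable proper ideal of the quantum torus, hence zero. *)
  move=> x; apply: (@torus_simple [set x | forall g, e Q (act g x)]).
  + split.
    * by move=> g; rewrite rmorph0; exact: (ideal0 (e_ideal Q)).
    * by move=> u v Wu Wv g; rewrite rmorphD; exact: (idealD (e_ideal Q) (Wu g) (Wv g)).
    * by move=> u v Wv g; rewrite rmorphM; exact: (idealMl _ (e_ideal Q) (Wv g)).
    * by move=> u v Wv g; rewrite rmorphM; exact: (idealMr _ (e_ideal Q) (Wv g)).
  + by move=> h u Wu g; have [gh ->] := act_mul g h; exact: Wu.
  + by move=> /(_ g0); rewrite rmorph1.
- move=> P [pP _]; have /prime_idealP[idP _ _] := pP; split=> //; first exact: cprime.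
  by apply: e_min.
Qed.

End QuantumTorus.

(** * Topological consequences *)

Lemma spec_eq (R : nzRingType) (P Q : spec R) : (P : set R) = Q -> P = Q.
Proof.
by case: P Q => [P pP] [Q pQ] /= E; subst Q; congr Spec; exact: Prop_irrelevance.
Qed.

Lemma homeomorphic_sym (T U : topologicalType) : homeomorphic T U -> homeomorphic U T.
Proof. by move=> [f [g [cf cg fg gf]]]; exists g, f. Qed.

Lemma homeomorphic_trans (T U V : topologicalType) :
  homeomorphic T U -> homeomorphic U V -> homeomorphic T V.
Proof.
move=> [f [g [cf cg fg gf]]] [f' [g' [cf' cg' fg' gf']]]; exists (f' \o f), (g \o g'); split.
- by move=> x; apply: continuous_comp; [exact: cf|exact: cf'].
- by move=> x; apply: continuous_comp; [exact: cg'|exact: cg].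
- by move=> x /=; rewrite fg' fg.
- by move=> x /=; rewrite gf gf'.
Qed.

Lemma spec_openE (R : nzRingType) (U : set (spec R)) :
  open U <-> exists2 I : set R, ideal I & U = [set P : spec R | ~ (I `<=` P)].
Proof. by []. Qed.

Lemma spec_equiv_homeomorphic (A B : nzRingType) (T : set (spec A)) (X : set (set A)) :
  (forall P : spec A, T P <-> X P) -> (forall P, X P -> prime_ideal P) ->
  spec_equiv X [set Q : set B | prime_ideal Q] -> homeomorphic T (spec B).
Proof.
move=> TX Xp [F [H [FX HY FI HI]]].
have Tx (p : T) : X (set_val p) by apply/TX; exact: set_valP.
pose f (p : T) : spec B := Spec (FX _ (Tx p)).1.
have gT (Q : spec B) : Spec (Xp _ (HY _ (spec_prime Q)).1) \in T.
  by apply/mem_set/TX; exact: (HY _ (spec_prime Q)).1.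
pose g (Q : spec B) : T := SigSub (gT Q).
exists f, g; split.
- apply/continuousP => U /spec_openE[I idI ->].
  have [J idJ JE] := HI _ idI.
  exists [set P : spec A | ~ (J `<=` P)]; first by apply/spec_openE; exists J.
  by apply/seteqP; split=> p /=; rewrite (JE _ (Tx p)).
- apply/continuousP => _ [U /spec_openE[I idI ->] <-].
  have [J idJ JE] := FI _ idI.
  apply/spec_openE; exists J => //; apply/seteqP; split=> Q /=;
    by rewrite JE ?(HY _ (spec_prime Q)).2 //; exact: (HY _ (spec_prime Q)).1.
- by move=> p; apply: val_inj; apply: spec_eq; exact: (FX _ (Tx p)).2.
- by move=> Q; apply: spec_eq; exact: (HY _ (spec_prime Q)).2.
Qed.

(** * The Krull dimension of Laurent polynomial algebras *)

(** Inclusion of primes is the specialization order of the topology, so homeomorphisms preserve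
    chains of primes. *)
Lemma spec_sub_open (R : nzRingType) (P Q : spec R) :
  (P : set R) `<=` Q <-> forall U : set (spec R), open U -> U Q -> U P.
Proof.
split=> [PQ U /spec_openE[I _ ->] /= IQ IP|H].
  by apply: IQ; exact: subset_trans PQ.
apply: contrapT => nPQ; have idP : ideal P by case: (spec_prime P).
by have := H [set P' : spec R | ~ ((P : set R) `<=` P')]; apply=> //; apply/spec_openE; exists P.
Qed.

Definition spec_chain (R : nzRingType) (l : nat) (c : nat -> spec R) : Prop :=
  forall i, (i < l)%N -> (c i : set R) `<=` c i.+1 /\ c i <> c i.+1.

Lemma homeomorphic_chain (R R' : nzRingType) l (c : nat -> spec R) :
  homeomorphic (spec R) (spec R') -> spec_chain l c -> exists c', @spec_chain R' l c'.
Proof.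
move=> [f [g [cf _ fg _]]] ch; exists (f \o c) => i /ch[s ne]; split=> /=.
  apply/spec_sub_open => U oU; move/continuousP: cf => /(_ U oU) ofU.
  by have /spec_sub_open/(_ _ ofU) := s.
by move=> /(can_inj fg).
Qed.

Section LaurentDimension.
Variables (K : fieldType) (d : nat).
Local Notation L := (laurent K d).
Local Notation expo := {ffun 'I_d -> int}.

Let prime_mul (P : set L) x y : prime_ideal P -> P (x * y) -> P x \/ P y.
Proof.
move=> /prime_idealP[idP nT PP] Pxy.
have idg (z : L) : ideal [set a | exists b, a = b * z].
  split=> /=; first by exists 0; rewrite mul0r.
  - by move=> _ _ [a ->] [b ->]; exists (a + b); rewrite mulrDl.
  - by move=> a _ [b ->]; exists (a * b); rewrite mulrA.
  - by move=> a _ [b ->]; exists (b * a); rewrite -!mulrA; congr (_ * _); exact: laurentC.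
have [|H|H] := PP _ _ (idg x) (idg y).
- move=> _ _ [a ->] [b ->]; rewrite (_ : a * x * (b * y) = a * b * (x * y)).
    exact: idealMl.
  by rewrite -!mulrA; congr (_ * _); rewrite !mulrA (laurentC x).
- by left; apply: H; exists 1; rewrite mul1r.
- by right; apply: H; exists 1; rewrite mul1r.
Qed.

Let prime_mulX (P : set L) x y k : prime_ideal P -> ~ P x -> P (x ^+ k * y) -> P y.
Proof.
move=> pP nx; elim: k => [|k IH]; first by rewrite mul1r.
by rewrite exprS -mulrA => /(prime_mul pP)[].
Qed.

Section AlgebraicDependence.
Variable N : nat.

(** Exponent vectors bounded by [N], as nested pairs so that the exponent of the first element
    splits off in the induction. *)
Fixpoint mexp (l : nat) : finType := if l is l'.+1 then ('I_N.+1 * mexp l')%type else unit.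

Fixpoint mexp_eval (l : nat) (x : nat -> L) : mexp l -> L :=
  if l is l'.+1 then fun e => x 0%N ^+ e.1 * @mexp_eval l' (fun i => x i.+1) e.2
  else fun=> 1.

Lemma card_mexp l : #|mexp l| = (N.+1 ^ l)%N.
Proof. by elim: l => [|l IH]; rewrite /= ?card_unit // card_prod card_ord IH expnS. Qed.

(* Coquand and Lombardi: dividing a polynomial relation between the [x i] by the
   least power of [x 0] that occurs in it moves the relation one step up the chain. *)
Lemma chain_independent l (P : nat -> set L) (x : nat -> L) (c : mexp l -> K) :
  (forall i, (i <= l)%N -> prime_ideal (P i)) ->
  (forall i, (i < l)%N -> P i `<=` P i.+1 /\ P i.+1 (x i) /\ ~ P i (x i)) ->
  P 0%N (\sum_e c e *: mexp_eval x e) -> forall e, c e = 0.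
Proof.
elim: l P x c => [|l IH] P x c pP cP PE e.
  have /prime_idealP[idP n1 _] := pP 0%N isT.
  apply: contrapT => /eqP c0; apply: n1; apply: (idealZE idP (k := c tt)); first by case: e c0.
  by move: PE; rewrite (big_pred1 tt) //; case.
apply: contrapT => /eqP ce.
pose Q (j : 'I_N.+1) := [exists e', c (j, e') != 0].
have Qe : Q e.1 by apply/existsP; exists e.2; rewrite -surjective_pairing.
pose j0 := [arg min_(j < e.1 | Q j) (j : nat)].
have [Qj0 minj0] : Q j0 /\ forall j, Q j -> (j0 <= j)%N.
  by rewrite /j0; case: arg_minnP.
have pP0 := pP 0%N isT; have [s01 [x1 nx0]] := cP 0%N isT.
have id1 : ideal (P 1%N) by have [] := (prime_idealP _).1 (pP 1%N isT).
pose x' i := x i.+1.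
pose q (j : 'I_N.+1) := \sum_e' c (j, e') *: mexp_eval x' e'.
(* Powers below [j0] have zero coefficients. Once [x 0 ^+ j0], which is outside [P 0], is cancelled,
   all terms but [q j0] are multiples of [x 0] and so lie in [P 1]. *)
have E : \sum_e c e *: mexp_eval x e = x 0%N ^+ j0 * (q j0 +
    x 0%N * \sum_(j < N.+1 | (j0 < j)%N) x 0%N ^+ (j - j0).-1 * q j).
  rewrite (eq_bigr (fun e : 'I_N.+1 * mexp l =>
      x 0%N ^+ e.1 * (c (e.1, e.2) *: mexp_eval x' e.2))); last first.
    by case=> j e' _ /=; rewrite scalerAr.
  rewrite -(pair_bigA _ (fun (j : 'I_N.+1) (e' : mexp l) =>
      x 0%N ^+ j * (c (j, e') *: mexp_eval x' e'))) /=.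
  rewrite (eq_bigr (fun j : 'I_N.+1 => x 0%N ^+ j * q j)); last by move=> j _; rewrite -mulr_sumr.
  rewrite (bigD1 j0) //= mulrDr; congr (_ + _).
  rewrite mulr_sumr mulr_sumr [RHS]big_mkcond [LHS]big_mkcond; apply: eq_bigr => j _.
  case: ltnP => [lt|le].
    rewrite ifT; last by rewrite neq_ltn lt orbT.
    by rewrite !mulrA -exprSr -exprD; congr (_ ^+ _ * _); lia.
  case: eqP => //= /eqP ne; have lt : (j < j0)%N by rewrite ltn_neqAle le andbT.
  suff -> : q j = 0 by rewrite mulr0.
  apply: big1 => e' _; have [->|ce'] := eqVneq (c (j, e')) 0; first by rewrite scale0r.
  have : Q j by apply/existsP; exists e'.
  by move=> /minj0; rewrite leqNgt lt.
move: PE; rewrite E => /(prime_mulX pP0 nx0)/s01 Pq.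
have {}Pq : P 1%N (q j0).
  set r := x 0%N * _ in Pq; rewrite (_ : q j0 = (q j0 + r) - r); last by rewrite addrK.
  by apply: idealB => //; exact: idealMr.
have := IH (fun i => P i.+1) x' (fun e' => c (j0, e')) (fun i il => pP i.+1 il)
  (fun i il => cP i.+1 il) Pq.
by move=> c0; have /existsP[e'] := Qj0; rewrite c0 eqxx.
Qed.

End AlgebraicDependence.

Definition bounded (b : nat) (x : L) : Prop := exists l : seq (K * expo),
  (forall t, t \in l -> forall k, (`|t.2 k| <= b)%N) /\ x = \sum_(t <- l) t.1 *: zmon K t.2.

Let bounded_ex x : exists b, bounded b x.
Proof.
have [c [r _ ->]] := zmon_span x.
exists (\sum_(e <- r) \sum_k `|e k|)%N, [seq (c e, e) | e <- r]; split.
  move=> _ /mapP[e er ->] k /=; rewrite (big_rem e er) /= (bigD1 k) //= -addnA.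
  exact: leq_addr.
by rewrite big_map.
Qed.

Let bounded_mono b b' x : (b <= b')%N -> bounded b x -> bounded b' x.
Proof.
by move=> bb [l [lb ->]]; exists l; split=> // t /lb tb k; exact: leq_trans (tb k) bb.
Qed.

Let boundedM b b' x y : bounded b x -> bounded b' y -> bounded (b + b') (x * y).
Proof.
move=> [l [lb ->]] [r [rb ->]].
have /choice[k kP] (p : expo * expo) : exists k, zmon K p.1 * zmon K p.2 = k *: zmon K (p.1 + p.2).
  by have [k _ E] := zmonM K p.1 p.2; exists k.
have {}kP e f : zmon K e * zmon K f = k (e, f) *: zmon K (e + f) := kP (e, f).
exists [seq (t.1 * s.1 * k (t.2, s.2), t.2 + s.2) | t <- l, s <- r]; split.
  move=> _ /allpairsP[[t s] /= [tl sr ->]] i /=; rewrite ffunE.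
  move: (t.2 i) (s.2 i) (lb t tl i) (rb s sr i) => u v ub vb; lia.
rewrite big_allpairs_dep mulr_suml; apply: eq_bigr => t _; rewrite mulr_sumr.
by apply: eq_bigr => s _; rewrite -scalerAl -scalerAr kP !scalerA.
Qed.

Let bounded1 : bounded 0 1.
Proof.
exists [:: (1, 0)]; rewrite big_seq1 scale1r /zmon mon0; split=> // t.
by rewrite inE => /eqP -> k; rewrite ffunE.
Qed.

Let boundedX b x k : bounded b x -> bounded (k * b) (x ^+ k).
Proof.
by move=> bx; elim: k => [|k IH]; [rewrite mul0n|rewrite exprS mulSn; exact: boundedM].
Qed.

Let bounded_mexp N b l x (e : mexp N l) : (forall i, bounded b (x i)) ->
  bounded (l * (N * b)) (mexp_eval x e).
Proof.
elim: l x e => [|l IH] x e xb //=; rewrite mulSn; apply: boundedM; last by apply: IH.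
apply: bounded_mono (boundedX _ (xb 0%N)); rewrite leq_mul2r -ltnS ltn_ord orbT //.
Qed.

Let bounded_coef b x : bounded b x -> exists v : {ffun 'I_d -> 'I_(2 * b).+1} -> K,
  x = \sum_a v a *: zmon K [ffun k => (a k)%:Z - b%:Z].
Proof.
move=> [l [lb ->]]; elim: l lb => [|t l IH] lb.
  by exists (fun=> 0); rewrite big_nil big1 // => a _; rewrite scale0r.
have [v Ev] : exists v : {ffun 'I_d -> 'I_(2 * b).+1} -> K,
    \sum_(t <- l) t.1 *: zmon K t.2 = \sum_a v a *: zmon K [ffun k => (a k)%:Z - b%:Z].
  by apply: IH => s sl; apply: lb; rewrite inE sl orbT.
have tb := lb t (mem_head _ _).
pose a0 : {ffun 'I_d -> 'I_(2 * b).+1} := [ffun k => inord (absz (t.2 k + b%:Z))].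
exists (fun a => v a + t.1 * (a == a0)%:R); rewrite big_cons Ev addrC.
under [RHS]eq_bigr do rewrite scalerDl.
rewrite big_split /=; congr (_ + _); rewrite (bigD1 a0) //= eqxx mulr1 big1 ?addr0.
  congr (_ *: zmon K _); apply/ffunP => k; rewrite !ffunE; move: (t.2 k) (tb k) => z zb.
  by rewrite inordK; lia.
by move=> a /negPf ->; rewrite mulr0 scale0r.
Qed.

(** By counting: the monomials of bounded degree in [d + 1] elements picked along a longer chain
    outnumber the Laurent monomials in [d] variables that can occur in them. The resulting linear
    relation contradicts [chain_independent]. *)
Lemma laurent_chain_le l (c : nat -> spec L) : spec_chain l c -> (l <= d)%N.
Proof.
move=> ch; rewrite leqNgt; apply/negP => dl.
have {}ch : spec_chain d.+1 c by move=> i id; apply: ch; exact: leq_trans id dl.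
have /choice[x xP] i : exists x, (i < d.+1)%N -> (c i.+1 : set L) x /\ ~ (c i : set L) x.
  have [id|_] := boolP (i < d.+1)%N; last by exists 0.
  have [s ne] := ch i id.
  have : ~ (c i.+1 : set L) `<=` c i by move=> s'; apply: ne; apply: spec_eq; apply/seteqP.
  by move=> /existsNP[x /not_implyP]; exists x.
have /choice[b bP] i := bounded_ex (x i).
pose y i := if (i < d.+1)%N then x i else 0.
pose D := (\sum_(i < d.+1) b i)%N.
have yD i : bounded D (y i).
  rewrite /y; case: ifP => id; last by exists [::]; rewrite big_nil.
  by apply: bounded_mono (bP i); rewrite /D (bigD1 (Ordinal id)) //=; exact: leq_addr.
(* With this value [(2 B + 1)^d] is at most [N (N + 1)^d], which is less than [(N + 1)^(d + 1)]. *)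
pose N := ((2 * (d.+1 * D)).+1 ^ d)%N.
pose B := (d.+1 * (N * D))%N.
have /choice[v vE] (e : mexp N d.+1) := bounded_coef (bounded_mexp e yD).
pose J := {ffun 'I_d -> 'I_(2 * B).+1}.
pose MM : 'M[K]_(#|mexp N d.+1|, #|J|) := \matrix_(e, a) v (enum_val e) (enum_val a).
have lt : (#|J| < #|mexp N d.+1|)%N.
  rewrite card_ffun !card_ord card_mexp expnS.
  apply: (@leq_ltn_trans (((2 * (d.+1 * D)).+1 * N.+1) ^ d)).
    have e2 a b' k : (a <= b' -> a ^ k <= b' ^ k)%N.
      by move=> ab; elim: k => // k IH; rewrite !expnS leq_mul.
    by apply: e2; rewrite /B; nia.
  by rewrite expnMn -/N ltn_mul2r expn_gt0 /= ltnSn.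
have k0 : kermx MM != 0.
  rewrite -mxrank_eq0 mxrank_ker subn_eq0 -ltnNge.
  by apply: leq_ltn_trans lt; exact: rank_leq_col.
have u0 : nz_row (kermx MM) != 0 by rewrite nz_row_eq0.
have uM : nz_row (kermx MM) *m MM = 0 by apply/sub_kermxP; exact: nz_row_sub.
set u := nz_row _ in u0 uM.
pose cc (e : mexp N d.+1) := u 0 (enum_rank e).
have cc0 : forall e, cc e = 0.
  apply: (@chain_independent N d.+1 (fun i => c i : set L) y).
  - by move=> i _; exact: spec_prime.
  - by move=> i id; have [s _] := ch i id; rewrite /y id; have [] := xP i id.
  rewrite (_ : \sum_e _ = 0); first by apply: ideal0; case: (spec_prime (c 0%N)).
  under eq_bigr do rewrite vE scaler_sumr.
  rewrite exchange_big big1 // => a _; under eq_bigr do rewrite scalerA.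
  rewrite -scaler_suml (_ : \sum_e _ = 0) ?scale0r //.
  have := congr1 (fun X : 'rV_#|J| => X 0 (enum_rank a)) uM; rewrite mxE [RHS]mxE => E0.
  rewrite -[RHS]E0.
  rewrite (reindex (@enum_val _ (mexp N d.+1))) /=; last exact: onW_bij (enum_val_bij _).
  by apply: eq_bigr => e _; rewrite mxE !enum_rankK /cc enum_valK.
case/eqP: u0; apply/rowP => e; rewrite [RHS]mxE.
by have := cc0 (enum_val e); rewrite /cc enum_valK.
Qed.

End LaurentDimension.

(** It suffices to be nonzero on the finitely many nonzero differences. This provides a total order
    on the exponents at hand that is compatible with addition. *)
Lemma linear_functional_inj (d : nat) (D : seq {ffun 'I_d -> int}) :
  exists u : 'I_d -> int, {in D &, injective (fun e : {ffun 'I_d -> int} => \sum_i u i * e i)}.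
Proof.
suff H (V : seq {ffun 'I_d -> int}) : (forall v, v \in V -> v != 0) ->
    exists u : 'I_d -> int, forall v, v \in V -> \sum_i u i * v i != 0.
  have [|u uP] := H [seq v <- [seq a - b | a <- D, b <- D] | v != 0].
    by move=> v; rewrite mem_filter => /andP[].
  exists u => a b aD bD /= E; apply/eqP; rewrite -subr_eq0; apply: contraT => ab.
  have := uP (a - b); rewrite mem_filter ab => /(_ (allpairs_f _ aD bD)) /eqP; case.
  under eq_bigr do rewrite !ffunE mulrBr.
  by rewrite sumrB E subrr.
elim: V => [_|v V IH H]; first by exists (fun=> 0).
have [|u uP] := IH; first by move=> v' vV; apply: H; rewrite inE vV orbT.
have [uv|uv] := eqVneq (\sum_i u i * v i) 0; last first.
  by exists u => v'; rewrite inE => /orP[/eqP->|/uP].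
have [k vk] : exists k, v k != 0.
  apply: contrapT => nv; have /eqP := H v (mem_head _ _); apply; apply/ffunP => k.
  by rewrite ffunE; apply: contrapT => /eqP vk; apply: nv; exists k.
(* [B] exceeds the [k]-th coordinate of each earlier vector, so scaling [u] by [B] and adding that
   coordinate keeps the earlier values nonzero and repairs the value at [v]. *)
pose B : int := 1 + \sum_(v' <- V) `|v' k|.
exists (fun i => B * u i + (i == k)%:Z) => v'.
have -> : \sum_i (B * u i + (i == k)%:Z) * v' i = B * (\sum_i u i * v' i) + v' k.
  under eq_bigr do rewrite mulrDl -mulrA.
  rewrite big_split /= -mulr_sumr; congr (_ + _).
  by rewrite (bigD1 k) //= eqxx mul1r big1 ?addr0 // => i /negPf ->; rewrite mul0r.
rewrite inE => /orP[/eqP->|v'V]; first by rewrite uv mulr0 add0r.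
have := uP v' v'V; set s := \sum_i _ => s0.
have lt : `|v' k| < B.
  rewrite /B (big_rem v') //=; have : 0 <= \sum_(y <- rem v' V) `|y k|.
    by apply: sumr_ge0.
  by move: (\sum_(y <- _) _) (`|v' k|) => t w; lia.
have : B <= `|B * s|.
  have B0 : 0 <= B by apply: le_trans (ltW lt).
  by rewrite normrM (ger0_norm B0) ler_peMr //; lia.
by move: (B * s) => t; lia.
Qed.

(** * Absence of zero divisors and a chain of maximal length *)

Section LaurentDomain.
Variables (K : fieldType) (d : nat) (q : K).
Hypotheses (q_neq0 : q != 0) (q_not_root1 : forall k : nat, (0 < k)%N -> q ^+ k != 1).
Local Notation L := (laurent K d).
Local Notation expo := {ffun 'I_d -> int}.

Lemma zmon_neq0 e : zmon K e != 0 :> L.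
Proof.
apply/eqP => z0; have [k k0] := zmonM K e (- e); rewrite z0 mul0r subrr /zmon mon0 => /esym/eqP.
by rewrite scaler_eq0 (negPf k0) (negPf (oner_neq0 _)).
Qed.

Let nz_terms (x : L) : x != 0 -> exists (c : expo -> K) (r : seq expo), [/\ uniq r,
  x = \sum_(e <- r) c e *: zmon K e, {in r, forall e, c e != 0} & (0 < size r)%N].
Proof.
move=> x0; have [c [r ur E]] := zmon_span x.
exists c, [seq e <- r | c e != 0]; split; first exact: filter_uniq.
- rewrite big_filter E (bigID (fun e => c e != 0)) /= [X in _ + X]big1 ?addr0 //.
  by move=> e; rewrite negbK => /eqP ->; rewrite scale0r.
- by move=> e; rewrite mem_filter => /andP[].
rewrite lt0n size_eq0; apply: contra x0 => /eqP nr; rewrite E.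
have := filter_all (fun e => c e == 0) r.
rewrite big_seq big1 // => e er; have : e \notin [seq e <- r | c e != 0] by rewrite nr.
by rewrite mem_filter er andbT negbK => /eqP ->; rewrite scale0r.
Qed.

(** Leading terms: for a functional injective on the supports, the exponents [a] and [b] of maximal
    value form the one pair with sum [a + b]. The component of [x * y] at [a + b] is isolated by the
    automorphisms of [laurent_twist], and it is a nonzero multiple of a unit. *)
Lemma laurent_domain (x y : L) : x * y = 0 -> x = 0 \/ y = 0.
Proof.
move=> xy; have [->|x0] := eqVneq x 0; first by left.
have [->|y0] := eqVneq y 0; first by right.
have [c [r [ur Ex cr sr]]] := nz_terms x0; have [c' [r' [ur' Ey cr' sr']]] := nz_terms y0.
have [u uI] := linear_functional_inj (r ++ r').
pose U (e : expo) := \sum_i u i * e i.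
have UD e f : U (e + f) = U e + U f.
  by rewrite /U -big_split; apply: eq_bigr => i _; rewrite ffunE mulrDr.
have maxU (s : seq expo) : (0 < size s)%N -> exists2 e, e \in s & forall f, f \in s -> U f <= U e.
  case: s => // e s _; elim: s e => [|f s IH] e.
    by exists e; rewrite ?mem_head // => f; rewrite inE => /eqP ->.
  have [e' es' Hs] := IH f; have [le|lt] := leP (U e) (U e').
    exists e'; first by rewrite inE es' orbT.
    by move=> g; rewrite inE => /orP[/eqP->|/Hs].
  exists e; first exact: mem_head.
  by move=> g; rewrite inE => /orP[/eqP->//|/Hs le]; exact: le_trans le (ltW lt).
have [a ar amax] := maxU r sr; have [b br bmax] := maxU r' sr'.
have [f fE] := laurent_twist d q_neq0.
pose F (t : expo * expo) : L := (c t.1 * c' t.2) *: (zmon K t.1 * zmon K t.2).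
have xyE : \sum_(t <- [seq (e, e') | e <- r, e' <- r']) F t = 0.
  rewrite big_allpairs_dep -[RHS]xy Ex Ey mulr_suml; apply: eq_bigr => e _.
  by rewrite mulr_sumr; apply: eq_bigr => e' _; rewrite /F -scalerAl -scalerAr scalerA.
have : [set 0] (\sum_(t <- [seq (e, e') | e <- r, e' <- r'] |
    `[< forall i, q ^ (t.1 i + t.2 i) = q ^ (a i + b i) >]) F t).
  apply: (@eigen_separation K L [set 0] _ _ 'I_d f _ _ _ F
    (fun i t => q ^ (t.1 i + t.2 i)) _ _ (a, b) xyE) => /=.
  - by move=> v w -> ->; rewrite addr0.
  - by move=> k w ->; rewrite scaler0.
  - by move=> j k v w; rewrite linearP.
  - by move=> j v ->; rewrite rmorph0.
  - move=> j t; rewrite /F linearZ /= rmorphM /= !fE -scalerAl -scalerAr !scalerA expfzDr //.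
    by congr (_ *: _); ring.
rewrite big_seq_cond (eq_bigl (pred1 (a, b))) => [|[e e'] /=]; last first.
  apply/andP/eqP => [[/allpairsP[[e1 e2] /= [er er' [-> ->]]] /asboolP /= H]|[-> ->]]; last first.
    split; last by apply/asboolP.
    by apply/allpairsP; exists (a, b).
  have E : e1 + e2 = a + b.
    by apply/ffunP => i; rewrite !ffunE; exact: expqz_inj q_neq0 q_not_root1 _ _ (H i).
  have := congr1 U E; rewrite !UD; have := amax _ er; have := bmax _ er' => l1 l2 EU.
  have Ua : U e1 = U a by lia.
  have -> : e1 = a by apply: uI => //; rewrite mem_cat ?er ?ar.
  have Ub : U e2 = U b by lia.
  by have -> : e2 = b by apply: uI => //; rewrite mem_cat ?er' ?br orbT.
rewrite -big_filter filter_pred1_uniq; last 2 first.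
- by apply: allpairs_uniq => // -[e1 e2] [e3 e4] _ _ [-> ->].
- by apply/allpairsP; exists (a, b).
rewrite big_seq1 /F /=; have [k k0 ->] := zmonM K a b.
move=> /eqP; rewrite scalerA scaler_eq0 (negPf (zmon_neq0 _)) orbF !mulf_eq0.
by rewrite (negPf (cr _ ar)) (negPf (cr' _ br)) (negPf k0).
Qed.

Lemma prime_kernel (R : nzRingType) (f : {rmorphism R -> L}) :
  prime_ideal [set x | f x = 0].
Proof.
apply/prime_idealP; split; first exact: ideal_ker.
  by rewrite /= rmorph1; apply/eqP; exact: oner_neq0.
move=> I J idI idJ IJ; apply: contrapT => /not_orP[/existsNP[x /not_implyP[Ix fx]]].
move=> /existsNP[y /not_implyP[Jy fy]].
have := IJ _ _ Ix Jy; rewrite /= rmorphM => /laurent_domain.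
by case.
Qed.

(** The chain consists of the kernels of the endomorphisms setting the first [k] variables to 1. *)
Lemma laurent_chain_ex : exists c, @spec_chain L d c.
Proof.
have /choice[s sP] (k : nat) : exists s : {lrmorphism L -> L},
    forall i, s (zgen K (i, true)) = (if (i < k)%N then 1 else zgen K (i, true)) /\
              s (zgen K (i, false)) = (if (i < k)%N then 1 else zgen K (i, false)).
  apply: (@laurent_universal K d L (fun i => if (i < k)%N then 1 else zgen K (i, true))
    (fun i => if (i < k)%N then 1 else zgen K (i, false))).
  - by move=> i; case: ifP => _; [rewrite mulr1|exact: zgenV].
  - by move=> i; case: ifP => _; [rewrite mulr1|rewrite laurentC; exact: zgenV].
  - by move=> i j; exact: laurentC.
exists (fun k => Spec (prime_kernel (s k))) => k kd; split=> /=.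
  have ss : s k.+1 =1 s k.+1 \o s k.
    apply: (generated_eq (f := s k.+1) (g := s k.+1 \o s k) (@zgen_generated K d)).
    case=> i [] /=; have [E E'] := sP k i; rewrite ?E ?E'; case: ifP => // ik.
      by rewrite rmorph1 (sP k.+1 i).1 ltnW.
    by rewrite rmorph1 (sP k.+1 i).2 ltnW.
  by move=> x /= sx; rewrite ss /= sx rmorph0.
move=> /(congr1 (@spec_ideal _)) /= E.
pose i0 := Ordinal kd.
have : [set x | s k.+1 x = 0] (zgen K (i0, true) - 1).
  by rewrite /= rmorphB rmorph1 /= (sP k.+1 i0).1 /= ltnSn subrr.
rewrite -E /= rmorphB rmorph1 /= (sP k i0).1 /= ltnn => z1.
(* A variable is not 1, since a twist multiplies it by [q] and fixes 1; hence the inclusions are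
   strict. *)
have [f fE] := laurent_twist d q_neq0.
have zE : zgen K (i0, true) = zmon K [ffun j => (j == i0)%:Z * 1].
  by rewrite /zmon mon_single.
have : f i0 (zgen K (i0, true)) = q *: zgen K (i0, true).
  by rewrite {1}zE fE ffunE eqxx mul1r expr1z -zE.
move: z1 => /eqP; rewrite subr_eq0 => /eqP ->; rewrite rmorph1 -[LHS]scale1r => /eqP.
rewrite -subr_eq0 -scalerBl scaler_eq0 (negPf (oner_neq0 _)) orbF subr_eq0.
by rewrite eq_sym -[q]expr1 (negPf (q_not_root1 _)).
Qed.

End LaurentDomain.

Lemma laurent_dim_le (K : fieldType) (q : K) (d d' : nat) :
  q != 0 -> (forall k : nat, (0 < k)%N -> q ^+ k != 1) ->
  homeomorphic (spec (laurent K d)) (spec (laurent K d')) -> (d <= d')%N.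
Proof.
move=> q0 q1 h; have [c ch] := laurent_chain_ex d q0 q1.
have [c' ch'] := homeomorphic_chain h ch; exact: laurent_chain_le ch'.
Qed.

(** * Strata of quantum matrices *)

(** The element [g1] acting as the identity puts the core, here the kernel of [f], inside each prime
    of the stratum, so that these primes correspond to primes of the quotient. *)
Lemma quotient_spec_equiv (K : fieldType) (A B : algType K) (f : {lrmorphism A -> B})
    (G : Type) (actA : G -> {lrmorphism A -> A}) (actB : G -> {lrmorphism B -> B}) (g1 : G) :
  (forall b, exists a, f a = b) -> (forall g a, f (actA g a) = actB g (f a)) ->
  (forall a, actA g1 a = a) ->
  spec_equiv [set P | prime_ideal P /\ [set x | forall g, P (actA g x)] = [set x | f x = 0]]
    (str0 actB).
Proof.
move=> fs fact act1.
pose c (I : set B) : set A := [set a | I (f a)].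
have c_ideal I : ideal I -> ideal (c I) by exact: ideal_preimage.
have e_ideal (I : set A) : ideal I -> ideal (f @` I).
  move=> idI; split.
  - by exists 0; [exact: ideal0|rewrite rmorph0].
  - by move=> _ _ [a Ia <-] [b Ib <-]; exists (a + b); [exact: idealD|rewrite rmorphD].
  - move=> r _ [a Ia <-]; have [b <-] := fs r.
    by exists (b * a); [exact: idealMl|rewrite rmorphM].
  - move=> r _ [a Ia <-]; have [b <-] := fs r.
    by exists (a * b); [exact: idealMr|rewrite rmorphM].
apply: (@spec_equiv_galois A B _ _ (fun I => f @` I) c) => //.
- by move=> I J IJ _ [a Ia <-]; exists a => //; exact: IJ.
- by move=> I J IJ a; exact: IJ.
- by move=> I _ a Ia; exists a.
- by move=> I _ b Ib; have [a E] := fs b; exists a => //; rewrite /c /= E.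
- move=> P [pP coreP]; have [idP nP1 PP] := (prime_idealP _).1 pP.
  have fP a : (f @` P) (f a) -> P a.
    move=> [p Pp E]; have : [set x | f x = 0] (p - a) by rewrite /= rmorphB /= E subrr.
    rewrite -coreP => /(_ g1); rewrite act1 => Ppa.
    by rewrite -[a](subKr p); exact: idealB.
  split=> //; split.
    apply/prime_idealP; split; first exact: e_ideal.
      by rewrite -(rmorph1 f) => /fP.
    move=> I J idI idJ IJ; have := PP _ _ (c_ideal _ idI) (c_ideal _ idJ).
    case=> [x y Ix Jy|s|s]; first by apply: fP; rewrite rmorphM; exact: IJ.
      by left=> b Ib; have [a E] := fs b; exists a => //; apply: s; rewrite /c /= E.
    by right=> b Ib; have [a E] := fs b; exists a => //; apply: s; rewrite /c /= E.
  move=> b Hb; have [a E] := fs b; rewrite -E in Hb *.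
  have : [set x | forall g, P (actA g x)] a by move=> g; apply: fP; rewrite fact.
  by rewrite coreP.
- move=> Q [pQ coreQ]; have [idQ nQ1 QQ] := (prime_idealP _).1 pQ.
  split=> //; last by move=> _ [a ca <-].
  split.
    apply/prime_idealP; split; [exact: c_ideal|by rewrite /c /= rmorph1|].
    move=> I J idI idJ IJ; have := QQ _ _ (e_ideal _ idI) (e_ideal _ idJ).
    case=> [_ _ [x Ix <-] [y Jy <-]|s|s].
    - by rewrite -rmorphM; exact: IJ.
    - by left=> a Ia; apply: s; exists a.
    - by right=> a Ia; apply: s; exists a.
  apply/seteqP; split=> a /=.
    by move=> Ha; apply: coreQ => g; rewrite -fact; exact: Ha.
  by move=> fa g; rewrite /c /= fact fa rmorph0; exact: ideal0.
Qed.

(** * Running all deletions, from the last box to the first *)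

Section ClassSpectrum.
Variables (m n : nat) (K : fieldType) (q : K).
Hypotheses (q_neq0 : q != 0) (q_not_root1 : forall k : nat, (0 < k)%N -> q ^+ k != 1).
Variables (G : Type) (chi : G -> 'I_m * 'I_n -> K) (g0 : G).
Hypothesis chi_neq0 : forall g s, chi g s != 0.
Hypothesis chi_rect : forall g i j a b, chi g (i, b) * chi g (j, a) = chi g (i, a) * chi g (j, b).
Hypothesis chi_mul : forall g h, exists gh, forall s, chi gh s = chi g s * chi h s.
Hypothesis chi_row : forall i, exists g, forall s, chi g s = if s.1 == i then q else 1.

(** [S] is the set of boxes whose generators are units at stage 0. Deletions may create or destroy
    nonzero generators, so [S] is tied to the initial [Y] in the sparse case only. *)
Lemma qclass_spec_equiv (k : nat) (A : algType K) (Y Yi : 'I_m * 'I_n -> A)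
    (act : G -> {lrmorphism A -> A}) : (k <= m * n)%N -> qclass q chi k Y Yi act ->
  exists S : {set 'I_m * 'I_n}, (sparse Y -> S = [set s | Y s != 0]%SET) /\
    forall d (bs : 'I_d -> {ffun 'I_m * 'I_n -> int}), lattice_basis (radical S) bs ->
      spec_equiv (str0 act) [set P : set (laurent K d) | prime_ideal P].
Proof.
elim: k A Y Yi act => [|k IH] A Y Yi act km qc.
  exists [set s | Y s != 0]%SET; split=> // d bs.
  exact: (qclass0_spec_equiv q_neq0 q_not_root1 g0 chi_neq0 chi_mul chi_row qc).
have [r rk] := pos_surj km.
have [Yr0|Yr0] := eqVneq (Y r) 0.
  exact: IH (ltnW km) (qclass_zero qc rk Yr0).
have [R [Y' [Yi' [act' [qc' eqv sp]]]]] :=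
  qclass_delete q_neq0 q_not_root1 chi_neq0 chi_rect qc rk Yr0.
have [S [SE HS]] := IH _ _ _ _ (ltnW km) qc'.
exists S; split=> [/sp[/SE -> H]|d bs lb].
  by apply/setP => s; rewrite !inE; congr (~~ _); apply/eqP/eqP => /H.
exact: spec_equiv_trans eqv (HS _ _ lb).
Qed.

End ClassSpectrum.

Section Strata.
Variables (m n : nat) (K : fieldType) (q : K).
Hypothesis q_neq0 : q != 0.
Local Notation box := ('I_m * 'I_n)%type.
Local Notation A := (qmat m n q).
Local Notation T := {h : 'I_(m + n) -> K | torus h}.
Local Notation Yg := (fun s : box => qmat_gen q s.1 s.2).

Lemma free_eval_mulB (X : choiceType) (B : algType K) (v : X -> B) k s t u w :
  free_eval v (gen K s * gen K t - k *: (gen K u * gen K w)) = v s * v t - k *: (v u * v w).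
Proof. by rewrite free_evalB free_evalZ !free_evalM !free_eval_gen. Qed.

Lemma qmat_universal (B : algType K) (v : box -> B) :
  (forall s, qmat_relator q s -> free_eval v s = 0) ->
  exists f : {lrmorphism A -> B}, forall s, f (Yg s) = v s.
Proof.
move=> v0; have [f fE] := quotalg_universal (@qmat_proper m n K q) v0.
by exists f => -[i a]; rewrite /qmat_gen fE /= free_eval_gen.
Qed.

Lemma qmat_generated : generated Yg.
Proof.
have := generated_image (f := quotalg_pi (@qmat_proper m n K q))
  (@freealg_generated K box) (@quotalg_surj _ _ _ _).
by move=> H S SS SY; apply: (H S) => // -[i a]; exact: (SY (i, a)).
Qed.

Lemma qmat_relation (B : algType K) (f : {lrmorphism A -> B}) s :
  qmat_relator q s -> free_eval (f \o Yg) s = 0.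
Proof.
move=> rs; rewrite -(free_eval_uniq (f := f \o quotalg_pi (@qmat_proper m n K q))).
  have /quotalg_pi_eq0 E : ideal_gen (@qmat_relator m n K q) s by exact: sub_ideal_gen.
  by rewrite /= E rmorph0.
by case.
Qed.

Lemma qmat_comm (B : algType K) (f : {lrmorphism A -> B}) (p s : box) :
  (pos p < pos s)%N -> ~~ nw p s -> f (Yg p) * f (Yg s) = q ^ omega p s *: (f (Yg s) * f (Yg p)).
Proof.
case: p s => [i a] [j b]; rewrite pos_lt /nw /= => l ns.
have [ij|/eqP E] : (i < j)%N \/ i == j by lia.
  have [ab|/eqP E] : (b < a)%N \/ a == b by move: ns; rewrite ij -val_eqE /=; lia.
    have := qmat_relation f (QmatAnti q ij ab); rewrite -[X in _ - X]scale1r free_eval_mulB.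
    rewrite scale1r /= => /subr0_eq ->.
    by rewrite /omega -!val_eqE /= (ltn_eqF ij) (gtn_eqF ab) !mul0r expr0z scale1r.
  have := qmat_relation f (QmatCol q a ij); rewrite -E free_eval_mulB /= => /subr0_eq ->.
  rewrite scalerA /omega -val_eqE /= (ltn_eqF ij) eqxx ij [(j < i)%N]ltnNge (ltnW ij) mul0r.
  by rewrite add0r subr0 mul1r expr1z mulfV // scale1r.
rewrite -E ltnn eqxx /= in l *; have := qmat_relation f (QmatRow q i l).
rewrite free_eval_mulB /= => /subr0_eq ->.
rewrite scalerA /omega -!val_eqE /= (ltn_eqF l) eqxx l [(b < a)%N]ltnNge (ltnW l) mul0r.
by rewrite addr0 subr0 mul1r expr1z mulfV // scale1r.
Qed.

Definition weight (h : T) (s : box) : K := sval h (lshift n s.1) * sval h (rshift m s.2).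

Lemma torus_auto : exists act : T -> {lrmorphism A -> A}, forall h x,
  act h x = torus_act (sval h) x.
Proof.
suff H (h : T) : exists f : {lrmorphism A -> A}, forall x, f x = torus_act (sval h) x.
  by exists (fun h => projT1 (cid (H h))) => h x; case: cid.
have [fD fM f1 fZ] := torus_act_lrmorphism q (sval h).
have [f fE] := lrmorphism_exists fD fM f1 fZ.
by exists f.
Qed.

Lemma weight_neq0 h s : weight h s != 0.
Proof. by rewrite mulf_neq0 //; exact: (svalP h). Qed.

Lemma weight_rect h (i j : 'I_m) (a b : 'I_n) :
  weight h (i, b) * weight h (j, a) = weight h (i, a) * weight h (j, b).
Proof. by rewrite /weight /=; ring. Qed.

Lemma weight_mul g h : exists gh, forall s, weight gh s = weight g s * weight h s.
Proof.
have t : torus (fun k => sval g k * sval h k).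
  by move=> k; rewrite mulf_neq0 //; [exact: (svalP g)|exact: (svalP h)].
by exists (exist _ _ t) => s; rewrite /weight /=; ring.
Qed.

Lemma weight_row (i : 'I_m) : exists h, forall s, weight h s = if s.1 == i then q else 1.
Proof.
have t : torus (fun k => if k == lshift n i then q else 1).
  by move=> k /=; case: ifP => // _; exact: oner_neq0.
by exists (exist _ _ t) => s; rewrite /weight /= eq_rlshift mulr1 (inj_eq (@lshift_inj _ _)).
Qed.

Lemma torus1 : torus (fun _ : 'I_(m + n) => 1 : K).
Proof. by move=> k; exact: oner_neq0. Qed.

Lemma torusV (h : 'I_(m + n) -> K) : torus h -> torus (fun k => (h k)^-1).
Proof. by move=> th k; rewrite /= invr_eq0; exact: th. Qed.

Section Automorphisms.
Variable act : T -> {lrmorphism A -> A}.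
Hypothesis actE : forall h x, act h x = torus_act (sval h) x.

Lemma act_gen h s : act h (Yg s) = weight h s *: Yg s.
Proof. by rewrite actE torus_act_gen. Qed.

Lemma act1 x : act (exist _ _ torus1) x = x.
Proof.
suff /(_ x) : act (exist _ _ torus1) =1 idfun by [].
by apply: (generated_eq qmat_generated) => s; rewrite act_gen /weight /= mul1r scale1r.
Qed.

Lemma actV h x : act h (act (exist _ _ (torusV (svalP h))) x) = x.
Proof.
have := generated_eq (f := act h \o act (exist _ _ (torusV (svalP h)))) (g := idfun)
  qmat_generated.
apply=> s /=; rewrite act_gen linearZ /= act_gen scalerA /weight /=.
by rewrite mulrACA !mulVf ?mulr1 ?scale1r //; exact: (svalP h).
Qed.

Lemma stable_invariant I : stable act I -> torus_invariant I.
Proof.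
move=> sI h th; pose g : T := exist _ h th.
apply/seteqP; split=> [_ [x Ix <-]|x Ix].
  by rewrite -(actE g); exact: sI.
exists (act (exist _ _ (torusV (svalP g))) x); first exact: sI.
by rewrite -(actE g) actV.
Qed.

Lemma invariant_stable I : torus_invariant I -> stable act I.
Proof. by move=> iI h x Ix; rewrite actE -(iI _ (svalP h)); exists x. Qed.

(** The image of [P] under [h] is its preimage under the inverse of [h], and inverses run over the
    whole torus. *)
Lemma torus_coreE P : torus_core P = [set x | forall h, P (act h x)].
Proof.
apply/seteqP; split=> x /= Hx.
  move=> h; have [y Py <-] := Hx _ (torusV (svalP h)).
  by rewrite -(actE (exist _ _ (torusV (svalP h)))) actV.
move=> h th; pose g : T := exist _ h th.
exists (act (exist _ _ (torusV (svalP g))) x); first exact: Hx.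
by rewrite -(actE g) actV.
Qed.

(** The entry point of the algorithm: at stage [m * n] every correction is present and no generator
    has been inverted, so [Yi] is zero throughout. *)
Lemma torus_prime_class J : torus_prime J ->
  exists (B : algType K) (f : {lrmorphism A -> B}) (actB : T -> {lrmorphism B -> B}),
  [/\ forall x, f x = 0 <-> J x, qclass q weight (m * n) (f \o Yg) (fun=> 0) actB &
      spec_equiv [set P | prime_ideal P /\ torus_core P = J] (str0 actB)].
Proof.
move=> [idJ nJ invJ primeJ].
have genJ : ideal_gen J = J.
  by apply/seteqP; split=> [x|]; [apply; split|exact: sub_ideal_gen].
have pJ : ~ ideal_gen J 1.
  rewrite genJ => J1; apply: (negP nJ); apply/eqP/seteqP; split=> // x _.
  by rewrite -[x]mulr1; exact: idealMl.
pose f : {lrmorphism A -> quotalg pJ} := quotalg_pi pJ.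
have fs b : exists a, f a = b by exact: quotalg_surj.
have fJ x : f x = 0 <-> J x by rewrite quotalg_pi_eq0 genJ.
have /choice[actB actBE] (h : T) : exists g : {lrmorphism quotalg pJ -> quotalg pJ},
    forall a, g (f a) = f (act h a).
  apply: (quotalg_universal pJ (f := f \o act h)) => s Js /=.
  by apply/fJ; exact: invariant_stable.
exists (quotalg pJ), f, actB; split=> //.
  split.
  - move=> S SS SY; apply: (generated_image qmat_generated fs) => // s.
    exact: (SY (s, true)).
  - by move=> h s; rewrite /= actBE act_gen linearZ.
  - move=> p s nps nsp; have [l|l|/pos_inj ->] := ltngtP (pos p) (pos s).
    + exact: qmat_comm.
    + by rewrite (qmat_comm f l nsp) omegaC scalerA -expfzDr // addNr expr0z scale1r.
    + by rewrite /omega /= !ltnn !subrr !mulr0 addr0 expr0z scale1r.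
  - move=> i j a b ij ab; rewrite pos_max.
    have := qmat_relation f (QmatDiag q ij ab).
    rewrite free_evalB free_eval_mulB free_evalM 2!free_eval_gen.
    exact: subr0_eq.
  - by move=> s; rewrite leqNgt pos_max.
  - by [].
  move=> I1 I2 id1 s1 id2 s2 I12.
  pose c (I : set (quotalg pJ)) : set A := [set a | I (f a)].
  have c_ideal I : ideal I -> ideal (c I) by exact: ideal_preimage.
  have c_inv I : stable actB I -> torus_invariant (c I).
    by move=> sI; apply: stable_invariant => h x Ix; rewrite /c /= -actBE; exact: sI.
  have [|s|s] := primeJ _ _ (c_ideal _ id1) (c_inv _ s1) (c_ideal _ id2) (c_inv _ s2).
  - move=> z /(_ J); apply; split=> // _ [x [y [Ix Iy ->]]].
    by apply/fJ; rewrite rmorphM; exact: I12.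
  - by left=> b Ib; have [a E] := fs b; rewrite -E in Ib *; apply/fJ; exact: s.
  - by right=> b Ib; have [a E] := fs b; rewrite -E in Ib *; apply/fJ; exact: s.
have := quotient_spec_equiv (g1 := exist _ _ torus1) fs (fun h a => esym (actBE h a)) act1.
have -> : [set x | f x = 0] = J by apply/seteqP; split=> x /fJ.
by under eq_set do rewrite -torus_coreE.
Qed.

End Automorphisms.
End Strata.

Section Dimensions.
Variables (m n : nat) (K : fieldType) (q : K).
Hypotheses (q_neq0 : q != 0) (q_not_root1 : forall k : nat, (0 < k)%N -> q ^+ k != 1).
Local Notation box := ('I_m * 'I_n)%type.
Local Notation A := (qmat m n q).
Local Notation Yg := (fun s : box => qmat_gen q s.1 s.2).

(** The dimension enters through an arbitrary lattice basis of the radical, which allows a bounded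
    basis in one direction and an explicit one in the other. *)
Lemma stratum_dim_basis J : torus_prime J ->
  exists S : {set box},
    ((forall p s : box, nw s p -> J (qmat_gen q s.1 p.2 * qmat_gen q p.1 s.2)) ->
      forall s, s \in S <-> ~ J (Yg s)) /\
    forall d (bs : 'I_d -> {ffun box -> int}), lattice_basis (radical S) bs -> stratum_dim J d.
Proof.
have [act actE] := torus_auto m n q.
move=> pJ; have [B [f [actB [fJ qc eqv]]]] := torus_prime_class q_neq0 actE pJ.
have [S [SE HS]] := qclass_spec_equiv q_neq0 q_not_root1 (exist _ _ (@torus1 m n K))
  (@weight_neq0 m n K) (@weight_rect m n K) (@weight_mul m n K) (@weight_row m n K q q_neq0)
  (leqnn _) qc.
exists S; split=> [sp s|d bs /HS H].
  rewrite SE ?inE; last by move=> p s' np; rewrite /= -rmorphM; apply/fJ; exact: sp.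
  rewrite -(fJ (Yg s)); split=> [/eqP//|H]; exact/eqP.
apply: spec_equiv_homeomorphic (spec_equiv_trans eqv H); last by move=> P [].
by move=> P; split=> [|[]] //= PJ; split=> //; exact: spec_prime.
Qed.

(** * Strata of prescribed dimension from diagonal boxes *)

Section Diagonal.
Variable d : nat.
Hypotheses (dm : (d <= m)%N) (dn : (d <= n)%N).
Local Notation L := (laurent K d).

Let D (k : 'I_d) : box := (widen_ord dm k, widen_ord dn k).
(** [insub] reads the row of [s] as an index below [d]; rows beyond [d] get the default value 0. *)
Let v (s : box) : L :=
  oapp (fun k : 'I_d => if s == D k then zgen K (k, true) else 0) 0 (insub (s.1 : nat)).

Let v_D k : v (D k) = zgen K (k, true).
Proof. by rewrite /v /= valK /= eqxx. Qed.

Let v_out (s : box) : (forall k, s != D k) -> v s = 0.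
Proof. by move=> H; rewrite /v; case: insubP => //= k _ _; rewrite (negPf (H k)). Qed.

Let D_offdiag (s : box) k : s.1 != s.2 :> nat -> s != D k.
Proof. by apply: contraNneq => ->. Qed.

Let v_diag (s : box) : s.1 != s.2 :> nat -> v s = 0.
Proof. by move=> ns; apply: v_out => k; exact: D_offdiag. Qed.

Let v_mul (s p : box) : ((s.1 != s.2 :> nat) || (p.1 != p.2 :> nat)) -> v s * v p = 0.
Proof. by case/orP => /v_diag ->; rewrite ?mul0r ?mulr0. Qed.

Let v_relator s : qmat_relator q s -> free_eval v s = 0.
Proof.
case=> [i a b ab|i j a ij|i j a b ij ba|i j a b ij ab].
- by rewrite free_eval_mulB !v_mul ?scaler0 ?subrr //= -?val_eqE /=; lia.
- by rewrite free_eval_mulB !v_mul ?scaler0 ?subrr //=; lia.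
- rewrite free_evalB [X in X - _]free_evalM free_evalM 2!free_eval_gen.
  by rewrite laurentC subrr.
rewrite 2!free_evalB free_evalZ [X in X - _]free_evalM [X in _ - (X - _)]free_evalM
  free_evalM 4!free_eval_gen (@v_mul (i, b) (j, a)) /=; last by lia.
by rewrite scaler0 subr0 laurentC subrr.
Qed.

Lemma diagonal_stratum : exists J : set A, torus_prime J /\ stratum_dim J d.
Proof.
have [f fE] := qmat_universal v_relator.
pose J : set A := [set x | f x = 0].
have [idJ J1 JP] : prime_ideal J := prime_kernel q_neq0 q_not_root1 f.
have [act actE] := torus_auto m n q.
have sJ : stable act J.
  (* The map to the Laurent algebra carries the action of [h] to the automorphism scaling the [k]-th
     variable by [w k], so its kernel is stable. *)
  move=> h; pose w k := weight h (D k).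
  have wV k : (w k *: zgen K (k, true)) * ((w k)^-1 *: zgen K (k, false)) = 1.
    rewrite -scalerAl -scalerAr scalerA zgenV mulfV ?scale1r //; exact: weight_neq0.
  have [|k l|s sE] := laurent_universal wV; [by move=> k; rewrite laurentC|exact: laurentC|].
  have fs : f \o act h =1 s \o f.
    apply: (generated_eq (f := f \o act h) (g := s \o f) (@qmat_generated m n K q)) => b.
    rewrite /= (act_gen actE) linearZ /= fE.
    have [[k ->]|nD] := pselect (exists k, b = D k); first by rewrite v_D (sE k).1.
    by rewrite v_out ?rmorph0 ?scaler0 // => k; apply: contra_notN nD => /eqP ->; exists k.
  by move=> x fx; rewrite /J /= -[f _]/((f \o act h) x) fs /= fx rmorph0.
have pJ : torus_prime J.
  split=> //; first exact: stable_invariant actE _ sJ.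
  by move=> I1 I2 id1 _ id2 _; exact: JP.
exists J; split=> //.
have [S [SE HS]] := stratum_dim_basis pJ.
(* The antidiagonal product attached to a north-west pair always has an off-diagonal factor, so the
   sparse case applies and [S] consists of the chosen diagonal boxes. *)
have SD s : s \in S <-> exists k, s = D k.
  rewrite SE; last first.
    move=> [p1 p2] [s1 s2] /andP[/= l1 l2]; rewrite /J /= rmorphM /=.
    have /= -> := fE (s1, p2); have /= -> := fE (p1, s2).
    by rewrite v_mul //=; lia.
  rewrite /J /= (fE s); split=> [H|[k ->]].
    apply: contrapT => nD; apply: H; apply: v_out => k.
    by apply: contra_notN nD => /eqP ->; exists k.
  rewrite v_D; apply/eqP; apply: contraTneq (oner_neq0 L) => z0.
  by rewrite -(zgenV K k) z0 mul0r eqxx.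
(* The form vanishes on [S], so its radical is the whole lattice of vectors supported on [S], of
   rank [d]. *)
have omega0 k l : omega (D k) (D l) = 0.
  have [kl|kl|E] := ltngtP k l.
  - by apply: omega_nw; rewrite /nw /= kl.
  - by rewrite omegaC omega_nw ?oppr0 // /nw /= kl.
  - by rewrite /omega /= E !ltnn !subrr !mulr0.
have Dinj : injective D by move=> k l [E _]; exact: val_inj.
pose bs k : {ffun box -> int} := [ffun s => (s == D k)%:Z].
have bsE (a : 'I_d -> int) s : (\sum_k bs k *~ a k) s = \sum_k (s == D k)%:Z * a k.
  rewrite sum_ffunE; apply: eq_bigr => k _.
  by rewrite ffunMzE ffunE -mulrzz.
have bsD (a : 'I_d -> int) k : (\sum_k bs k *~ a k) (D k) = a k.
  rewrite bsE (bigD1 k) //= eqxx mul1r big1 ?addr0 // => l lk.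
  by rewrite (inj_eq Dinj) eq_sym (negPf lk) mul0r.
apply: (HS d bs); split.
- move=> k; split=> [s sS|s /SD[l ->]].
    by rewrite ffunE; case: eqP => // E; case/negP: sS; apply/SD; exists k.
  apply: big1 => p _; rewrite ffunE; case: eqP => [->|_]; last by rewrite mul0r.
  by rewrite omega0 mulr0.
- move=> e [e0 _]; exists [ffun k => e (D k)]; apply/ffunP => s.
  have [sS|sS] := boolP (s \in S); first by have /SD[k ->] := sS; rewrite bsD ffunE.
  rewrite e0 // bsE big1 // => k _; case: eqP => [E|_]; last by rewrite mul0r.
  by case/negP: sS; apply/SD; exists k.
- by move=> a a0; apply/ffunP => k; rewrite -bsD a0 !ffunE.
Qed.

End Diagonal.
End Dimensions.

Theorem theorem1p1 (m n : nat) (K : fieldType) (q : K)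
    (m_gt0 : (0 < m)%N) (n_gt0 : (0 < n)%N)
    (q_neq0 : q != 0) (q_not_root1 : forall k : nat, (0 < k)%N -> q ^+ k != 1) :
  (forall J : set (qmat m n q), torus_prime J ->
     (exists d : nat, stratum_dim J d) /\
     (forall d : nat, stratum_dim J d -> (d <= minn m n)%N)) /\
  (forall d : nat, (d <= minn m n)%N ->
     exists J : set (qmat m n q), torus_prime J /\ stratum_dim J d).
Proof.
split=> [J pJ|d]; last first.
  by rewrite leq_min => /andP[dm dn]; exact: (diagonal_stratum q_neq0 q_not_root1 dm dn).
have [S [_ HS]] := stratum_dim_basis q_neq0 q_not_root1 pJ.
have [d [bs [lb dmn]]] := radical_basis S.
split=> [|d' Hd']; first by exists d; exact: HS lb.
(* Any other dimension [d'] of the same stratum is compared with the rank [d] of the radical, which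
   is the quantity known to be bounded. *)
apply: leq_trans dmn; apply: (laurent_dim_le q_neq0 q_not_root1).
exact: homeomorphic_trans (homeomorphic_sym Hd') (HS _ _ lb).
Qed.
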